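(* Let $d\in\mathbb{N}$ be fixed and let $X_i$, $i\in\mathbb{N}$, be i.i.d. random vectors on $(\Omega,\mathcal{A},\mathbb{P})$ with values in $\mathbb{R}^d$ such that $\mathbb{E}[X_1]=0$ and $\mathbb{E}[\|X_1\|^2]<\infty$. Let $V_n:=n\|\overline{X}_n\|^2$ with $\overline{X}_n:=n^{-1}\sum_{i=1}^nX_i$, and let $c_{n,\alpha}^*$ be the bootstrap critical value. Then for each $\alpha\in(0,1)$ the test that rejects $H_0:\mu=0$ (where $\mu=\mathbb{E}[X_1]$) if $V_n>c_{n,\alpha}^*$ satisfies $$\mathbb{P}(H_0\text{ is rejected at level }\alpha)=\mathbb{P}(V_n>c_{n,\alpha}^* )\to\alpha,\quad n\to\infty.$$
   Context: $\|\cdot\|$ is the Euclidean norm on $\mathbb{R}^d$. Bootstrap construction: for every $n\in\mathbb{N}$ let $i_{n1},\ldots,i_{nn}$ be random variables on some probability space $(\Omega^*,\mathcal{A}^*,\mathbb{P}^* )$ that are $\mathbb{P}^*$-independent and each uniformly distributed on $\{1,\ldots,n\}$. For $\omega\in\Omega$ and $1\le k\le n$ define $\xi_{nk}(\omega):\Omega^*\to\mathbb{R}^d$ by $\xi_{nk}(\omega)(\omega^* ):=X_{i_{nk}(\omega^* )}(\omega)$. Put $\overline{\xi}_n(\omega):=n^{-1}\sum_{i=1}^n(\xi_{ni}(\omega)-\overline{X}_n(\omega))$ and $V_n^*(\omega):=n\|\overline{\xi}_n(\omega)\|^2$, a random variable on $(\Omega^*,\mathcal{A}^*,\mathbb{P}^*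 )$ for each fixed $\omega$. Let $F_n^*(\omega)$ be the distribution function of $V_n^*(\omega)$ under $\mathbb{P}^*$ and $c_{n,\alpha}^*(\omega):=(F_n^*(\omega))^{-1}(1-\alpha)$, where $G^{-1}(u)=\inf\{x\in\mathbb{R}:G(x)\ge u\}$ denotes the quantile function of a distribution function $G$. Thus $c_{n,\alpha}^*$ is a random variable on $\Omega$.
   Formalization: The formal statement additionally assumes that X_1 is not almost surely 0; if X_1 = 0 a.s., then V_n and c*_{n,α} both vanish a.s., so the rejection probability is 0 and does not tend to α. *)

(* Defs.v *)
From HB Require Import structures.
From mathcomp Require Import all_boot all_order all_algebra finmap.
From mathcomp Require Import all_classical all_reals all_analysis.
From mathcomp Require Import measurable_realfun.

Set Implicit Arguments.
Unset Strict Implicit.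
Unset Printing Implicit Defensive.

Import Order.TTheory GRing.Theory Num.Theory.
Import numFieldNormedType.Exports.

Local Open Scope classical_set_scope.
Local Open Scope ring_scope.

(* Random vectors take values in [d.-tuple R], whose sigma-algebra is the
   product (= Borel) one; the linear structure of R^d is that of ['rV[R]_d]. *)
Definition vec (R : realType) (d : nat) (x : d.-tuple R) : 'rV[R]_d :=
  \row_(j < d) tnth x j.

(* The canonical norm of ['rV[R]_d] is the sup norm, not the Euclidean one. *)
Definition enorm (R : realType) (d : nat) (x : 'rV[R]_d) : R :=
  Num.sqrt (\sum_(j < d) x 0 j ^+ 2).

Definition mutually_independent (dO dT : measure_display)
    (O : measurableType dO) (T : measurableType dT) (R : realType)
    (P : probability O R) (K : choiceType) (D : set K)
    (Y : K -> {RV P >-> T}) : Prop :=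
  forall (J : {fset K}) (B : K -> set T),
    [set` J] `<=` D -> (forall k, measurable (B k)) ->
    P (\bigcap_(k in [set` J]) (Y k @^-1` B k)) =
    (\prod_(k <- J) P (Y k @^-1` B k))%E.

Definition identically_distributed (dO dT : measure_display)
    (O : measurableType dO) (T : measurableType dT) (R : realType)
    (P : probability O R) (K : Type) (Y : K -> {RV P >-> T}) : Prop :=
  forall (k l : K) (B : set T), measurable B ->
    distribution P (Y k) B = distribution P (Y l) B.

Definition quantile (R : realType) (G : R -> \bar R) (u : R) : R :=
  inf [set x : R | (u%:E <= G x)%E].

(* Indices start at 0: [X i] is the (i+1)-st observation, and the resampling
   indices of row [n] are the [idx n k], k < n, with values in {0, .., n-1}. *)
Definition sample_mean (R : realType) (d : nat) (dO : measure_display)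
    (O : measurableType dO) (P : probability O R)
    (X : nat -> {RV P >-> d.-tuple R}) (n : nat) (w : O) : 'rV[R]_d :=
  n%:R^-1 *: \sum_(i < n) vec (X i w).

Definition Vn (R : realType) (d : nat) (dO : measure_display)
    (O : measurableType dO) (P : probability O R)
    (X : nat -> {RV P >-> d.-tuple R}) (n : nat) (w : O) : R :=
  n%:R * enorm (sample_mean X n w) ^+ 2.

Definition resampling_indices (R : realType) (dS : measure_display)
    (S : measurableType dS) (Q : probability S R)
    (idx : nat -> nat -> {RV Q >-> nat}) : Prop :=
  forall n : nat,
    mutually_independent [set k | (k < n)%N] (idx n) /\
    forall k j : nat, (k < n)%N -> (j < n)%N ->
      distribution Q (idx n k) [set j] = (n%:R^-1)%:E.

Section bootstrap.
Context (R : realType) (d : nat).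
Context (dO : measure_display) (O : measurableType dO) (P : probability O R).
Context (dS : measure_display) (S : measurableType dS) (Q : probability S R).
Context (X : nat -> {RV P >-> d.-tuple R}) (idx : nat -> nat -> {RV Q >-> nat}).
Context (n : nat).

Definition xi (k : nat) (w : O) (s : S) : 'rV[R]_d := vec (X (idx n k s) w).

Definition xi_mean (w : O) (s : S) : 'rV[R]_d :=
  n%:R^-1 *: \sum_(i < n) (xi i w s - sample_mean X n w).

Definition Vstar (w : O) (s : S) : R := n%:R * enorm (xi_mean w s) ^+ 2.

Lemma measurable_Vstar w : measurable_fun [set: S] (Vstar w).
Proof.
have -> : Vstar w = fun s => n%:R * \sum_(j < d) (n%:R^-1 *
    \sum_(i < n) (tnth (X (idx n i s) w) j - sample_mean X n w 0 j)) ^+ 2.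
  apply/funext => s; rewrite /Vstar /enorm sqr_sqrtr ?sumr_ge0//; last first.
    by move=> j _; rewrite sqr_ge0.
  congr (_ * _); apply: eq_bigr => j _; rewrite !mxE summxE.
  by congr ((_ * _) ^+ 2); apply: eq_bigr => i _; rewrite !mxE.
apply: measurable_funM => //; apply: measurable_sum => j.
apply: measurable_funX; apply: measurable_funM => //.
apply: measurable_sum => i; apply: measurable_funB => //.
by apply: (@measurableT_comp _ _ _ _ _ _ (fun m : nat => tnth (X m w) j)).
Qed.

HB.instance Definition _ (w : O) :=
  isMeasurableFun.Build _ _ S R (Vstar w) (measurable_Vstar w).

Definition Fstar (w : O) : R -> \bar R := cdf (Vstar w : {RV Q >-> R}).

Definition cstar (alpha : R) (w : O) : R := quantile (Fstar w) (1 - alpha).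

End bootstrap.

(* Main.v *)
(* Fix the data and write p_a, a < n, for the centered observations divided by
   sqrt n. The bootstrap expectation of f is T^n f (0), where T averages f over
   the translations by the p_a. For f with bounded third derivatives, Lindeberg's
   replacement argument gives |E f (S_n / sqrt n) - T^n f (0)| -> 0 as soon as the
   first two sample moments are close to the true ones and the Lindeberg sum is
   small; by the weak law this holds with probability close to 1. So the laws of
   V_n and V_n^* are close on smooth radial test functions.

   To pass to distribution functions one only needs that V_n does not concentrate
   on short intervals. Again by Lindeberg, T may be replaced by any T' with the
   same first two moments. Choose a coordinate with positive variance, regress the
   p_a on it, and replace the explained part by a Rademacher multiple e u of a
   fixed vector u. Conditionally on the residuals, the squared norm of the sum is
   a quadratic polynomial with leading coefficient |u|^2 in a simple random walk,
   whose atoms have mass at most n^(-1/2); hence it lies in an interval of length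
   w with probability O(sqrt w + n^(-1/2)). No Gaussian limit is needed: since
   F_n and F_n^* are uniformly close and F_n has small increments, the bootstrap
   quantile lies between two deterministic points where F_n is nearly 1 - alpha. *)

Require Import Defs.
From HB Require Import structures.
From mathcomp Require Import all_boot all_order all_algebra finmap.
From mathcomp Require Import all_classical all_reals all_analysis.
From mathcomp Require Import measurable_realfun ring lra zify.

Set Implicit Arguments.
Unset Strict Implicit.
Unset Printing Implicit Defensive.

Import Order.TTheory GRing.Theory Num.Theory.
Import numFieldNormedType.Exports.

Local Open Scope classical_set_scope.
Local Open Scope ring_scope.

(** * Smooth cutoff functions of the squared norm *)

Section taylor.
Context {R : realType}.
Implicit Types (f g : R -> R).

(** Only second moments are finite, so a cubic Taylor remainder cannot be integrated against the
    data. Errors are measured by [mu] instead, which is cubic for small and quadratic for large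
    increments; Lindeberg's condition then says that [n] times the mean of [mu] is small. The
    constants are chosen in a fixed order. The constant [K] of a cutoff grows as its transition
    narrows or moves outwards, so a width [delta] and a bound [M] on the thresholds come first;
    tightness of V_n confines the relevant thresholds to such a range. Next come [K], the closeness
    [g] of the sample averages to their limits, and last [n]. The exceptional event only concerns
    finitely many averages of the data, so one event serves all thresholds. Tightness and small
    increments of F_n do not mention the data, yet they are proved through them: the exceptional
    event has probability below 1, so one good sample exists, and its iterated average is close to
    the true expectation. A sample is a finite set of points, on which regression is exact
    algebra. *)

Lemma derive_bound01 f df (K : R) :
  (forall t, is_derive t (1 : R) f (df t)) ->
  (forall t, 0 <= t <= 1 -> `|df t| <= K) ->
  forall t, 0 <= t <= 1 -> `|f t - f 0| <= K.
Proof.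
move=> fdf dfK t /andP[t0 t1].
have fc : {within `[0, t], continuous f}.
  apply: continuous_subspaceT => x.
  apply/differentiable_continuous/derivable1_diffP.
  exact: (@ex_derive _ _ _ _ _ _ _ (fdf x)).
have [c c0t ->] := MVT_segment t0 (fun x _ => fdf x) fc.
rewrite subr0 normrM (ger0_norm t0).
move: c0t; rewrite in_itv/= => /andP[c0 ct].
have c1 : 0 <= c <= 1 by rewrite c0 (le_trans ct).
apply: le_trans (dfK _ c1); rewrite -[leRHS]mulr1.
by apply: ler_wpM2l.
Qed.

Lemma taylor2_01 (f f1 f2 : R -> R) (K : R) :
  (forall t, is_derive t (1 : R) f (f1 t)) ->
  (forall t, is_derive t (1 : R) f1 (f2 t)) ->
  (forall t, 0 <= t <= 1 -> `|f2 t| <= K) ->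
  `|f 1 - f 0 - f1 0| <= K.
Proof.
move=> ff1 f1f2 f2K.
have h01 : (0 : R) <= (1 : R) <= 1.
  by rewrite lexx ler01.
have d1 t : is_derive t (1 : R) (fun t => f t - f1 0 * t) (f1 t - f1 0).
  apply: is_derive_eq.
  by rewrite /GRing.scale/=; ring.
have := derive_bound01 d1 (derive_bound01 f1f2 f2K) h01.
by rewrite mulr1 mulr0 subr0; congr (`|_| <= _); ring.
Qed.

(** The mean value inequality is applied three times on [[0, 1]], which costs the factor 1/6; only
    finiteness of the constant matters. *)
Lemma taylor3_01 (f f1 f2 f3 : R -> R) (K : R) :
  (forall t, is_derive t (1 : R) f (f1 t)) ->
  (forall t, is_derive t (1 : R) f1 (f2 t)) ->
  (forall t, is_derive t (1 : R) f2 (f3 t)) ->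
  (forall t, 0 <= t <= 1 -> `|f3 t| <= K) ->
  `|f 1 - f 0 - f1 0 - f2 0 / 2| <= K.
Proof.
move=> ff1 f1f2 f2f3 f3K.
have d1 t : is_derive t (1 : R) (fun t => f t - f2 0 / 2 * t ^+ 2)
    (f1 t - f2 0 * t).
  apply: is_derive_eq.
  rewrite /GRing.scale/=. by lra.
have d2 t : is_derive t (1 : R) (fun t => f1 t - f2 0 * t) (f2 t - f2 0).
  apply: is_derive_eq.
  by rewrite /GRing.scale/=; ring.
have := taylor2_01 d1 d2 (derive_bound01 f2f3 f3K).
by congr (`|_| <= _); field.
Qed.

End taylor.
Section smooth_step.
Context {R : realType}.

Definition pospart (t : R) : R := Num.max 0 t.

Lemma pospart_ge0 t : 0 <= pospart t.
Proof. by rewrite le_max lexx. Qed.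

Lemma pospart_eq0 t : t <= 0 -> pospart t = 0.
Proof. by move=> t0; apply/max_idPl. Qed.

Lemma pospart_id t : 0 <= t -> pospart t = t.
Proof. by move=> t0; apply/max_idPr. Qed.

Lemma pospart_le t (c : R) : 0 <= c -> t <= c -> pospart t <= c.
Proof. by move=> c0 tc; rewrite ge_max c0. Qed.

(** The positive part has a kink at 0, so the chain rule does not differentiate its square there. A
    remainder bounded by [h ^+ 2] can be checked for all signs of [t] and [h + t]. *)
Lemma is_derive_quadratic_remainder (f : R -> R) (t l : R) :
  (forall h, `|f (h + t) - f t - h * l| <= h ^+ 2) ->
  is_derive t (1 : R) f l.
Proof.
move=> fl.
have cv : h^-1 *: (f (h *: (1 : R) + t) - f t) @[h --> 0^'] --> l.
  apply/cvgrPdist_le => e e0.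
  near=> h.
  have h0 : h != 0 by near: h; exact: nbhs_dnbhs_neq.
  have -> : l - h^-1 *: (f (h *: (1 : R) + t) - f t) =
      - (h^-1 * (f (h + t) - f t - h * l)).
    by rewrite /GRing.scale/= mulr1; field.
  rewrite normrN normrM normfV ler_pdivrMl ?normr_gt0//.
  apply: le_trans (fl h) _.
  rewrite -real_normK ?num_real// expr2 ler_wpM2l//.
  by near: h; apply: dnbhs0_le.
apply: DeriveDef; first by apply/cvg_ex; exists l.
exact: cvg_lim cv.
Unshelve. all: end_near. Qed.

Lemma is_derive_pospart2 t :
  is_derive t (1 : R) (fun t => pospart t ^+ 2) (2 * pospart t).
Proof.
apply: is_derive_quadratic_remainder => h.
have [ht|/ltW ht] := leP (h + t) 0; have [t0|/ltW t0] := leP t 0;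
  rewrite ?(pospart_eq0 ht) ?(pospart_id ht) ?(pospart_eq0 t0) ?(pospart_id t0);
  rewrite ler_norml; apply/andP; split; nra.
Qed.

Lemma pospartM t : pospart t * t = pospart t ^+ 2.
Proof.
have [t0|/ltW t0] := leP t 0.
  by rewrite pospart_eq0// mul0r expr0n.
by rewrite pospart_id.
Qed.

Lemma is_derive_pospart3 t :
  is_derive t (1 : R) (fun t => pospart t ^+ 3) (3 * pospart t ^+ 2).
Proof.
(* One factor [pospart t], not differentiable at 0, is traded for [t]. *)
have -> : (fun t => pospart t ^+ 3) = (fun t => pospart t ^+ 2 * t).
  apply/funext => s; transitivity (pospart s * (pospart s * s)); last by ring.
  by rewrite pospartM; ring.
have := is_derive_pospart2 t => h.
apply: is_derive_eq.
rewrite /GRing.scale/=.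
by have := pospartM t; nra.
Qed.

Lemma is_derive_pospart4 t :
  is_derive t (1 : R) (fun t => pospart t ^+ 4) (4 * pospart t ^+ 3).
Proof.
have -> : (fun t => pospart t ^+ 4) = (fun t => (pospart t ^+ 2) ^+ 2).
  by apply/funext => s; rewrite -exprM.
have := is_derive_pospart2 t => h.
apply: is_derive_eq.
by rewrite /GRing.scale/=; ring.
Qed.

End smooth_step.
Section smooth_step_derivatives.
Context {R : realType}.
Local Notation p := (@pospart R).

(* [smoothstep] is C^3, vanishes for [t <= 0] and equals 1 for [t >= 1]; composing
   two fourth powers of positive parts keeps its derivatives explicit. *)
Definition ramp (t : R) : R := 1 - p (1 - t) ^+ 4.
Definition ramp1 (t : R) : R := 4 * p (1 - t) ^+ 3.
Definition ramp2 (t : R) : R := - 12 * p (1 - t) ^+ 2.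
Definition ramp3 (t : R) : R := 24 * p (1 - t).

Definition smoothstep (t : R) : R := p (ramp t) ^+ 4.
Definition smoothstep1 (t : R) : R := 4 * p (ramp t) ^+ 3 * ramp1 t.
Definition smoothstep2 (t : R) : R := 12 * p (ramp t) ^+ 2 * ramp1 t ^+ 2 +
  4 * p (ramp t) ^+ 3 * ramp2 t.
Definition smoothstep3 (t : R) : R := 24 * p (ramp t) * ramp1 t ^+ 3 +
  36 * p (ramp t) ^+ 2 * (ramp1 t * ramp2 t) +
  4 * p (ramp t) ^+ 3 * ramp3 t.

Lemma is_derive_comp (f g : R -> R) (df dg t : R) :
  is_derive (g t) (1 : R) f df -> is_derive t (1 : R) g dg ->
  is_derive t (1 : R) (fun s => f (g s)) (df * dg).
Proof.
exact: is_derive1_comp.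
Qed.

Lemma is_derive_onem (t : R) : is_derive t (1 : R) (fun s => 1 - s) (-1).
Proof. by apply: is_derive_eq; ring. Qed.

Lemma is_derive_ramp t : is_derive t (1 : R) ramp (ramp1 t).
Proof.
have h := is_derive_comp (g := fun s => 1 - s) (is_derive_pospart4 (1 - t))
  (is_derive_onem t).
by apply: is_derive_eq; rewrite /ramp1; ring.
Qed.

Lemma is_derive_ramp1 t : is_derive t (1 : R) ramp1 (ramp2 t).
Proof.
have h := is_derive_comp (g := fun s => 1 - s) (is_derive_pospart3 (1 - t))
  (is_derive_onem t).
by apply: is_derive_eq; rewrite /GRing.scale/= /ramp2; ring.
Qed.

Lemma is_derive_ramp2 t : is_derive t (1 : R) ramp2 (ramp3 t).
Proof.
have h := is_derive_comp (g := fun s => 1 - s) (is_derive_pospart2 (1 - t))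
  (is_derive_onem t).
by apply: is_derive_eq; rewrite /GRing.scale/= /ramp3; ring.
Qed.

Lemma is_derive_smoothstep t : is_derive t (1 : R) smoothstep (smoothstep1 t).
Proof.
exact: (is_derive_comp (g := ramp) (is_derive_pospart4 _)
  (is_derive_ramp t)).
Qed.

Lemma is_derive_smoothstep1 t : is_derive t (1 : R) smoothstep1 (smoothstep2 t).
Proof.
have h := is_derive_comp (g := ramp) (is_derive_pospart3 _)
  (is_derive_ramp t).
have h1 := is_derive_ramp1 t.
by apply: is_derive_eq; rewrite /GRing.scale/= /smoothstep2; ring.
Qed.

Lemma is_derive_smoothstep2 t : is_derive t (1 : R) smoothstep2 (smoothstep3 t).
Proof.
have h3 := is_derive_comp (g := ramp) (is_derive_pospart3 _)
  (is_derive_ramp t).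
have h2 := is_derive_comp (g := ramp) (is_derive_pospart2 _)
  (is_derive_ramp t).
have h1 := is_derive_ramp1 t.
have h4 := is_derive_ramp2 t.
by apply: is_derive_eq; rewrite /GRing.scale/= /smoothstep3; ring.
Qed.

Lemma ramp_le1 t : ramp t <= 1.
Proof. by rewrite /ramp gerBl exprn_even_ge0. Qed.

Lemma p_ramp_le1 t : 0 <= p (ramp t) <= 1.
Proof. by rewrite pospart_ge0 pospart_le// ramp_le1. Qed.

Lemma p_ramp_eq0 t : t <= 0 -> p (ramp t) = 0.
Proof.
move=> t0; apply: pospart_eq0; rewrite /ramp pospart_id; last by lra.
by rewrite subr_le0 exprn_ege1//; lra.
Qed.

Lemma smoothstep_ge0 t : 0 <= smoothstep t.
Proof. by rewrite exprn_ge0// pospart_ge0. Qed.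

Lemma smoothstep_le1 t : smoothstep t <= 1.
Proof. by have /andP[? ?] := p_ramp_le1 t; rewrite exprn_ile1. Qed.

Lemma smoothstep_eq0 t : t <= 0 -> smoothstep t = 0.
Proof. by move=> t0; rewrite /smoothstep p_ramp_eq0// expr0n. Qed.

Lemma smoothstep_eq1 t : 1 <= t -> smoothstep t = 1.
Proof.
move=> t1; rewrite /smoothstep /ramp (pospart_eq0 (t := 1 - t)); last by lra.
by rewrite expr0n subr0 pospart_id ?ler01// expr1n.
Qed.

Lemma smoothstep123_eq0 t : t <= 0 ->
  [/\ smoothstep1 t = 0, smoothstep2 t = 0 & smoothstep3 t = 0].
Proof.
move=> t0; rewrite /smoothstep1 /smoothstep2 /smoothstep3.
rewrite p_ramp_eq0// !expr0n/=.
by split; ring.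
Qed.

(** For [t > 0] the derivatives are polynomials in [u = p (1 - t)] and [v = p (ramp t)], both in
    [[0, 1]]. The constant is [24 * 64 + 36 * 48 + 96], the sum of the absolute coefficients of the
    third derivative; those of the first two sum to less. *)
Lemma smoothstep123_bound t :
  [/\ `|smoothstep1 t| <= 3360, `|smoothstep2 t| <= 3360 &
      `|smoothstep3 t| <= 3360].
Proof.
have [t0|/ltW t0] := leP t 0.
  by have [-> -> ->] := smoothstep123_eq0 t0; rewrite normr0; split; lra.
have := p_ramp_le1 t.
rewrite /smoothstep1 /smoothstep2 /smoothstep3 /ramp1 /ramp2 /ramp3.
have : 0 <= p (1 - t) <= 1 by rewrite pospart_ge0 pospart_le//; lra.
set u := p (1 - t); set v := p (ramp t) => /andP[u0 u1] /andP[v0 v1].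
have e k l : 0 <= u ^+ k * v ^+ l <= 1.
  by rewrite mulr_ge0 ?exprn_ge0//= mulr_ile1 ?exprn_ge0 ?exprn_ile1.
rewrite !ler_norml; split; apply/andP.
- have := e 3 3; split; nra.
- have := e 6 2; have := e 2 3; split; nra.
- have := e 9 1; have := e 5 2; have := e 1 3; split; nra.
Qed.

Lemma smoothstep123_bounded : exists2 C : R, 0 <= C &
  forall t, [/\ `|smoothstep1 t| <= C, `|smoothstep2 t| <= C &
    `|smoothstep3 t| <= C].
Proof. by exists 3360; [lra|exact: smoothstep123_bound]. Qed.

End smooth_step_derivatives.

(** * Second-order expansions of functions of the squared norm *)

Section euclidean.
Context {R : realType} {d : nat}.
Implicit Types (x y s : 'rV[R]_d).

Definition dotp x y : R := \sum_(j < d) x 0 j * y 0 j.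
Definition sqnorm x : R := \sum_(j < d) x 0 j ^+ 2.

Lemma sqnorm_ge0 x : 0 <= sqnorm x.
Proof. by apply: sumr_ge0 => j _; rewrite sqr_ge0. Qed.

Lemma sqnormZ (c : R) x : sqnorm (c *: x) = c ^+ 2 * sqnorm x.
Proof.
by rewrite /sqnorm big_distrr; apply: eq_bigr => j _; rewrite mxE exprMn.
Qed.

Lemma sqnorm0 : sqnorm 0 = 0.
Proof. by rewrite /sqnorm big1// => j _; rewrite mxE expr0n. Qed.

Lemma sqnormDZ x y (c : R) :
  sqnorm (x + c *: y) = sqnorm x + 2 * c * dotp x y + c ^+ 2 * sqnorm y.
Proof.
rewrite /sqnorm /dotp !big_distrr -!big_split/=; apply: eq_bigr => j _.
by rewrite !mxE; ring.
Qed.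

Lemma sqnormD x y : sqnorm (x + y) = sqnorm x + 2 * dotp x y + sqnorm y.
Proof. by have := sqnormDZ x y 1; rewrite scale1r mulr1 expr1n mul1r. Qed.

Lemma dotpDZl x y s (c : R) : dotp (x + c *: y) s = dotp x s + c * dotp y s.
Proof.
rewrite /dotp big_distrr -big_split/=; apply: eq_bigr => j _.
by rewrite !mxE; ring.
Qed.

Lemma dotpp x : dotp x x = sqnorm x.
Proof. by apply: eq_bigr => j _; rewrite expr2. Qed.

Lemma cauchy_schwarz x y : dotp x y ^+ 2 <= sqnorm x * sqnorm y.
Proof.
have [y0|y0] := eqVneq (sqnorm y) 0.
  have yj j : y 0 j = 0.
    have := y0; rewrite /sqnorm => /psumr_eq0P => /(_ (fun j _ => sqr_ge0 _)).
    by move=> /(_ j isT) /eqP; rewrite sqrf_eq0 => /eqP.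
  by rewrite y0 mulr0 /dotp big1 ?expr0n// => j _; rewrite yj mulr0.
have yp : 0 < sqnorm y by rewrite lt_def y0 sqnorm_ge0.
have := sqnorm_ge0 (x + (- dotp x y / sqnorm y) *: y).
rewrite sqnormDZ => h.
have {h} := mulr_ge0 (ltW yp) h.
set a := dotp x y; set b := sqnorm y; set c := sqnorm x.
have -> : b * (c + 2 * (- a / b) * a + (- a / b) ^+ 2 * b) = c * b - a ^+ 2.
  by field.
by rewrite subr_ge0.
Qed.

Lemma le_coord_sqnorm x j : x 0 j ^+ 2 <= sqnorm x.
Proof.
by rewrite /sqnorm (bigD1 j)//= lerDl sumr_ge0// => i _; rewrite sqr_ge0.
Qed.

Lemma normM_coord_le x j k : `|x 0 j * x 0 k| <= sqnorm x.
Proof.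
have := le_coord_sqnorm x j; have := le_coord_sqnorm x k.
move: (x 0 j) (x 0 k) => a b ha hb.
by rewrite ler_norml; apply/andP; split; nra.
Qed.

Lemma sqnormD_le x y : sqnorm (x + y) <= 2 * sqnorm x + 2 * sqnorm y.
Proof.
rewrite /sqnorm !big_distrr -big_split/=; apply: ler_sum => j _.
by rewrite mxE; have := sqr_ge0 (x 0 j - y 0 j); nra.
Qed.

(* [mu (|y|^2) = min (|y|^2, |y|^3)] *)
Definition mu (t : R) : R := t * Num.min 1 (Num.sqrt t).

Lemma mu_ge0 t : 0 <= t -> 0 <= mu t.
Proof. by move=> t0; rewrite mulr_ge0// le_min ler01 sqrtr_ge0. Qed.

Lemma mu_le t : 0 <= t -> mu t <= t.
Proof. by move=> t0; rewrite ler_piMr// ge_min lexx. Qed.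

Lemma mu_le_sqrt t : 0 <= t -> mu t <= t * Num.sqrt t.
Proof. by move=> t0; rewrite ler_wpM2l// ge_min lexx orbT. Qed.

Lemma mu_homo (s t : R) : 0 <= s -> s <= t -> mu s <= mu t.
Proof.
move=> s0 st; rewrite ler_pM// ?le_min ?ler01 ?sqrtr_ge0//.
by rewrite ge_min lexx/= ge_min ler_wsqrtr ?orbT.
Qed.

Lemma mu_sqM (c t : R) : 1 <= c -> 0 <= t -> mu (c ^+ 2 * t) <= c ^+ 3 * mu t.
Proof.
move=> c1 t0; have c0 : 0 <= c by lra.
rewrite /mu sqrtrM ?sqr_ge0// sqrtr_sqr ger0_norm//.
have -> : c ^+ 3 * (t * Num.min 1 (Num.sqrt t)) =
  (c ^+ 2 * t) * (c * Num.min 1 (Num.sqrt t)) by ring.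
rewrite ler_wpM2l ?mulr_ge0 ?sqr_ge0// minr_pMr// mulr1 le_min.
by rewrite !ge_min c1/= lexx orbT.
Qed.

(** The larger argument absorbs the smaller one: the sum is at most 4 times it, and scaling by
    [2 ^+ 2] costs [2 ^+ 3]. *)
Lemma muD_le (s t : R) : 0 <= s -> 0 <= t ->
  mu (2 * s + 2 * t) <= 8 * mu s + 8 * mu t.
Proof.
have key u v : 0 <= u -> u <= v -> mu (2 * u + 2 * v) <= 8 * mu v.
  move=> u0 uv; apply: (@le_trans _ _ (mu (2 ^+ 2 * v))).
    by apply: mu_homo; lra.
  by apply: le_trans (mu_sqM _ _) _; [lra|lra|rewrite -natrX].
move=> s0 t0; have := mu_ge0 s0; have := mu_ge0 t0.
have [st|/ltW ts] := leP s t; first by have := key _ _ s0 st; lra.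
by have := key _ _ t0 ts; rewrite addrC; lra.
Qed.

(** A Taylor expansion with anonymous coefficients and a constant uniform in [x]. The linear
    coefficients carry no bound because they will be paired with centered increments; the bound on
    the quadratic ones controls a mismatch of covariances. *)
Definition expands (K : R) (f : 'rV[R]_d -> R) := forall x,
  exists l : 'I_d -> R, exists b : 'I_d -> 'I_d -> R,
    (forall j k, `|b j k| <= K) /\
    forall y, `|f (x + y) - f x - \sum_j l j * y 0 j -
               \sum_j \sum_k b j k * (y 0 j * y 0 k)| <= K * mu (sqnorm y).

Lemma expandsB (K L : R) (f g : 'rV[R]_d -> R) :
  expands K f -> expands L g -> expands (K + L) (fun x => f x - g x).
Proof.
move=> fK gL x; have [l [b [bK fb]]] := fK x; have [m [c [cL gc]]] := gL x.
exists (fun j => l j - m j), (fun j k => b j k - c j k); split=> [j k|y].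
  by rewrite (le_trans (ler_normB _ _))// lerD.
rewrite mulrDl; apply: le_trans (lerD (fb y) (gc y)).
apply: le_trans (ler_normB _ _); rewrite le_eqVlt; apply/orP; left; apply/eqP.
congr `|_|.
have -> : \sum_j (l j - m j) * y 0 j =
    \sum_j l j * y 0 j - \sum_j m j * y 0 j.
  by rewrite -sumrB; apply: eq_bigr => j _; rewrite mulrBl.
have -> : \sum_j \sum_k (b j k - c j k) * (y 0 j * y 0 k) =
    \sum_j \sum_k b j k * (y 0 j * y 0 k) -
    \sum_j \sum_k c j k * (y 0 j * y 0 k).
  rewrite -sumrB; apply: eq_bigr => j _; rewrite -sumrB.
  by apply: eq_bigr => k _; rewrite mulrBl.
by ring.
Qed.

(* Taylor's formula along the segment from [x] to [x + y]; as [h] is constant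
   beyond [M], the derivatives of [sqnorm] only matter where they are bounded. *)
Lemma expands_radial (h h1 h2 h3 : R -> R) (B M : R) : 0 <= M ->
  (forall t, is_derive t (1 : R) h (h1 t)) ->
  (forall t, is_derive t (1 : R) h1 (h2 t)) ->
  (forall t, is_derive t (1 : R) h2 (h3 t)) ->
  (forall t, [/\ `|h1 t| <= B, `|h2 t| <= B & `|h3 t| <= B]) ->
  (forall t, M < t -> [/\ h1 t = 0, h2 t = 0 & h3 t = 0]) ->
  let c := Num.sqrt (4 * M) in
  expands (B * (c ^+ 3 + 6 * c + 2 * c ^+ 2 + 5)) (fun s => h (sqnorm s)).
Proof.
move=> M0 hh1 h1h2 h2h3 hB hM c x.
have c0 : 0 <= c by exact: sqrtr_ge0.
have c2 : c ^+ 2 = 4 * M by rewrite sqr_sqrtr//; lra.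
have B0 : 0 <= B by have [+ _ _] := hB 0; apply: le_trans.
set K := B * _.
exists (fun j => h1 (sqnorm x) * (2 * x 0 j)).
exists (fun j k => 2 * h2 (sqnorm x) * (x 0 j * x 0 k) +
  h1 (sqnorm x) * (j == k)%:R).
split=> [j k|y].
  apply: le_trans (ler_normD _ _) _.
  have e1 : `|h1 (sqnorm x) * (j == k)%:R| <= B.
    have [+ _ _] := hB (sqnorm x); case: (j == k); rewrite ?mulr1 ?mulr0//.
    by rewrite normr0.
  have e2 : `|2 * h2 (sqnorm x) * (x 0 j * x 0 k)| <= 2 * B * M.
    rewrite !normrM (ger0_norm (ler0n _ 2)) -normrM.
    have [xM|xM] := leP (sqnorm x) M.
      have [_ hb _] := hB (sqnorm x).
      rewrite -!mulrA ler_wpM2l// ler_pM//.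
      by rewrite (le_trans (normM_coord_le _ _ _)).
    have [_ -> _] := hM _ xM; rewrite normr0 mulr0 mul0r.
    by rewrite !mulr_ge0.
  apply: le_trans (lerD e2 e1) _; rewrite /K.
  have -> : M = c ^+ 2 / 4 by rewrite c2; field.
  rewrite -subr_ge0; have -> : B * (c ^+ 3 + 6 * c + 2 * c ^+ 2 + 5) -
    (2 * B * (c ^+ 2 / 4) + B) =
    B * (c ^+ 3 + 6 * c + 3 / 2 * c ^+ 2 + 4) by field.
  by rewrite mulr_ge0// !addr_ge0// ?mulr_ge0 ?exprn_ge0//; lra.
set n := sqnorm y; set a := dotp x y; set r := Num.sqrt n.
have n0 : 0 <= n by exact: sqnorm_ge0.
have r0 : 0 <= r by exact: sqrtr_ge0.
have r2 : r ^+ 2 = n by rewrite sqr_sqrtr.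
(* The squared norm of [x + t *: y] as a polynomial in [t]. *)
pose q (t : R) := sqnorm x + 2 * a * t + n * t ^+ 2.
pose q1 (t : R) := 2 * a + 2 * n * t.
have dq (t : R) : is_derive t (1 : R) q (q1 t).
  by apply: is_derive_eq; rewrite /q1 /GRing.scale/=; ring.
have dq1 (t : R) : is_derive t (1 : R) q1 (2 * n).
  by apply: is_derive_eq; rewrite /GRing.scale/=; ring.
(* Cauchy-Schwarz for [x + t *: y] and [y]. Where [q t <= M] this gives [q1 t <= c * r] in absolute
   value, whence [c = sqrt (4 M)]. *)
have q1q t : q1 t ^+ 2 <= 4 * q t * n.
  have -> : q t = sqnorm (x + t *: y) by rewrite sqnormDZ /q /a /n; ring.
  have -> : q1 t = 2 * dotp (x + t *: y) y.
    by rewrite dotpDZl dotpp /q1 -/n -/a; ring.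
  by rewrite exprMn -mulrA -natrX ler_wpM2l// cauchy_schwarz.
have q1le t : q t <= M -> `|q1 t| <= c * r.
  move=> qM; rewrite -(@ler_pXn2r _ 2)// ?nnegrE ?mulr_ge0//.
  rewrite real_normK ?num_real// exprMn c2 r2.
  by apply: le_trans (q1q t) _; rewrite ler_wpM2r//; lra.
pose f t := h (q t).
pose f1 t := h1 (q t) * q1 t.
pose f2 t := h2 (q t) * q1 t ^+ 2 + h1 (q t) * (2 * n).
pose f3 t := h3 (q t) * q1 t ^+ 3 + 6 * n * (h2 (q t) * q1 t).
have df (t : R) : is_derive t (1 : R) f (f1 t).
  exact: (is_derive_comp (g := q)).
have dh1 (t : R) := is_derive_comp (g := q) (h1h2 (q t)) (dq t).
have dh2 (t : R) := is_derive_comp (g := q) (h2h3 (q t)) (dq t).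
have df1 (t : R) : is_derive t (1 : R) f1 (f2 t).
  have := dh1 t; have := dq1 t => ? ?.
  by apply: is_derive_eq; rewrite /f2 /GRing.scale/=; ring.
have df2 (t : R) : is_derive t (1 : R) f2 (f3 t).
  have := dh1 t; have := dh2 t; have := dq1 t => ? ? ?.
  by apply: is_derive_eq; rewrite /f3 /GRing.scale/=; ring.
have f2b t : `|f2 t| <= B * (c ^+ 2 + 2) * n.
  rewrite /f2; have [h1B h2B _] := hB (q t).
  have [qM|qM] := leP (q t) M; last first.
    by have [-> -> _] := hM _ qM; rewrite !mul0r add0r normr0 !mulr_ge0//; nra.
  apply: le_trans (ler_normD _ _) _.
  rewrite mulrDr mulrDl lerD//.
    rewrite normrM -mulrA ler_pM// normrX.
    by have := q1le t qM; rewrite -r2 -exprMn ler_pXn2r// ?nnegrE ?mulr_ge0.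
  rewrite !normrM (ger0_norm n0) (ger0_norm (ler0n _ 2)).
  by rewrite mulrA ler_wpM2r// ler_wpM2r.
have f3b t : `|f3 t| <= B * (c ^+ 3 + 6 * c) * (n * r).
  rewrite /f3; have [_ h2B h3B] := hB (q t).
  have [qM|qM] := leP (q t) M; last first.
    have [_ -> ->] := hM _ qM; rewrite !mul0r mulr0 add0r normr0 !mulr_ge0//.
    by rewrite addr_ge0// ?exprn_ge0// mulr_ge0.
  apply: le_trans (ler_normD _ _) _.
  have -> : B * (c ^+ 3 + 6 * c) * (n * r) =
    B * (c ^+ 3 * (n * r)) + B * (6 * c) * (n * r) by ring.
  apply: lerD.
    rewrite normrM ler_pM// normrX.
    have := q1le t qM; rewrite -r2 -exprSr -exprMn.
    by rewrite ler_pXn2r// ?nnegrE ?mulr_ge0.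
  rewrite !normrM (ger0_norm n0) (ger0_norm (ler0n _ 6)).
  have -> : B * (6 * c) * (n * r) = 6 * n * (B * (c * r)) by ring.
  rewrite ler_wpM2l ?mulr_ge0// ler_pM//.
  exact: q1le.
have h01 : 0 <= (0 : R) <= 1 by rewrite lexx ler01.
have t2 := taylor2_01 df df1 (fun t _ => f2b t).
have t3 := taylor3_01 df df1 df2 (fun t _ => f3b t).
have e0 : f 0 = h (sqnorm x).
  by rewrite /f /q mulr0 expr0n mulr0 !addr0.
have q0 : q 0 = sqnorm x by rewrite /q mulr0 expr0n mulr0 !addr0.
have e1 : f 1 = h (sqnorm (x + y)).
  by rewrite sqnormD /f /q mulr1 expr1n mulr1 -/a.
have e2 : f1 0 = \sum_j h1 (sqnorm x) * (2 * x 0 j) * y 0 j.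
  rewrite /f1 q0 /q1 mulr0 addr0 /a /dotp !big_distrr/=.
  by apply: eq_bigr => j _; ring.
have e3 : f2 0 / 2 = \sum_j \sum_k (2 * h2 (sqnorm x) * (x 0 j * x 0 k) +
  h1 (sqnorm x) * (j == k)%:R) * (y 0 j * y 0 k).
  transitivity (\sum_j (2 * h2 (sqnorm x) * (x 0 j * y 0 j) * a +
     h1 (sqnorm x) * (y 0 j) ^+ 2)); last first.
    apply: eq_bigr => j _.
    have -> : h1 (sqnorm x) * (y 0 j) ^+ 2 =
       \sum_k h1 (sqnorm x) * (j == k)%:R * (y 0 j * y 0 k).
      rewrite (bigD1 j)//= eqxx big1 ?addr0; first by rewrite mulr1 expr2.
      by move=> k; rewrite eq_sym => /negPf ->; rewrite mulr0 mul0r.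
    rewrite /a /dotp big_distrr -big_split/=; apply: eq_bigr => k _.
    by ring.
  rewrite big_split/= -big_distrl/= -!big_distrr/= -/(dotp x y) -/a.
  rewrite -/(sqnorm y) -/n /f2 q0 /q1 mulr0 addr0.
  by field.
rewrite -e0 -e1 -e2 -e3.
(* The remainder is estimated twice: by [K * n], counting the quadratic term as an error, and by
   [K * (n * r)]. The smaller bound is [K * mu n]. *)
have b1 : `|f 1 - f 0 - f1 0 - f2 0 / 2| <= K * n.
  apply: le_trans (ler_normB _ _) _.
  have : `|f2 0 / 2| <= B * (c ^+ 2 + 2) * n / 2.
    by rewrite normrM normfV (ger0_norm (ler0n _ 2)) ler_wpM2r.
  move: t2; set u := `|_|; set v := `|_|; move=> t2 v2.
  have -> : K * n = B * (c ^+ 2 + 2) * n + B * (c ^+ 2 + 2) * n / 2 +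
     B * n * (c ^+ 3 + 6 * c + c ^+ 2 / 2 + 2) by rewrite /K; field.
  rewrite -[leLHS]addr0 lerD// ?lerD// mulr_ge0 ?mulr_ge0//.
  by rewrite !addr_ge0// ?mulr_ge0 ?exprn_ge0.
have b2 : `|f 1 - f 0 - f1 0 - f2 0 / 2| <= K * (n * r).
  apply: le_trans t3 _; rewrite ler_wpM2r ?mulr_ge0// /K ler_wpM2l//.
  by rewrite -addrA lerDl addr_ge0// mulr_ge0// exprn_ge0.
rewrite /mu -/n -/r; case: (leP 1 r) => _; last by [].
by rewrite mulr1.
Qed.

End euclidean.
Section cutoff.
Context {R : realType} {d : nat}.

(** [K] is chosen before the threshold [x]: this uniformity is what later gives distribution
    functions that are close uniformly on [x <= M]. *)
Lemma smooth_cutoff (delta M : R) : 0 < delta ->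
  exists K : R, forall x, x <= M -> exists h : R -> R,
    [/\ measurable_fun setT h, (forall t, 0 <= h t <= 1),
        (forall t, t <= x -> h t = 1), (forall t, x + delta <= t -> h t = 0) &
        expands K (fun s : 'rV[R]_d => h (sqnorm s))].
Proof.
move=> d0; set b := delta^-1; have b0 : 0 < b by rewrite invr_gt0.
have [C C0 smoothstepC] := @smoothstep123_bounded R.
(* The chain rule produces the factors [b], [b ^+ 2] and [b ^+ 3]; [(1 + b) ^+ 3] dominates them
   whether [b] is small or large. *)
set B := C * (1 + b) ^+ 3.
set M' := Num.max 0 (M + delta).
set c := Num.sqrt (4 * M').
exists (B * (c ^+ 3 + 6 * c + 2 * c ^+ 2 + 5)) => x xM.
exists (fun t => smoothstep (1 - (t - x) * b)).
have daff (t : R) :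
    is_derive t (1 : R) (fun t => 1 - (t - x) * b) (- b).
  by apply: is_derive_eq; rewrite /GRing.scale/=; ring.
have dh (t : R) : is_derive t (1 : R) (fun t => smoothstep (1 - (t - x) * b))
    (- b * smoothstep1 (1 - (t - x) * b)).
  rewrite mulrC.
  exact: (is_derive_comp (g := fun t => 1 - (t - x) * b)
    (is_derive_smoothstep _)).
have ge1b k : (k <= 3)%N -> b ^+ k <= (1 + b) ^+ 3.
  move=> k3; apply: (@le_trans _ _ ((1 + b) ^+ k)).
    by rewrite lerXn2r// ?nnegrE; lra.
  by apply: ler_weXn2l => //; lra.
have b0' := ltW b0.
have scaled k (u : R) : (k <= 3)%N -> `|u| <= C -> `|b ^+ k * u| <= B.
  move=> k3 u0; rewrite normrM ger0_norm ?exprn_ge0// mulrC /B.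
  by apply: ler_pM => //; rewrite ?exprn_ge0// ge1b.
split.
- apply: continuous_measurable_fun => t.
  apply/differentiable_continuous/derivable1_diffP.
  exact: (@ex_derive _ _ _ _ _ _ _ (dh t)).
- by move=> t; rewrite smoothstep_ge0 smoothstep_le1.
- move=> t tx; rewrite smoothstep_eq1//.
  by rewrite lerDl oppr_ge0 mulr_le0_ge0 ?subr_le0// ltW.
- move=> t xt; rewrite smoothstep_eq0// subr_le0 ler_pdivlMr// mul1r.
  by rewrite lerBrDr addrC.
apply: (@expands_radial _ _ (fun t => smoothstep (1 - (t - x) * b))
  (fun t => - b * smoothstep1 (1 - (t - x) * b))
  (fun t => b ^+ 2 * smoothstep2 (1 - (t - x) * b))
  (fun t => - b ^+ 3 * smoothstep3 (1 - (t - x) * b)) B M' _ dh).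
- by rewrite le_max lexx.
- move=> t.
  have := is_derive_comp (g := fun t => 1 - (t - x) * b)
    (is_derive_smoothstep1 _) (daff t) => ?.
  by apply: is_derive_eq; rewrite /GRing.scale/=; ring.
- move=> t.
  have := is_derive_comp (g := fun t => 1 - (t - x) * b)
    (is_derive_smoothstep2 _) (daff t) => ?.
  by apply: is_derive_eq; rewrite /GRing.scale/=; ring.
- move=> t; have [s1 s2 s3] := smoothstepC (1 - (t - x) * b).
  by rewrite !mulNr !normrN -{1}[b]expr1; split; exact: scaled.
- move=> t; rewrite gt_max => /andP[_ Mt].
  have [|-> -> ->] := @smoothstep123_eq0 _ (1 - (t - x) * b);
    last by rewrite !mulr0.
  by rewrite subr_le0 ler_pdivlMr// mul1r; lra.
Qed.

End cutoff.
(** * Averages over translations *)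

Section averages.
Context {R : realType}.
Implicit Types (I J : finType).

Definition avg I (g : I -> R) : R := (\sum_i g i) / #|I|%:R.

Lemma avgD I (g h : I -> R) : avg (fun i => g i + h i) = avg g + avg h.
Proof. by rewrite /avg big_split mulrDl. Qed.

Lemma avgB I (g h : I -> R) : avg (fun i => g i - h i) = avg g - avg h.
Proof. by rewrite /avg sumrB mulrBl. Qed.

Lemma avgZ I (c : R) (g : I -> R) : avg (fun i => c * g i) = c * avg g.
Proof. by rewrite /avg -big_distrr mulrA. Qed.

Lemma avg_sum I (K : Type) (r : seq K) (g : K -> I -> R) :
  avg (fun i => \sum_(k <- r) g k i) = \sum_(k <- r) avg (g k).
Proof. by rewrite /avg exchange_big mulr_suml. Qed.

Lemma avg_le I (g h : I -> R) : (forall i, g i <= h i) -> avg g <= avg h.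
Proof. by move=> gh; rewrite ler_wpM2r ?invr_ge0// ler_sum. Qed.

Lemma avg_ge0 I (g : I -> R) : (forall i, 0 <= g i) -> 0 <= avg g.
Proof. by move=> g0; rewrite mulr_ge0 ?invr_ge0// sumr_ge0. Qed.

Lemma ler_norm_avg I (g : I -> R) : `|avg g| <= avg (fun i => `|g i|).
Proof.
rewrite /avg normrM [X in _ * X]ger0_norm ?invr_ge0//.
by rewrite ler_wpM2r ?invr_ge0// ler_norm_sum.
Qed.

Lemma avg_cst I (c : R) : (0 < #|I|)%N -> avg (fun _ : I => c) = c.
Proof.
move=> I0; rewrite /avg sumr_const -[c *+ _]mulr_natr mulfK//.
by rewrite pnatr_eq0 -lt0n.
Qed.

Lemma avg_exchange I J (g : I -> J -> R) :
  avg (fun i => avg (g i)) = avg (fun j => avg (fun i => g i j)).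
Proof.
rewrite /avg -!mulr_suml exchange_big/= -!mulrA; congr (_ * _).
by rewrite mulrC.
Qed.

Lemma avg_pair I J (g : I -> J -> R) :
  avg (fun ij : I * J => g ij.1 ij.2) = avg (fun i => avg (g i)).
Proof.
rewrite /avg -(pair_bigA _ (fun i j => g i j))/= card_prod natrM invfM.
by rewrite -!mulr_suml mulrA mulrAC.
Qed.

End averages.

Section shift_averages.
Context {R : realType} {d : nat}.
Implicit Types (I J : finType) (f g : 'rV[R]_d -> R).

(** Convolution with the uniform law on the points [p i]. Its [n]-th iterate at [x] is the mean over
    [n] independent draws added to [x], without a product space. *)
Definition shiftavg I (p : I -> 'rV[R]_d) f : 'rV[R]_d -> R :=
  fun x => avg (fun i => f (x + p i)).

Lemma shiftavgC I J (p : I -> 'rV[R]_d) (q : J -> 'rV[R]_d) f :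
  shiftavg p (shiftavg q f) = shiftavg q (shiftavg p f).
Proof.
apply/funext => x; rewrite /shiftavg avg_exchange.
by congr avg; apply/funext => j; congr avg; apply/funext => i; rewrite addrAC.
Qed.

Lemma shiftavg_iterC I J (p : I -> 'rV[R]_d) (q : J -> 'rV[R]_d) f n :
  shiftavg p (iter n (shiftavg q) f) = iter n (shiftavg q) (shiftavg p f).
Proof. by elim: n => //= n <-; rewrite shiftavgC. Qed.

Lemma shiftavg_pair I J (p : I -> 'rV[R]_d) (q : J -> 'rV[R]_d) f :
  shiftavg (fun ij : I * J => p ij.1 + q ij.2) f =
  shiftavg p (shiftavg q f).
Proof.
apply/funext => x; rewrite /shiftavg.
rewrite (avg_pair (fun i j => f (x + (p i + q j)))); congr avg.
by apply/funext => i; congr avg; apply/funext => j; rewrite addrA.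
Qed.

(** Shift averages commute, so all draws from [q] can be averaged first with those from [p] held
    fixed; this is conditioning on the latter. *)
Lemma iter_shiftavg_pair I J (p : I -> 'rV[R]_d) (q : J -> 'rV[R]_d) f n :
  iter n (shiftavg (fun ij : I * J => p ij.1 + q ij.2)) f =
  iter n (shiftavg p) (iter n (shiftavg q) f).
Proof.
elim: n => //= n ->.
by rewrite shiftavg_pair shiftavg_iterC.
Qed.

Lemma iter_shiftavgB I (p : I -> 'rV[R]_d) f g n x :
  iter n (shiftavg p) (fun y => f y - g y) x =
  iter n (shiftavg p) f x - iter n (shiftavg p) g x.
Proof.
elim: n x => //= n IHn x; rewrite /shiftavg -avgB; congr avg.
by apply/funext => i; exact: IHn.
Qed.

Lemma iter_shiftavg_le I (p : I -> 'rV[R]_d) f (c : R) n :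
  (0 < #|I|)%N -> (forall x, f x <= c) ->
  forall x, iter n (shiftavg p) f x <= c.
Proof.
move=> I0 fc; elim: n => //= n IHn x.
by rewrite -[leRHS](avg_cst c I0); apply: avg_le.
Qed.

Lemma iter_shiftavg_ge0 I (p : I -> 'rV[R]_d) f n :
  (forall x, 0 <= f x) -> forall x, 0 <= iter n (shiftavg p) f x.
Proof. by move=> f0; elim: n => //= n IHn x; apply: avg_ge0. Qed.

Lemma shiftavg_norm_le I (p : I -> 'rV[R]_d) f (c : R) :
  (0 < #|I|)%N -> (forall x, `|f x| <= c) -> forall x, `|shiftavg p f x| <= c.
Proof.
move=> I0 fc x; apply: le_trans (ler_norm_avg _) _.
by rewrite -[leRHS](avg_cst c I0); apply: avg_le.
Qed.

(** Telescoping over the factors: the two operators commute and are contractions for the supremum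
    norm, so each exchange costs at most [c]. *)
Lemma iter_shiftavg_dist I J (p : I -> 'rV[R]_d) (q : J -> 'rV[R]_d)
    f (c : R) n : (0 < #|I|)%N -> (0 < #|J|)%N ->
  (forall x, `|shiftavg p f x - shiftavg q f x| <= c) ->
  forall x, `|iter n (shiftavg p) f x - iter n (shiftavg q) f x| <= n%:R * c.
Proof.
move=> I0 J0 fc; elim: n => [|n IHn] x.
  by rewrite mul0r subrr normr0.
rewrite -natr1 mulrDl mul1r -[iter n.+1 _ _ _ - _](subrKA
  (shiftavg p (iter n (shiftavg q) f) x)).
apply: le_trans (ler_normD _ _) _; apply: lerD.
  rewrite [_ - _](_ : _ = shiftavg p (fun y =>
    iter n (shiftavg p) f y - iter n (shiftavg q) f y) x).
    exact: shiftavg_norm_le.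
  by rewrite /= /shiftavg -avgB.
rewrite shiftavg_iterC iterSr -iter_shiftavgB.
elim: n x {IHn} => [|n IHn] x; first exact: fc.
by rewrite iterS; exact: shiftavg_norm_le.
Qed.

Lemma avg_expansion I (p : I -> 'rV[R]_d) f (l : 'I_d -> R)
    (b : 'I_d -> 'I_d -> R) (K : R) x : (0 < #|I|)%N ->
  (forall j, avg (fun i => p i 0 j) = 0) ->
  (forall y, `|f (x + y) - f x - \sum_j l j * y 0 j -
               \sum_j \sum_k b j k * (y 0 j * y 0 k)| <= K * mu (sqnorm y)) ->
  `|shiftavg p f x - f x -
    \sum_j \sum_k b j k * avg (fun i => p i 0 j * p i 0 k)| <=
  K * avg (fun i => mu (sqnorm (p i))).
Proof.
move=> I0 p0 fK.
have -> : shiftavg p f x - f x -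
    \sum_j \sum_k b j k * avg (fun i => p i 0 j * p i 0 k) =
  avg (fun i => f (x + p i) - f x - \sum_j l j * p i 0 j -
               \sum_j \sum_k b j k * (p i 0 j * p i 0 k)).
  have l0 : avg (fun i => \sum_j l j * p i 0 j) = 0.
    by rewrite avg_sum big1// => j _; rewrite avgZ p0 mulr0.
  rewrite !avgB (avg_cst _ I0) l0 subr0.
  congr (_ - _); rewrite avg_sum; apply: eq_bigr => j _; rewrite avg_sum.
  by apply: eq_bigr => k _; rewrite -avgZ.
apply: le_trans (ler_norm_avg _) _; rewrite -avgZ.
by apply: avg_le => i; exact: fK.
Qed.

(** Both averages use the same expansion at [x]; the linear terms vanish by centering, the quadratic
    ones agree because the second moments do, and only remainders survive. *)
Lemma shiftavg_lindeberg I J (p : I -> 'rV[R]_d) (q : J -> 'rV[R]_d)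
    f (K : R) : (0 < #|I|)%N -> (0 < #|J|)%N -> expands K f ->
  (forall j, avg (fun i => p i 0 j) = 0) ->
  (forall j, avg (fun i => q i 0 j) = 0) ->
  (forall j k, avg (fun i => p i 0 j * p i 0 k) =
               avg (fun i => q i 0 j * q i 0 k)) ->
  forall x, `|shiftavg p f x - shiftavg q f x| <=
    K * (avg (fun i => mu (sqnorm (p i))) + avg (fun i => mu (sqnorm (q i)))).
Proof.
move=> I0 J0 fK p0 q0 pq x; have [l [b [bK fb]]] := fK x.
have := avg_expansion I0 p0 fb; have := avg_expansion J0 q0 fb.
have -> : \sum_j \sum_k b j k * avg (fun i => q i 0 j * q i 0 k) =
  \sum_j \sum_k b j k * avg (fun i => p i 0 j * p i 0 k).
  by apply: eq_bigr => j _; apply: eq_bigr => k _; rewrite pq.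
set e := \sum_j _; move=> hq hp.
have -> : shiftavg p f x - shiftavg q f x =
  (shiftavg p f x - f x - e) - (shiftavg q f x - f x - e) by ring.
by apply: le_trans (ler_normB _ _) _; rewrite mulrDr lerD.
Qed.

End shift_averages.
(** * Anti-concentration of Rademacher sums *)

Section binomial_bound.

Lemma bin_double_le_central m k : ('C(m.*2, k) <= 'C(m.*2, m))%N.
Proof.
have up j : ('C(m.*2, m + j) <= 'C(m.*2, m))%N.
  elim: j => [|j IHj]; first by rewrite addn0.
  (* Beyond the centre, consecutive entries have ratio [(m - j) / (m + j + 1)], at most 1. *)
  apply: leq_trans IHj; rewrite addnS -(@leq_pmul2l (m + j).+1)//.
  by rewrite mul_bin_left leq_mul2r; apply/orP; right; lia.
have [mk|km] := leqP m k; first by rewrite -(subnKC mk).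
rewrite -bin_sub; last by lia.
have -> : (m.*2 - k = m + (m - k))%N by lia.
exact: up.
Qed.

Lemma bin_doubleS m :
  (m.+1 * 'C(m.+1.*2, m.+1) = 2 * (m.*2.+1 * 'C(m.*2, m)))%N.
Proof.
rewrite doubleS binS.
have -> : 'C(m.*2.+1, m.+1) = 'C(m.*2.+1, m).
  by rewrite -bin_sub; [congr 'C(_, _)|]; lia.
have := mul_bin_down m.*2.+1 m.
by rewrite /= (_ : m.*2.+1 - m = m.+1)%N; [move=> ->; lia|lia].
Qed.

Context {R : realType}.

(** The normalized central coefficient is multiplied by [(2m+1) / (2m+2)] at each step, and
    [(2m+1) (2m+3) <= (2m+2)^2] closes the induction. The factor [m.*2.+1], rather than [m.*2], is
    what makes it close. *)
Lemma central_bin_sq_le m :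
  ('C(m.*2, m)%:R / 2 ^+ m.*2 : R) ^+ 2 * m.*2.+1%:R <= 1.
Proof.
elim: m => [|m IHm]; first by rewrite bin0 expr0 divr1 expr1n mul1r.
set a : R := 'C(m.*2, m)%:R / 2 ^+ m.*2 in IHm.
have m1 : (m.+1%:R : R) != 0 by rewrite pnatr_eq0.
have -> : 'C(m.+1.*2, m.+1)%:R / 2 ^+ m.+1.*2 =
    a * (m.*2.+1%:R / m.*2.+2%:R) :> R.
  have := congr1 (fun i : nat => i%:R : R) (bin_doubleS m).
  rewrite !natrM => E.
  have -> : 'C(m.+1.*2, m.+1)%:R = 2 * (m.*2.+1%:R * 'C(m.*2, m)%:R) /
     m.+1%:R :> R by rewrite -E mulrAC mulfV// mul1r.
  have -> : m.*2.+2%:R = 2 * m.+1%:R :> R.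
    by rewrite -natrM; congr _%:R; lia.
  have p0 : (2 : R) ^+ m.*2 != 0 by rewrite expf_neq0.
  rewrite /a doubleS !exprS; move: (m.+1%:R) m1 (2 ^+ m.*2) p0 => x x0 y y0.
  by field; rewrite x0 y0.
rewrite exprMn -mulrA.
apply: le_trans IHm; rewrite ler_wpM2l ?sqr_ge0//.
have -> : m.+1.*2.+1%:R = m.*2%:R + 3 :> R by rewrite -natrD; congr _%:R; lia.
have -> : m.*2.+1%:R = m.*2%:R + 1 :> R by rewrite natr1.
have -> : m.*2.+2%:R = m.*2%:R + 2 :> R by rewrite -natrD; congr _%:R; lia.
have x0 : 0 <= m.*2%:R :> R by [].
move: (m.*2%:R : R) x0 => x x0.
rewrite exprMn exprVn mulrAC ler_pdivrMr ?exprn_gt0//; last by lra.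
by nra.
Qed.

Lemma bin_sq_le n k : ('C(n, k)%:R / 2 ^+ n : R) ^+ 2 * n%:R <= 1.
Proof.
have bnd m (c : R) : 0 <= c -> c <= 'C(m.*2, m)%:R / 2 ^+ m.*2 ->
    c ^+ 2 * m.*2.+1%:R <= 1.
  move=> c0 cm; apply: le_trans (central_bin_sq_le m).
  by rewrite ler_wpM2r// ler_pXn2r// nnegrE// (le_trans c0).
have c0 : 0 <= 'C(n, k)%:R / 2 ^+ n :> R by rewrite divr_ge0 ?exprn_ge0.
have [m [nE|nE]] : exists m, n = m.*2.+1 \/ n = m.*2.
- by exists n./2; have := odd_double_half n; case: (odd n); lia.
(* By Pascal's rule a normalized entry of an odd row is the mean of two entries of the even row
   above. *)
- subst n; apply: bnd => //.
  case: k {c0} => [|k]; last first.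
    rewrite binS exprS invfM mulrA ler_wpM2r ?invr_ge0 ?exprn_ge0//.
    rewrite ler_pdivrMr// -natrM ler_nat.
    have := bin_double_le_central m k; have := bin_double_le_central m k.+1.
    by lia.
  rewrite bin0 exprS invfM mulrA ler_wpM2r ?invr_ge0 ?exprn_ge0//.
  have : (1 <= 'C(m.*2, m))%N by rewrite bin_gt0; lia.
  by rewrite -(ler_nat R) => ?; lra.
subst n; apply: (@le_trans _ _ (('C(m.*2, k)%:R / 2 ^+ m.*2 : R) ^+ 2 *
   m.*2.+1%:R)).
  by rewrite ler_wpM2l ?sqr_ge0// ler_nat.
apply: bnd; first by rewrite divr_ge0 ?exprn_ge0.
rewrite ler_wpM2r ?invr_ge0 ?exprn_ge0// ler_nat.
exact: bin_double_le_central.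
Qed.

End binomial_bound.

Lemma card_le_of_diameter n D (A : {set 'I_n}) :
  (forall i j : 'I_n, i \in A -> j \in A -> (i <= j)%N -> (j < i + D)%N) ->
  (#|A| <= D)%N.
Proof.
move=> AD; have [->|/set0Pn[i0 i0A]] := eqVneq A finset.set0.
  by rewrite cards0.
have [i iA imin] := arg_minnP (fun i : 'I_n => nat_of_ord i) i0A.
rewrite cardE -(size_map (@nat_of_ord n)) -[leqRHS](size_iota i).
apply: uniq_leq_size.
  by rewrite map_inj_uniq ?enum_uniq//; exact: val_inj.
move=> j /mapP[k]; rewrite mem_enum => kA ->.
by rewrite mem_iota imin//= AD// imin.
Qed.

Section rademacher.
Context {R : realType} {d : nat}.
Implicit Types (f : 'rV[R]_d -> R) (u x : 'rV[R]_d).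

Definition signed_vec u (b : bool) : 'rV[R]_d := (-1) ^+ b *: u.

Lemma iter_rademacher u f n x : iter n (shiftavg (signed_vec u)) f x =
  \sum_(k < n.+1) 'C(n, k)%:R / 2 ^+ n * f (x + (n%:R - 2 * k%:R) *: u).
Proof.
elim: n x => [|n IHn] x.
  by rewrite big_ord1 bin0 expr0 divr1 mul1r mulr0 subr0 scale0r addr0.
pose G k := f (x + (n.+1%:R - 2 * k%:R) *: u).
rewrite iterS {1}/shiftavg /avg card_bool big_bool !IHn /signed_vec/=.
rewrite expr1 expr0 scale1r scaleN1r.
have -> : \sum_(k < n.+1) 'C(n, k)%:R / 2 ^+ n *
    f (x - u + (n%:R - 2 * k%:R) *: u) =
    \sum_(k < n.+1) 'C(n, k)%:R / 2 ^+ n * G k.+1.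
  apply: eq_bigr => k _; congr (_ * f _).
  rewrite -addrA -scaleN1r -scalerDl; congr (_ + _ *: _).
  by rewrite -!natr1; ring.
have -> : \sum_(k < n.+1) 'C(n, k)%:R / 2 ^+ n *
    f (x + u + (n%:R - 2 * k%:R) *: u) =
    \sum_(k < n.+1) 'C(n, k)%:R / 2 ^+ n * G k.
  apply: eq_bigr => k _; congr (_ * f _).
  rewrite -addrA -{1}[u]scale1r -scalerDl; congr (_ + _ *: _).
  by rewrite -!natr1; ring.
rewrite -[\sum_(k < n.+2) _]/(\sum_(k < n.+2) 'C(n.+1, k)%:R / 2 ^+ n.+1 * G k).
have pascal : \sum_(k < n.+2) 'C(n.+1, k)%:R / 2 ^+ n.+1 * G k =
    \sum_(k < n.+2) ('C(n, k)%:R / 2 ^+ n.+1 * G k) +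
    \sum_(k < n.+1) ('C(n, k)%:R / 2 ^+ n.+1 * G k.+1).
  rewrite big_ord_recl [in RHS]big_ord_recl/= !bin0 -addrA; congr (_ + _).
  rewrite -big_split/=; apply: eq_bigr => k _.
  by rewrite /bump/= !add1n binS natrD !mulrDl.
rewrite pascal [X in _ = X + _]big_ord_recr/= bin_small// !mul0r addr0.
rewrite addrC mulrDl.
by congr (_ + _); rewrite mulr_suml; apply: eq_bigr => k _;
  rewrite exprS invfM; ring.
Qed.

(* Along the line [x + t u] the function [sqnorm] is a quadratic polynomial with
   leading coefficient [sqnorm u], so it meets a band of width [w] for at most
   [2 D] of the [n + 1] atoms, each of which has mass at most [n ^ (-1/2)]. *)
Lemma rademacher_anticoncentration u f n (lo w : R) (D : nat) x :
  (0 < n)%N -> w < 4 * sqnorm u * D%:R ^+ 2 ->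
  (forall s, f s <= 1) ->
  (forall s, ~~ (lo <= sqnorm s <= lo + w) -> f s <= 0) ->
  iter n (shiftavg (signed_vec u)) f x <= 2 * D%:R / Num.sqrt n%:R.
Proof.
move=> n0 wD f1 f0; rewrite iter_rademacher.
(* Below, [z k] is half the derivative of the quadratic polynomial at the [k]-th atom. Its sign
   tells the side of the vertex, so [A1] and [A2] collect atoms on which the polynomial is
   monotone. *)
have u0 : 0 <= sqnorm u := sqnorm_ge0 u.
pose z k : R := (n%:R - 2 * k%:R) * sqnorm u + dotp x u.
pose inb (k : 'I_n.+1) :=
  lo <= sqnorm (x + (n%:R - 2 * k%:R) *: u) <= lo + w.
pose A1 := [set k : 'I_n.+1 | inb k & 0 <= z k]%SET.
pose A2 := [set k : 'I_n.+1 | inb k & z k < 0]%SET.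
have key (i j : 'I_n.+1) : inb i -> inb j -> 0 <= z i * z j ->
    (i <= j)%N -> (j < i + D)%N.
  rewrite /inb !sqnormDZ => /andP[ilo ihi] /andP[jlo jhi] zz ij.
  rewrite ltnNge; apply/negP => Dij.
  have Dr : D%:R <= j%:R - i%:R :> R by rewrite lerBrDl -natrD ler_nat.
  have D0 : 0 <= D%:R :> R by [].
  have DD : D%:R ^+ 2 <= (j%:R - i%:R) ^+ 2 :> R.
    by rewrite ler_pXn2r// nnegrE (le_trans D0).
  have {}wD : w < 4 * sqnorm u * (j%:R - i%:R) ^+ 2.
    by apply: lt_le_trans wD _; rewrite ler_wpM2l// mulr_ge0.
  move: zz ilo ihi jlo jhi; rewrite /z.
  set a := dotp x u; set b := sqnorm u in u0 wD *; set c := sqnorm x.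
  set si : R := n%:R - 2 * i%:R; set sj : R := n%:R - 2 * j%:R.
  have {}wD : w < b * (si - sj) ^+ 2.
    by apply: lt_le_trans wD _; rewrite /si /sj; lra.
  move=> zz ilo ihi jlo jhi.
  have bp : 0 < b.
    rewrite lt_def u0 andbT; apply/negP => /eqP b0.
    by move: wD; rewrite b0 mul0r; lra.
  (* Completing the square: [b] times the squared norm is the square of [z] up to a constant. If [p]
     and [q] have the same sign, then [p ^+ 2] and [q ^+ 2] differ by at least [(p - q) ^+ 2], which
     exceeds [b * w] once the indices are [D] apart. *)
  have e1 : b * (2 * si * a + si ^+ 2 * b - (2 * sj * a + sj ^+ 2 * b)) =
     (si * b + a) ^+ 2 - (sj * b + a) ^+ 2 by ring.
  have e2 : b * (b * (si - sj) ^+ 2) = (si * b + a - (sj * b + a)) ^+ 2 by ring.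
  have h1 : b * (2 * si * a + si ^+ 2 * b - (2 * sj * a + sj ^+ 2 * b)) <=
     b * w by rewrite ler_wpM2l//; lra.
  have h2 : b * (2 * sj * a + sj ^+ 2 * b - (2 * si * a + si ^+ 2 * b)) <=
     b * w by rewrite ler_wpM2l//; lra.
  have h3 : b * w < b * (b * (si - sj) ^+ 2) by rewrite ltr_pM2l.
  move: h3 h2 h1 e1; rewrite e2.
  move: zz; set p := si * b + a; set q := sj * b + a.
  move=> zz h3 h2 h1 e1.
  have h4 : p ^+ 2 - q ^+ 2 < (p - q) ^+ 2 by lra.
  have h5 : q ^+ 2 - p ^+ 2 < (p - q) ^+ 2 by lra.
  by nra.
have cA1 : (#|A1| <= D)%N.
  apply: card_le_of_diameter => i j; rewrite !inE => /andP[ii zi] /andP[ij zj].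
  by apply: key => //; rewrite mulr_ge0.
have cA2 : (#|A2| <= D)%N.
  apply: card_le_of_diameter => i j; rewrite !inE => /andP[ii zi] /andP[ij zj].
  by apply: key => //; rewrite nmulr_rge0// ltW.
have sn0 : 0 < Num.sqrt n%:R :> R by rewrite sqrtr_gt0 ltr0n.
have cn k : 'C(n, k)%:R / 2 ^+ n <= (Num.sqrt n%:R)^-1 :> R.
  have := bin_sq_le (R := R) n k.
  rewrite -[X in _ * X <= _](@sqr_sqrtr R)// -exprMn.
  have p0 : 0 <= 'C(n, k)%:R / 2 ^+ n * Num.sqrt n%:R :> R.
    by rewrite mulr_ge0// divr_ge0// exprn_ge0.
  rewrite -[X in _ <= X](@expr1n _ 2) ler_pXn2r ?nnegrE// => h.
  by rewrite -(ler_pM2r sn0) mulVf ?gt_eqF.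
apply: (@le_trans _ _ (\sum_(k < n.+1 | inb k) (Num.sqrt n%:R)^-1)).
  rewrite [leRHS]big_mkcond/=; apply: ler_sum => k _.
  have C0 : 0 <= 'C(n, k)%:R / 2 ^+ n :> R by rewrite divr_ge0 ?exprn_ge0.
  case: ifPn => ik.
    by apply: le_trans (cn k); rewrite -[leRHS]mulr1 ler_wpM2l.
  by rewrite mulr_ge0_le0// f0.
rewrite sumr_const -[leLHS]mulr_natl ler_wpM2r ?invr_ge0//.
rewrite -natrM ler_nat mul2n -addnn.
have -> : #|[pred k | inb k]| = #|(A1 :|: A2)%SET|.
  apply: eq_card => k; rewrite !inE /=.
  by rewrite ltNge; case: (0 <= z k); rewrite /= ?andbT ?andbF ?orbF.
apply: leq_trans (leq_add cA1 cA2).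
by rewrite -cardsUI leq_addr.
Qed.

End rademacher.
(** * Independent random variables *)

Section independence.
Context {R : realType} {dO : measure_display} {O : measurableType dO}
  (P : probability O R) {dT : measure_display} {T : measurableType dT}
  (Y : nat -> {RV P >-> T}) (D : set nat) (m : nat).
Hypothesis indY : mutually_independent D Y.
Hypothesis Dm : forall i, (i < m)%N -> D i.

(** Independence is carried for all the remaining variables and not just for [Y k], so that one more
    of them can be absorbed by [chain] at each induction step. *)
Definition tail_event (k : nat) (B : nat -> set T) : set O :=
  [set w | forall i, (k <= i < m)%N -> B i (Y i w)].

Lemma tail_eventE k B : tail_event k B =
  \bigcap_(i in [set` [fset i | i in index_iota k m]%fset]) (Y i @^-1` B i).
Proof.
apply/seteqP; split=> [w h i /=|w h i kim].
  by rewrite in_fset mem_index_iota => /h.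
by apply: h => /=; rewrite in_fset mem_index_iota.
Qed.

Lemma measurable_tail_event k B : (forall i, measurable (B i)) ->
  measurable (tail_event k B).
Proof.
move=> mB; rewrite tail_eventE; apply: fin_bigcap_measurable => // i _.
by apply: measurable_funPTI.
Qed.

Lemma probability_tail_event k B : (forall i, measurable (B i)) ->
  P (tail_event k B) = (\prod_(k <= i < m) P (Y i @^-1` B i))%E.
Proof.
move=> mB; rewrite tail_eventE indY//; last first.
  by move=> i /=; rewrite in_fset mem_index_iota => /andP[_]; exact: Dm.
apply: perm_big; apply: uniq_perm; rewrite ?iota_uniq//.
by move=> i; rewrite in_fset.
Qed.

Lemma tail_event_ltn k B : (k < m)%N ->
  tail_event k B = (Y k @^-1` B k) `&` tail_event k.+1 B.
Proof.
move=> km; apply/seteqP; split=> [w h|w [hk h] i /andP[ki im]].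
  split; first by apply: h; rewrite leqnn.
  by move=> i /andP[ki im]; apply: h; rewrite (ltnW ki).
have [<-//|ki'] := eqVneq k i.
by apply: h; rewrite im andbT ltn_neqAle ki' ki.
Qed.

Context {dU : measure_display} {U : measurableType dU}.
Variables (u0 : U) (step : U * T -> U).
Hypothesis mstep : measurable_fun setT step.

(** A state fed by the first [k] variables. Partial sums, real or vector valued, are instances, and
    all that is needed about them is their independence from [Y k]. *)
Fixpoint chain (k : nat) (w : O) : U :=
  if k is k'.+1 then step (chain k' w, Y k' w) else u0.

Lemma measurable_chain k : measurable_fun setT (chain k).
Proof.
elim: k => [|k IHk] /=; first exact: measurable_cst.
by apply: measurableT_comp => //; apply: measurable_fun_pair.
Qed.

HB.instance Definition _ k :=
  isMeasurableFun.Build _ _ O U (chain k) (measurable_chain k).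

Definition chain_pair (k : nat) (w : O) : U * T := (chain k w, Y k w).

Lemma measurable_chain_pair k : measurable_fun setT (chain_pair k).
Proof. by apply: measurable_fun_pair => //; exact: measurable_chain. Qed.

HB.instance Definition _ k :=
  isMeasurableFun.Build _ _ O (U * T)%type (chain_pair k)
    (measurable_chain_pair k).

Lemma prod_measurable_eq (m1 m2 : {measure set (U * T) -> \bar R}) :
  (m1 setT < +oo)%E ->
  (forall A B, measurable A -> measurable B ->
     m1 (A `*` B) = m2 (A `*` B)) ->
  forall C, measurable C -> m1 C = m2 C.
Proof.
move=> m1oo m12.
apply: (measure_unique
  [set C | exists A, measurable A /\ exists B, measurable B /\ C = A `*` B]
  (fun=> setT)) => //.
- rewrite measurable_prod_measurableType //; congr (<<s _ >>).
  rewrite predeqE; split => [[A mA [B mB <-]]|[A [mA [B [mB ->]]]]].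
    by exists A; split => //; exists B.
  by exists A => //; exists B.
- move=> _ _ [X1 [mX1 [X2 [mX2 ->]]]] [Y1 [mY1 [Y2 [mY2 ->]]]].
  rewrite -setXI; exists (X1 `&` Y1); split; first exact: measurableI.
  by exists (X2 `&` Y2); split => //; exact: measurableI.
- by move=> _; exists setT; split => //; exists setT; rewrite setXTT.
- by rewrite bigcup_const//; exists 0%N.
- by move=> _ [A [mA [B [mB ->]]]]; exact: m12.
Qed.

(* A rectangle only involves one more variable than the induction hypothesis, and
   the general case follows as rectangles determine a finite measure. *)
Lemma chain_indep k : (k <= m)%N -> forall A B, measurable A ->
  (forall i, measurable (B i)) ->
  P (chain k @^-1` A `&` tail_event k B) =
  (P (chain k @^-1` A) * P (tail_event k B))%E.
Proof.
elim: k => [_ A B mA mB|k IHk km A B mA mB].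
  have [Au|Au] := pselect (A u0).
    have -> : chain 0 @^-1` A = setT by apply/seteqP; split.
    by rewrite setTI probability_setT mul1e.
  have -> : chain 0 @^-1` A = set0 by apply/seteqP; split.
  by rewrite set0I measure0 mul0e.
have mG : measurable (tail_event k.+1 B) by exact: measurable_tail_event.
pose m1 := pushforward (mrestr P mG) (chain_pair k).
have PG0 : 0 <= fine (P (tail_event k.+1 B)) by rewrite fine_ge0.
pose m2 := mscale (NngNum PG0) (distribution P (chain_pair k)).
have m2E C : m2 C = (P (tail_event k.+1 B) * P (chain_pair k @^-1` C))%E.
  by rewrite /m2 /mscale/= fineK// fin_num_measure.
have -> : chain k.+1 @^-1` A = chain_pair k @^-1` (step @^-1` A) by [].
rewrite -[LHS]/(m1 (step @^-1` A)) muleC -m2E.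
have mS : measurable (step @^-1` A).
  by rewrite -[X in measurable X]setTI; exact: mstep.
apply: prod_measurable_eq => //.
  rewrite /m1/= /pushforward/= /mrestr preimage_setT setTI.
  by rewrite (le_lt_trans (probability_le1 _ _)) ?ltry.
move=> A' B' mA' mB'.
rewrite [RHS]m2E /= /pushforward /mrestr.
pose B1 i := if i == k then B' else B i.
have mB1 i : measurable (B1 i) by rewrite /B1; case: ifP.
have tB1 : tail_event k.+1 B1 = tail_event k.+1 B.
  apply/seteqP; split=> w h i kim; have := h i kim; rewrite /B1;
    by case: eqP kim => // ->; rewrite ltnn.
pose B2 i := if i == k then B' else setT.
have mB2 i : measurable (B2 i) by rewrite /B2; case: ifP.
have tB2 : tail_event k B2 = Y k @^-1` B'.
  rewrite tail_event_ltn// /B2 eqxx setIidl// => w _ i /andP[ki _].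
  by case: eqP ki => [->|//]; rewrite ltnn.
have e1 : chain_pair k @^-1` (A' `*` B') = chain k @^-1` A' `&` Y k @^-1` B'.
  by [].
rewrite e1 -setIA.
have -> : Y k @^-1` B' `&` tail_event k.+1 B = tail_event k B1.
  by rewrite (tail_event_ltn B1 km) tB1 /B1 eqxx.
rewrite (IHk (ltnW km) A' B1 mA' mB1) -{1}tB2 (IHk (ltnW km) A' B2 mA' mB2).
rewrite tB2 !probability_tail_event// big_ltn// {1}/B1 eqxx.
have -> : (\prod_(k.+1 <= i < m) P (Y i @^-1` B1 i) =
  \prod_(k.+1 <= i < m) P (Y i @^-1` B i))%E.
  apply: eq_big_nat => i /andP[ki _]; rewrite /B1.
  by case: eqP ki => // ->; rewrite ltnn.
by rewrite muleA muleC.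
Qed.

Lemma chain_pair_indep k A B : (k < m)%N -> measurable A -> measurable B ->
  P (chain k @^-1` A `&` Y k @^-1` B) =
  (P (chain k @^-1` A) * P (Y k @^-1` B))%E.
Proof.
move=> km mA mB; pose B2 i := if i == k then B else setT.
have mB2 i : measurable (B2 i) by rewrite /B2; case: ifP.
have <- : tail_event k B2 = Y k @^-1` B.
  rewrite tail_event_ltn// /B2 eqxx setIidl// => w _ i /andP[ki _].
  by case: eqP ki => [->|//]; rewrite ltnn.
by apply: chain_indep => //; exact: ltnW.
Qed.

(** By independence the law of the pair is the product of the two laws, to which Tonelli's theorem
    applies. *)
Lemma chain_tonelli k (f : U * T -> \bar R) : (k < m)%N ->
  measurable_fun setT f -> (forall z, 0 <= f z)%E ->
  (\int[P]_w f (chain k w, Y k w) =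
   \int[P]_w \int[P]_w' f (chain k w, Y k w'))%E.
Proof.
move=> km mf f0.
have h C : measurable C ->
    (distribution P (chain k) \x distribution P (Y k))%E C =
    distribution P (chain_pair k) C.
  by apply: product_measure_unique => A B mA mB; exact: chain_pair_indep.
transitivity (\int[distribution P (chain_pair k)]_z f z)%E.
  by rewrite ge0_integral_distribution.
rewrite -(eq_measure_integral _ (fun C mC _ => h C mC)).
rewrite fubini_tonelli1// ge0_integral_distribution//; last 2 first.
- exact: measurable_fun_fubini_tonelli_F.
- by move=> u; exact: integral_ge0.
apply: eq_integral => w _ /=; rewrite /fubini_F ge0_integral_distribution//.
exact: measurableT_comp.
Qed.

End independence.

(** * Real-valued expectations and probabilities *)

Section real_expectation.
Context {R : realType} {dO : measure_display} {O : measurableType dO}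
  (P : probability O R).
Implicit Types (f g : O -> R).

Definition rint f := P.-integrable setT (EFin \o f).
Definition Ex f : R := \int[P]_w f w.

Lemma rint_bounded f (c : R) : measurable_fun setT f ->
  (forall w, `|f w| <= c) -> rint f.
Proof.
move=> mf fc; apply: measurable_bounded_integrable => //.
  by rewrite (le_lt_trans (probability_le1 _ _)) ?ltry.
exists c; split; rewrite ?num_real// => x cx w _.
by apply: le_trans (fc w) _; exact: ltW.
Qed.

Lemma rint01 f : measurable_fun setT f -> (forall w, 0 <= f w <= 1) -> rint f.
Proof.
move=> mf f01; apply: (rint_bounded (c := 1)) => // w.
by have /andP[f0 f1] := f01 w; rewrite ger0_norm.
Qed.

Lemma rint_measurable f : rint f -> measurable_fun setT f.
Proof. by move=> /measurable_int /measurable_EFinP. Qed.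

Lemma rint_cst (c : R) : rint (fun=> c).
Proof. exact: (rint_bounded (c := `|c|)). Qed.

Lemma rintD f g : rint f -> rint g -> rint (fun w => f w + g w).
Proof. by move=> hf hg; apply: (integrableD _ hf hg). Qed.

Lemma rintB f g : rint f -> rint g -> rint (fun w => f w - g w).
Proof. by move=> hf hg; apply: (integrableB _ hf hg). Qed.

Lemma rintZ (c : R) f : rint f -> rint (fun w => c * f w).
Proof. by move=> hf; apply: (integrableZl _ c hf). Qed.

Lemma rint_sum (I : Type) (r : seq I) (F : I -> O -> R) :
  (forall i, rint (F i)) -> rint (fun w => \sum_(i <- r) F i w).
Proof.
move=> hF; elim: r => [|i r IHr].
  by under eq_fun do rewrite big_nil; exact: rint_cst.
by under eq_fun do rewrite big_cons; exact: rintD.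
Qed.

Lemma rint_avg (I : finType) (F : I -> O -> R) :
  (forall i, rint (F i)) -> rint (fun w => avg (fun i => F i w)).
Proof.
move=> hF; have -> : (fun w => avg (fun i => F i w)) =
    (fun w => #|I|%:R^-1 * \sum_i F i w).
  by apply/funext => w; rewrite mulrC.
by apply: rintZ; exact: rint_sum.
Qed.

Lemma rint_le f g : measurable_fun setT f -> (forall w, `|f w| <= g w) ->
  rint g -> rint f.
Proof.
move=> mf fg hg; apply: (le_integrable _ _ _ hg) => //.
  exact/measurable_EFinP.
by move=> w _ /=; rewrite lee_fin (le_trans (fg w))// ler_norm.
Qed.

Lemma rint_norm f : rint f -> rint (fun w => `|f w|).
Proof.
move=> hf; apply: (rint_le _ _ (integrable_abse hf)) => /=.
  exact/measurableT_comp/rint_measurable.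
by move=> w; rewrite normr_id.
Qed.

Lemma Ex_cst (c : R) : Ex (fun=> c) = c.
Proof.
rewrite /Ex Rintegral_cst//.
by rewrite -[LHS]/(c * fine (P setT)) probability_setT mulr1.
Qed.

Lemma ExD f g : rint f -> rint g -> Ex (fun w => f w + g w) = Ex f + Ex g.
Proof. by move=> hf hg; rewrite /Ex RintegralD. Qed.

Lemma ExB f g : rint f -> rint g -> Ex (fun w => f w - g w) = Ex f - Ex g.
Proof. by move=> hf hg; rewrite /Ex RintegralB. Qed.

Lemma ExZ (c : R) f : rint f -> Ex (fun w => c * f w) = c * Ex f.
Proof. by move=> hf; rewrite /Ex RintegralZl. Qed.

Lemma Ex_sum (I : Type) (r : seq I) (F : I -> O -> R) :
  (forall i, rint (F i)) ->
  Ex (fun w => \sum_(i <- r) F i w) = \sum_(i <- r) Ex (F i).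
Proof.
move=> hF; elim: r => [|i r IHr].
  by rewrite big_nil; under eq_fun do rewrite big_nil; rewrite Ex_cst.
rewrite big_cons -IHr -ExD//; last exact: rint_sum.
by congr Ex; apply/funext => w; rewrite big_cons.
Qed.

Lemma Ex_avg (I : finType) (F : I -> O -> R) :
  (forall i, rint (F i)) ->
  Ex (fun w => avg (fun i => F i w)) = avg (fun i => Ex (F i)).
Proof.
move=> hF; rewrite /avg -Ex_sum// mulrC -ExZ; last exact: rint_sum.
by congr Ex; apply/funext => w; rewrite mulrC.
Qed.

Lemma Ex_le f g : rint f -> rint g -> (forall w, f w <= g w) -> Ex f <= Ex g.
Proof. by move=> hf hg fg; apply: le_Rintegral. Qed.

Lemma Ex_ge0 f : (forall w, 0 <= f w) -> 0 <= Ex f.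
Proof. by move=> f0; apply: Rintegral_ge0. Qed.

Lemma Ex_norm_le f : rint f -> `|Ex f| <= Ex (fun w => `|f w|).
Proof. by move=> hf; apply: le_normr_Rintegral. Qed.

Lemma Ex_EFin f : rint f -> (\int[P]_w (f w)%:E)%E = (Ex f)%:E.
Proof.
by move=> hf; rewrite /Ex /Rintegral fineK//; exact: integrable_fin_num.
Qed.

Definition pr (A : set O) : R := fine (P A).

Lemma EFin_pr A : measurable A -> (pr A)%:E = P A.
Proof. by move=> mA; rewrite /pr fineK// fin_num_measure. Qed.

Lemma pr_ge0 A : 0 <= pr A. Proof. by rewrite /pr fine_ge0. Qed.

Lemma le_pr A B : measurable A -> measurable B -> A `<=` B -> pr A <= pr B.
Proof.
by move=> mA mB AB; rewrite -lee_fin !EFin_pr// le_measure ?inE.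
Qed.

Lemma prU_le A B : measurable A -> measurable B -> pr (A `|` B) <= pr A + pr B.
Proof.
move=> mA mB; rewrite -lee_fin EFinD !EFin_pr//; last exact: measurableU.
exact: measureU2.
Qed.

Lemma pr_setC A : measurable A -> pr (~` A) = 1 - pr A.
Proof.
move=> mA; apply: EFin_inj; rewrite EFinB !EFin_pr//; last exact: measurableC.
exact: probability_setC.
Qed.

Lemma pr_indic A : measurable A -> rint (\1_A : O -> R) /\ Ex \1_A = pr A.
Proof.
move=> mA; have i1 : rint (\1_A : O -> R).
  apply: rint01 => // w; rewrite indicE.
  by case: (w \in A); rewrite ?ler01 ?lexx.
split => //; apply: EFin_inj; rewrite -Ex_EFin// EFin_pr//.
by rewrite integral_indic// setIT.
Qed.

Lemma pr_le_Ex A f : measurable A -> rint f -> (forall w, 0 <= f w) ->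
  (forall w, A w -> 1 <= f w) -> pr A <= Ex f.
Proof.
move=> mA hf f0 f1; have [i1 <-] := pr_indic mA.
apply: Ex_le => // w; rewrite indicE.
by case: (boolP (w \in A)) => [/set_mem/f1|].
Qed.

Lemma Ex_le_pr A f : measurable A -> rint f -> (forall w, f w <= 1) ->
  (forall w, ~ A w -> f w <= 0) -> Ex f <= pr A.
Proof.
move=> mA hf f0 f1; have [i1 <-] := pr_indic mA.
apply: Ex_le => // w; rewrite indicE.
case: (boolP (w \in A)) => // /negP wA.
by apply: f1 => Aw; apply: wA; rewrite inE.
Qed.

Lemma markov_pr (a : R) f : 0 < a -> rint f -> (forall w, 0 <= f w) ->
  pr [set w | a <= f w] <= Ex f / a.
Proof.
move=> a0 hf f0; rewrite mulrC -ExZ//; apply: pr_le_Ex.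
- rewrite -[X in measurable X]setTI.
  exact: (measurable_fun_le measurableT (measurable_cst a)
    (rint_measurable hf)).
- exact: rintZ.
- by move=> w; rewrite mulr_ge0 ?invr_ge0// ltW.
- by move=> w /= aw; rewrite mulrC ler_pdivlMr// mul1r.
Qed.

End real_expectation.

(** * Measurability for random row vectors *)

Section vector_measurability.
Context {R : realType} {d : nat}.

Definition unvec (x : 'rV[R]_d) : d.-tuple R := [tuple x 0 j | j < d].

Lemma unvecK : cancel unvec (@vec R d).
Proof. by move=> x; apply/rowP => j; rewrite mxE tnth_mktuple. Qed.

Definition vmeasurable {dS : measure_display} {S : measurableType dS}
    (Z : S -> 'rV[R]_d) :=
  forall j, measurable_fun setT (fun s => Z s 0 j).

(** The sigma-algebra lives on tuples, so it is transported along [vec]. *)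
Definition vborel (f : 'rV[R]_d -> R) :=
  measurable_fun setT (fun t : d.-tuple R => f (vec t)).

Lemma vborel_comp {dS : measure_display} {S : measurableType dS}
    (Z : S -> 'rV[R]_d) f :
  vborel f -> vmeasurable Z -> measurable_fun setT (fun s => f (Z s)).
Proof.
move=> mf mZ.
have -> : (fun s => f (Z s)) = (fun t => f (vec t)) \o (fun s => unvec (Z s)).
  by apply/funext => s /=; rewrite unvecK.
apply: measurableT_comp => //; apply/measurable_fun_tnthP => j.
have -> : (@tnth d R)^~ j \o (fun s => unvec (Z s)) = (fun s => Z s 0 j).
  by apply/funext => s /=; rewrite tnth_mktuple.
exact: mZ.
Qed.

Lemma vmeasurable_vec : vmeasurable (@vec R d).
Proof.
move=> j; have -> : (fun s : d.-tuple R => vec s 0 j) = (fun s => tnth s j).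
  by apply/funext => s; rewrite mxE.
exact: measurable_tnth.
Qed.

Section operations.
Context {dS : measure_display} {S : measurableType dS}.
Implicit Types (Z : S -> 'rV[R]_d).

Lemma vmeasurable_cst (x : 'rV[R]_d) : vmeasurable (fun _ : S => x).
Proof. by move=> j; exact: measurable_cst. Qed.

Lemma vmeasurableD Z1 Z2 : vmeasurable Z1 -> vmeasurable Z2 ->
  vmeasurable (fun s => Z1 s + Z2 s).
Proof.
move=> m1 m2 j; under eq_fun do rewrite mxE.
exact: measurable_funD.
Qed.

Lemma vmeasurableZ (c : R) Z : vmeasurable Z -> vmeasurable (fun s => c *: Z s).
Proof.
move=> m1 j; under eq_fun do rewrite mxE.
exact: measurable_funM.
Qed.

Lemma vmeasurable_sum (I : Type) (r : seq I) (Z : I -> S -> 'rV[R]_d) :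
  (forall i, vmeasurable (Z i)) -> vmeasurable (fun s => \sum_(i <- r) Z i s).
Proof.
move=> mZ; elim: r => [|i r IHr].
  by under eq_fun do rewrite big_nil; exact: vmeasurable_cst.
by under eq_fun do rewrite big_cons; exact: vmeasurableD.
Qed.

End operations.

Lemma vmeasurable_comp {dS dT : measure_display} {S : measurableType dS}
    {T : measurableType dT} (Z : T -> 'rV[R]_d) (u : S -> T) :
  vmeasurable Z -> measurable_fun setT u -> vmeasurable (fun s => Z (u s)).
Proof. by move=> mZ mu j; exact: (measurableT_comp (mZ j) mu). Qed.

Lemma vborel_shift f (x : 'rV[R]_d) : vborel f -> vborel (fun y => f (y + x)).
Proof.
move=> mf; apply: (vborel_comp mf); apply: vmeasurableD.
  exact: vmeasurable_vec.
exact: vmeasurable_cst.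
Qed.

Lemma vborel_shiftavg (I : finType) (p : I -> 'rV[R]_d) f :
  vborel f -> vborel (shiftavg p f).
Proof.
move=> mf; apply: measurable_funM => //; apply: measurable_sum => i.
exact: (vborel_shift (p i) mf).
Qed.

Lemma vborel_iter (I : finType) (p : I -> 'rV[R]_d) f n :
  vborel f -> vborel (iter n (shiftavg p) f).
Proof. by move=> mf; elim: n => // n IHn; exact: vborel_shiftavg. Qed.

Lemma vborel_sqnorm : vborel (@sqnorm R d).
Proof.
apply: measurable_sum => j; apply: measurable_funX.
exact: vmeasurable_vec.
Qed.

End vector_measurability.

(** * Sums of independent random vectors *)

Section independent_sums.
Context {R : realType} {d : nat} {dO : measure_display} {O : measurableType dO}
  (P : probability O R) {dT : measure_display} {T : measurableType dT}
  (Y : nat -> {RV P >-> T}) (D : set nat) (m : nat).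
Hypothesis indY : mutually_independent D Y.
Hypothesis Dm : forall i, (i < m)%N -> D i.

Lemma chain_Ex {dU : measure_display} {U : measurableType dU}
    (u0 : U) (step : U * T -> U) k (f : U * T -> R) :
  measurable_fun setT step -> (k < m)%N -> measurable_fun setT f ->
  (forall z, 0 <= f z <= 1) ->
  rint P (fun w => Ex P (fun w' => f (chain Y u0 step k w, Y k w'))) /\
  Ex P (fun w => f (chain Y u0 step k w, Y k w)) =
  Ex P (fun w => Ex P (fun w' => f (chain Y u0 step k w, Y k w'))).
Proof.
move=> ms km mf f01.
have mch : measurable_fun setT (chain Y u0 step k) by exact: measurable_chain.
have i1 : rint P (fun w => f (chain Y u0 step k w, Y k w)).
  apply: rint01 => //; apply: measurableT_comp => //.
  exact: measurable_fun_pair.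
have i2 w : rint P (fun w' => f (chain Y u0 step k w, Y k w')).
  apply: rint01 => //; apply: measurableT_comp => //.
  by apply: measurable_fun_pair.
have e w : (\int[P]_w' (EFin \o f) (chain Y u0 step k w, Y k w'))%E =
    (Ex P (fun w' => f (chain Y u0 step k w, Y k w')))%:E.
  by rewrite -Ex_EFin.
have i3 : rint P (fun w => Ex P (fun w' => f (chain Y u0 step k w, Y k w'))).
  apply: rint01.
  - apply/measurable_EFinP.
    have -> : EFin \o (fun w => Ex P (fun w' => f (chain Y u0 step k w, Y k w')))
      = (fun u => \int[distribution P (Y k)]_t (f (u, t))%:E)%E \o
        chain Y u0 step k.
      apply/funext => w /=; rewrite -e ge0_integral_distribution//.
        by apply/measurable_EFinP; exact: measurableT_comp.
      by move=> t; rewrite lee_fin; case/andP: (f01 (chain Y u0 step k w, t)).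
    apply: measurableT_comp => //.
    have : measurable_fun setT
        (fubini_F (distribution P (Y k)) (EFin \o f : U * T -> \bar R)).
      apply: measurable_fun_fubini_tonelli_F; first exact/measurable_EFinP.
      by move=> z; rewrite /= lee_fin; case/andP: (f01 z).
    exact.
  - move=> w; apply/andP; split.
      by apply: Ex_ge0 => w'; case/andP: (f01 (chain Y u0 step k w, Y k w')).
    rewrite -[leRHS](Ex_cst P 1); apply: Ex_le => //; first exact: rint_cst.
    by move=> w'; case/andP: (f01 (chain Y u0 step k w, Y k w')).
split=> //; apply: EFin_inj; rewrite -Ex_EFin//.
rewrite (chain_tonelli indY Dm u0 ms (f := EFin \o f) km)//; last 2 first.
- exact/measurable_EFinP.
- by move=> z; rewrite /= lee_fin; case/andP: (f01 z).
under eq_integral do rewrite e.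
exact: Ex_EFin.
Qed.

Variable phi : T -> 'rV[R]_d.
Hypothesis mphi : vmeasurable phi.

Definition vstep (z : d.-tuple R * T) : d.-tuple R :=
  unvec (vec z.1 + phi z.2).

Lemma measurable_vstep : measurable_fun setT vstep.
Proof.
apply/measurable_fun_tnthP => j.
have -> : (@tnth d R)^~ j \o vstep = (fun z => tnth z.1 j + phi z.2 0 j).
  by apply/funext => z /=; rewrite tnth_mktuple !mxE.
apply: measurable_funD.
  by apply: (measurableT_comp (measurable_tnth j)).
exact: (measurableT_comp (mphi j)).
Qed.

Lemma chain_vstepE k w : chain Y (unvec 0) vstep k w =
  unvec (\sum_(i < k) phi (Y i w)).
Proof.
elim: k => [|k IHk] /=; first by rewrite big_ord0.
by rewrite IHk /vstep/= unvecK big_ord_recr.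
Qed.

Lemma Ex_sumS k (f : 'rV[R]_d -> R) : (k < m)%N -> vborel f ->
  (forall x, 0 <= f x <= 1) ->
  rint P (fun w =>
    Ex P (fun w' => f (\sum_(i < k) phi (Y i w) + phi (Y k w')))) /\
  Ex P (fun w => f (\sum_(i < k.+1) phi (Y i w))) =
  Ex P (fun w => Ex P (fun w' => f (\sum_(i < k) phi (Y i w) + phi (Y k w')))).
Proof.
move=> km mf f01.
have := chain_Ex (unvec 0) (f := fun z => f (vec (vstep z)))
  measurable_vstep km.
have h1 : measurable_fun setT (fun z => f (vec (vstep z))).
  by apply: (measurableT_comp mf); exact: measurable_vstep.
move=> /(_ h1 (fun z => f01 _)).
have -> : (fun w => f (vec (vstep (chain Y (unvec 0) vstep k w, Y k w)))) =
   (fun w => f (\sum_(i < k.+1) phi (Y i w))).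
  apply/funext => w; congr f.
  by rewrite chain_vstepE /vstep/= !unvecK big_ord_recr.
suff -> : (fun w => Ex P (fun w' =>
      f (vec (vstep (chain Y (unvec 0) vstep k w, Y k w'))))) =
    (fun w => Ex P (fun w' =>
      f (\sum_(i < k) phi (Y i w) + phi (Y k w')))) by [].
apply/funext => w; congr (Ex P _); apply/funext => w'.
by rewrite chain_vstepE /vstep/= !unvecK.
Qed.

Lemma vmeasurable_partial_sum k :
  vmeasurable (fun w => \sum_(i < k) phi (Y i w)).
Proof.
by apply: vmeasurable_sum => i; apply: vmeasurable_comp.
Qed.

(* Lindeberg's replacement argument, one summand at a time. *)
Lemma Ex_sum_shiftavg (I : finType) (p : I -> 'rV[R]_d) (f : 'rV[R]_d -> R)
    (c : R) : (0 < #|I|)%N -> vborel f -> (forall x, 0 <= f x <= 1) ->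
  (forall i x, (i < m)%N ->
     `|Ex P (fun w => f (x + phi (Y i w))) - shiftavg p f x| <= c) ->
  `|Ex P (fun w => f (\sum_(i < m) phi (Y i w))) - iter m (shiftavg p) f 0| <=
  m%:R * c.
Proof.
move=> I0 mf f01 fc.
pose g k := iter k (shiftavg p) f.
have mg k : vborel (g k) by exact: vborel_iter.
have g01 k x : 0 <= g k x <= 1.
  rewrite iter_shiftavg_ge0 ?iter_shiftavg_le// => y; by case/andP: (f01 y).
have ig k i x : rint P (fun w => g k (x + phi (Y i w))).
  apply: rint01 => //; apply: vborel_comp => //; apply: vmeasurableD.
    exact: vmeasurable_cst.
  exact: vmeasurable_comp.
have isu k j : rint P (fun w => g k (\sum_(i < j) phi (Y i w))).
  apply: rint01 => //; apply: vborel_comp => //.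
  exact: vmeasurable_partial_sum.
(* The one-step error of [f] passes to its iterated averages, since averaging over shifts commutes
   with the expectation and does not increase norms. *)
have gc k i x : (i < m)%N ->
    `|Ex P (fun w => g k (x + phi (Y i w))) - g k.+1 x| <= c.
  move=> im; elim: k x => [|k IHk] x; first exact: fc.
  rewrite [g k.+2 x]/=.
  have -> : Ex P (fun w => g k.+1 (x + phi (Y i w))) =
      shiftavg p (fun y => Ex P (fun w => g k (y + phi (Y i w)))) x.
    rewrite /shiftavg -Ex_avg//; congr (Ex P _); apply/funext => w.
    by congr avg; apply/funext => a; rewrite addrAC.
  have -> : shiftavg p (fun y => Ex P (fun w => g k (y + phi (Y i w)))) x -
      shiftavg p (shiftavg p (iter k (shiftavg p) f)) x =
      shiftavg p (fun y => Ex P (fun w => g k (y + phi (Y i w))) - g k.+1 y) x.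
    by rewrite /shiftavg avgB.
  exact: shiftavg_norm_le.
(* Hybrid sums: the first [k] summands are random, the other [m - k] are already averaged. *)
suff : forall k, (k <= m)%N ->
    `|Ex P (fun w => g (m - k)%N (\sum_(i < k) phi (Y i w))) - g m 0| <= k%:R * c.
  by move=> /(_ m (leqnn m)); rewrite subnn.
elim=> [_|k IHk km].
  rewrite subn0 (_ : (fun w => _) = (fun=> g m 0)); last first.
    by apply/funext => w; rewrite big_ord0.
  by rewrite Ex_cst subrr normr0 mul0r.
rewrite -natr1 mulrDl mul1r [leRHS]addrC.
rewrite -[X in `|X|](subrKA (Ex P (fun w => g (m - k)%N
  (\sum_(i < k) phi (Y i w))))).
apply: le_trans (ler_normD _ _) _; apply: lerD; last exact: IHk (ltnW km).
have [i1 ->] := Ex_sumS km (mg (m - k.+1)%N) (g01 (m - k.+1)%N).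
rewrite -ExB//; apply: le_trans (Ex_norm_le _) _; first exact: rintB.
rewrite -[leRHS](Ex_cst P c); apply: Ex_le.
- by apply: rint_norm; exact: rintB.
- exact: rint_cst.
- by move=> w; rewrite -(subnSK km); exact: gc.
Qed.

End independent_sums.

(** * One Lindeberg step: a random increment against a finite average *)

Section one_step.
Context {R : realType} {d : nat} {dO : measure_display} {O : measurableType dO}
  (P : probability O R).

Lemma measurable_mu : measurable_fun setT (@mu R).
Proof.
apply: measurable_funM => //; apply: measurable_minr => //.
by apply: continuous_measurable_fun; exact: sqrt_continuous.
Qed.

(** The same expansion at [x] serves both laws. Their covariances agree only approximately, and the
    bound [K] on the quadratic coefficients turns the discrepancy into the last term. *)
Lemma Ex_lindeberg (Z : O -> 'rV[R]_d) (f : 'rV[R]_d -> R) (K : R)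
    (I : finType) (p : I -> 'rV[R]_d) : (0 < #|I|)%N -> 0 <= K ->
  vmeasurable Z -> rint P (fun w => sqnorm (Z w)) ->
  (forall j, Ex P (fun w => Z w 0 j) = 0) ->
  vborel f -> (forall x, 0 <= f x <= 1) -> expands K f ->
  (forall j, avg (fun i => p i 0 j) = 0) ->
  forall x, `|Ex P (fun w => f (x + Z w)) - shiftavg p f x| <=
    K * (Ex P (fun w => mu (sqnorm (Z w))) + avg (fun i => mu (sqnorm (p i))) +
    \sum_j \sum_k `|Ex P (fun w => Z w 0 j * Z w 0 k) -
                    avg (fun i => p i 0 j * p i 0 k)|).
Proof.
move=> I0 K0 mZ iZ Z0 mf f01 fK p0 x; have [l [b [bK fb]]] := fK x.
have msq : measurable_fun setT (fun w => sqnorm (Z w)).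
  exact: (vborel_comp vborel_sqnorm).
have iZj j : rint P (fun w => Z w 0 j).
  apply: (rint_le (g := fun w => 1 + sqnorm (Z w))) => //; last first.
    by apply: rintD => //; exact: rint_cst.
  move=> w; have := le_coord_sqnorm (Z w) j; move: (Z w 0 j) => a ha.
  by rewrite ler_norml; apply/andP; split; nra.
have iZjk j k : rint P (fun w => Z w 0 j * Z w 0 k).
  apply: (rint_le (g := fun w => sqnorm (Z w))) => //.
    exact: measurable_funM.
  by move=> w; exact: normM_coord_le.
have imu : rint P (fun w => mu (sqnorm (Z w))).
  apply: (rint_le (g := fun w => sqnorm (Z w))) => //.
    by apply: (measurableT_comp measurable_mu).
  by move=> w; rewrite ger0_norm ?mu_ge0 ?mu_le ?sqnorm_ge0.
have ifx : rint P (fun w => f (x + Z w)).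
  apply: rint01 => //; apply: (vborel_comp mf); apply: vmeasurableD => //.
have il : rint P (fun w => \sum_j l j * Z w 0 j).
  by apply: rint_sum => j; exact: rintZ.
have ib : rint P (fun w => \sum_j \sum_k b j k * (Z w 0 j * Z w 0 k)).
  by apply: rint_sum => j; apply: rint_sum => k; exact: rintZ.
have ic : rint P (fun=> f x) by exact: rint_cst.
have i1 := rintB ifx ic; have i2 := rintB i1 il; have ir := rintB i2 ib.
pose B := \sum_j \sum_k b j k * Ex P (fun w => Z w 0 j * Z w 0 k).
have eP : `|Ex P (fun w => f (x + Z w)) - f x - B| <=
    K * Ex P (fun w => mu (sqnorm (Z w))).
  have -> : Ex P (fun w => f (x + Z w)) - f x - B =
    Ex P (fun w => f (x + Z w) - f x - \sum_j l j * Z w 0 j -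
                   \sum_j \sum_k b j k * (Z w 0 j * Z w 0 k)).
    rewrite !ExB// Ex_cst; congr (_ - _).
      rewrite Ex_sum; last by move=> j; exact: rintZ.
      by rewrite big1 ?subr0// => j _; rewrite ExZ// Z0 mulr0.
    rewrite Ex_sum; last by move=> j; apply: rint_sum => k; exact: rintZ.
    apply: eq_bigr => j _; rewrite Ex_sum; last by move=> k; exact: rintZ.
    by apply: eq_bigr => k _; rewrite ExZ.
  apply: le_trans (Ex_norm_le ir) _; rewrite -ExZ//; apply: Ex_le => //.
  - exact: rint_norm.
  - exact: rintZ.
have eA := avg_expansion I0 p0 fb; rewrite -/(B) in eP.
set A := \sum_j \sum_k b j k * avg _ in eA.
have eAB : `|B - A| <= K * \sum_j \sum_k `|Ex P (fun w => Z w 0 j * Z w 0 k) -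
                    avg (fun i => p i 0 j * p i 0 k)|.
  rewrite /A /B -sumrB big_distrr/=; apply: le_trans (ler_norm_sum _ _ _) _.
  apply: ler_sum => j _; rewrite -sumrB big_distrr/=.
  apply: le_trans (ler_norm_sum _ _ _) _; apply: ler_sum => k _.
  by rewrite -mulrBr normrM ler_wpM2r.
have -> : Ex P (fun w => f (x + Z w)) - shiftavg p f x =
  (Ex P (fun w => f (x + Z w)) - f x - B) - (shiftavg p f x - f x - A) +
  (B - A) by ring.
rewrite !mulrDr; apply: le_trans (ler_normD _ _) _; apply: lerD => //.
by apply: le_trans (ler_normB _ _) _; apply: lerD.
Qed.

End one_step.

Section identical_distribution.
Context {R : realType} {dO : measure_display} {O : measurableType dO}
  (P : probability O R) {dT : measure_display} {T : measurableType dT}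
  (Y : nat -> {RV P >-> T}).
Hypothesis idY : identically_distributed Y.

Lemma rint_id (g : T -> R) i : measurable_fun setT g ->
  rint P (fun w => g (Y 0%N w)) -> rint P (fun w => g (Y i w)).
Proof.
move=> mg /integrableP[_ foo]; apply/integrableP; split.
  by apply/measurable_EFinP; exact: (measurableT_comp mg).
apply: le_lt_trans foo; rewrite le_eqVlt; apply/orP; left; apply/eqP.
have mg' : measurable_fun setT (fun t => `|(g t)%:E|%E).
  by apply: measurableT_comp => //; exact/measurable_EFinP.
rewrite -[LHS](ge0_integral_distribution (Y i) mg' (fun t => abse_ge0 _)).
rewrite -[RHS](ge0_integral_distribution (Y 0%N) mg' (fun t => abse_ge0 _)).
by apply: eq_measure_integral => B mB _; exact: idY.
Qed.

Lemma Ex_id (g : T -> R) i : measurable_fun setT g ->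
  rint P (fun w => g (Y 0%N w)) ->
  Ex P (fun w => g (Y i w)) = Ex P (fun w => g (Y 0%N w)).
Proof.
move=> mg h0; have hi := rint_id i mg h0.
have mg' : measurable_fun setT (EFin \o g) by exact/measurable_EFinP.
apply: EFin_inj; rewrite -!Ex_EFin//.
rewrite -[LHS](integral_distribution (X := Y i) mg' hi).
rewrite -[RHS](integral_distribution (X := Y 0%N) mg' h0).
by apply: eq_measure_integral => B mB _; exact: idY.
Qed.

End identical_distribution.
Section dominated.
Context {R : realType} {dO : measure_display} {O : measurableType dO}
  (P : probability O R).

Lemma Ex_dominated (f : nat -> O -> R) (g : O -> R) :
  (forall n, measurable_fun setT (f n)) -> rint P g ->
  (forall n w, `|f n w| <= g w) ->
  (forall w e, 0 < e -> exists N, forall n, (N <= n)%N -> `|f n w| <= e) ->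
  forall e, 0 < e -> exists N, forall n, (N <= n)%N -> `|Ex P (f n)| <= e.
Proof.
move=> mf ig fg f0 e e0.
have ifn n : rint P (f n) by exact: rint_le ig.
have cf w : (f n w)%:E @[n --> \oo] --> (0 : R)%:E.
  apply: cvg_EFin; first by exact: nearW.
  apply/cvgrPdist_le => e' e'0; have [N hN] := f0 w e' e'0.
  by exists N => // n /= /hN; rewrite sub0r normrN.
have := @dominated_cvg _ _ _ P setT measurableT (fun n => EFin \o f n)
  (EFin \o (fun=> 0)) (EFin \o g).
rewrite [X in _ -> _ -> _ -> _ -> _ -> _ --> X](_ : _ = (0 : R)%:E); last first.
  exact: (integral0 P setT).
move=> /(_ _ _ _ ig) h.
have {h} : (\int[P]_w (f n w)%:E)%E @[n --> \oo] --> (0 : R)%:E.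
  apply: h.
  - by move=> n; exact/measurable_EFinP.
  - by move=> w _; exact: cf.
  - by [].
  - by move=> n w _; rewrite /= lee_fin.
have -> : (fun n => \int[P]_w (f n w)%:E)%E = (fun n => (Ex P (f n))%:E).
  by apply/funext => n; rewrite Ex_EFin.
move=> /fine_cvgP[_] /cvgrPdist_le /(_ e e0)[N _ hN].
exists N => n Nn; have := hN n Nn.
by rewrite /= sub0r normrN.
Qed.

Lemma Ex_uniform (I : {RV P >-> nat}) n (g : nat -> R) : (0 < n)%N ->
  (forall j, (j < n)%N -> distribution P I [set j] = (n%:R^-1)%:E) ->
  (forall j, 0 <= g j <= 1) ->
  Ex P (fun s => g (I s)) = avg (fun j : 'I_n => g j).
Proof.
move=> n0 In g01.
pose A (j : nat) : set O := I @^-1` [set j].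
have mA j : measurable (A j) by apply: measurable_funPTI.
have pA (j : 'I_n) : pr P (A j) = n%:R^-1.
  by apply: EFin_inj; rewrite EFin_pr// -(In j).
have iA j : rint P (\1_(A j) : O -> R) by have [] := pr_indic P (mA j).
have EA (j : 'I_n) : Ex P (\1_(A j) : O -> R) = n%:R^-1.
  by have [_ ->] := pr_indic P (mA j).
have mg : measurable_fun setT (fun s => g (I s)).
  by apply: (measurableT_comp (f := g)).
have ig : rint P (fun s => g (I s)) by exact: rint01.
have sumE (c : nat -> R) s :
    \sum_(j < n) c j * \1_(A j) s = if (I s < n)%N then c (I s) else 0.
  case: ifPn => [In'|nI].
    rewrite (bigD1 (Ordinal In'))//= big1 ?addr0.
      by rewrite indicE mem_set ?mulr1.
    move=> j /eqP jI; rewrite indicE memNset ?mulr0// => AI.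
    by apply: jI; apply: val_inj; rewrite /= -AI.
  rewrite big1// => j _; rewrite indicE memNset ?mulr0// => AI.
  by move: nI; rewrite AI ltn_ord.
pose h s : R := \sum_(j < n) g j * \1_(A j) s.
(* [r] is the indicator of [n <= I s]. Its expectation is 0 because the [n] atoms already have total
   mass 1, and it dominates [g (I s) - h s]. *)
pose r s : R := 1 - \sum_(j < n) 1 * \1_(A j) s.
have ih : rint P h by apply: rint_sum => j; exact: rintZ.
have is1 : rint P (fun s => \sum_(j < n) 1 * \1_(A j) s).
  by apply: rint_sum => j; exact: rintZ.
have ir : rint P r by apply: rintB => //; exact: rint_cst.
have Eh : Ex P h = avg (fun j : 'I_n => g j).
  rewrite Ex_sum; last by move=> j; exact: rintZ.
  rewrite /avg card_ord mulr_suml; apply: eq_bigr => j _.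
  by rewrite ExZ// EA.
have Er : Ex P r = 0.
  rewrite ExB//; last exact: rint_cst.
  rewrite Ex_cst Ex_sum; last by move=> j; exact: rintZ.
  under eq_bigr => j _ do rewrite ExZ// mul1r EA.
  rewrite sumr_const card_ord -[_ *+ n]mulr_natr mulVf ?subrr//.
  by rewrite pnatr_eq0 -lt0n.
rewrite -Eh; apply/eqP; rewrite -subr_eq0 -ExB//.
have id : rint P (fun s => g (I s) - h s) by exact: rintB.
have hd s : 0 <= g (I s) - h s <= r s.
  rewrite /h /r !sumE (sumE (fun=> 1)); have := g01 (I s).
  by case: ifP; lra.
apply/eqP/le_anti/andP; split.
  by rewrite -Er; apply: Ex_le => // s; case/andP: (hd s).
by apply: Ex_ge0 => s; case/andP: (hd s).
Qed.

End dominated.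

(** * The weak law of large numbers *)

Section weak_law.
Context {R : realType} {dO : measure_display} {O : measurableType dO}
  (P : probability O R) {dT : measure_display} {T : measurableType dT}
  (Y : nat -> {RV P >-> T}).
Hypothesis indY : mutually_independent setT Y.
Hypothesis idY : identically_distributed Y.

(** Given the partial sum, the next term has mean 0, so the cross term drops out and each step adds
    at most [C ^+ 2]. *)
Lemma second_moment_sum (psi : T -> R) (C : R) n : measurable_fun setT psi ->
  (forall t, `|psi t| <= C) -> (forall i, Ex P (fun w => psi (Y i w)) = 0) ->
  rint P (fun w => (\sum_(i < n) psi (Y i w)) ^+ 2) /\
  Ex P (fun w => (\sum_(i < n) psi (Y i w)) ^+ 2) <= n%:R * C ^+ 2.
Proof.
move=> mpsi psiC psi0.
have mS k : measurable_fun setT (fun w => \sum_(i < k) psi (Y i w)).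
  by apply: measurable_sum => i; exact: (measurableT_comp mpsi).
have SC k w : `|\sum_(i < k) psi (Y i w)| <= k%:R * C.
  apply: le_trans (ler_norm_sum _ _ _) _.
  rewrite mulr_natl -[X in _ *+ X](card_ord k) -sumr_const.
  by apply: ler_sum => i _; exact: psiC.
have iS2 k : rint P (fun w => (\sum_(i < k) psi (Y i w)) ^+ 2).
  apply: (rint_bounded P (c := (k%:R * C) ^+ 2)); first exact: measurable_funX.
  move=> w; rewrite normrX ler_pXn2r ?nnegrE//.
  exact: le_trans (SC k w).
split=> //; elim: n => [|n IHn].
  rewrite mul0r (_ : (fun w => _) = (fun=> 0)) ?Ex_cst//.
  by apply/funext => w; rewrite big_ord0 expr0n.
have mstep : measurable_fun setT (fun z : R * T => z.1 + psi z.2).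
  by apply: measurable_funD => //; exact: (measurableT_comp mpsi).
have chE k w : chain Y (0 : R) (fun z : R * T => z.1 + psi z.2) k w =
    \sum_(i < k) psi (Y i w).
  by elim: k => [|k IHk] /=; rewrite ?big_ord0// IHk big_ord_recr.
have ipsi i : rint P (fun w => psi (Y i w)).
  by apply: (rint_bounded P (c := C)) => //; exact: (measurableT_comp mpsi).
have ipsi2 i : rint P (fun w => psi (Y i w) ^+ 2).
  apply: (rint_bounded P (c := C ^+ 2)).
    by apply: measurable_funX; exact: (measurableT_comp mpsi).
  move=> w; rewrite normrX ler_pXn2r ?nnegrE//.
  exact: le_trans (psiC (Y i w)).
have inner u : rint P (fun w' => (u + psi (Y n w')) ^+ 2) /\
    Ex P (fun w' => (u + psi (Y n w')) ^+ 2) =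
    u ^+ 2 + Ex P (fun w' => psi (Y n w') ^+ 2).
  have -> : (fun w' => (u + psi (Y n w')) ^+ 2) =
      (fun w' => (u ^+ 2 + (2 * u) * psi (Y n w')) + psi (Y n w') ^+ 2).
    by apply/funext => w'; ring.
  have i1 := rint_cst P (u ^+ 2); have i2 := rintZ (2 * u) (ipsi n).
  have i3 := rintD i1 i2.
  split; first exact: rintD.
  by rewrite !ExD// Ex_cst ExZ// psi0 mulr0 addr0.
have mf : measurable_fun setT (fun z : R * T => ((z.1 + psi z.2) ^+ 2)%:E).
  by apply/measurable_EFinP; apply: measurable_funX.
have f0 (z : R * T) : (0 <= ((z.1 + psi z.2) ^+ 2)%:E)%E.
  by rewrite lee_fin sqr_ge0.
have := chain_tonelli indY (m := n.+1) (fun i _ => Logic.I) (0 : R) mstep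
  (ltnSn n) mf f0.
rewrite /=.
have -> : (fun w => ((chain Y (0 : R) (fun z : R * T => z.1 + psi z.2) n w +
   psi (Y n w)) ^+ 2)%:E) = (fun w => ((\sum_(i < n.+1) psi (Y i w)) ^+ 2)%:E).
  by apply/funext => w; rewrite chE big_ord_recr.
rewrite Ex_EFin//.
have -> : (fun w => (\int[P]_w' ((chain Y (0 : R)
     (fun z : R * T => z.1 + psi z.2) n w + psi (Y n w')) ^+ 2)%:E)%E) =
   (fun w => ((\sum_(i < n) psi (Y i w)) ^+ 2 + Ex P (fun w' => psi (Y n w') ^+ 2))%:E).
  apply/funext => w; rewrite chE.
  by have [h1 <-] := inner (\sum_(i < n) psi (Y i w)); rewrite Ex_EFin.
have ic := rint_cst P (Ex P (fun w' => psi (Y n w') ^+ 2)).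
rewrite Ex_EFin; last exact: rintD.
move=> -[] ->; rewrite (ExD (iS2 n) ic) Ex_cst -natr1 mulrDl mul1r lerD//.
rewrite -[leRHS](Ex_cst P); apply: Ex_le => //; first exact: rint_cst.
move=> w; rewrite -[leLHS]real_normK ?num_real// ler_pXn2r ?nnegrE//.
exact: le_trans (psiC (Y n w)).
Qed.

End weak_law.
Section weak_law_of_large_numbers.
Context {R : realType} {dO : measure_display} {O : measurableType dO}
  (P : probability O R) {dT : measure_display} {T : measurableType dT}
  (Y : nat -> {RV P >-> T}).
Hypothesis indY : mutually_independent setT Y.
Hypothesis idY : identically_distributed Y.

Lemma le_nat_above (x : R) : exists N, forall n, (N <= n)%N -> x <= n%:R.
Proof.
exists (Num.truncn x).+1 => n Nn; apply: (@le_trans _ _ (Num.truncn x).+1%:R).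
  exact/ltW/truncnS_gt.
by rewrite ler_nat.
Qed.

Lemma truncation_tail (phi : T -> R) : measurable_fun setT phi ->
  rint P (fun w => phi (Y 0%N w)) -> forall e, 0 < e ->
  exists C : R, 0 <= C /\ exists phiC : T -> R,
    [/\ measurable_fun setT phiC, (forall t, `|phiC t| <= C),
        (forall t, `|phi t - phiC t| <= `|phi t|) &
        Ex P (fun w => `|phi (Y 0%N w) - phiC (Y 0%N w)|) <= e].
Proof.
move=> mphi iphi e e0.
pose tr (n : nat) (t : T) := if `|phi t| <= n%:R then phi t else 0.
have mtr n : measurable_fun setT (tr n).
  apply: measurable_fun_ifT => //.
  by apply: measurable_fun_ler => //; exact: measurableT_comp.
have trle n t : `|phi t - tr n t| <= `|phi t|.
  by rewrite /tr; case: ifP => _; rewrite ?subrr ?normr0 ?subr0.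
have [] := @Ex_dominated R dO O P
    (fun n w => `|phi (Y 0%N w) - tr n (Y 0%N w)|)
    (fun w => `|phi (Y 0%N w)|) _ _ _ _ e e0.
- move=> n; apply: measurableT_comp => //; apply: measurable_funB.
    exact: (measurableT_comp mphi).
  exact: (measurableT_comp (mtr n)).
- exact: rint_norm.
- by move=> n w; rewrite normr_id; exact: trle.
- move=> w e' e'0; have [N hN] := le_nat_above `|phi (Y 0%N w)|.
  by exists N => n /hN; rewrite /tr => ->; rewrite subrr !normr0 ltW.
move=> N hN; exists N%:R; split => //; exists (tr N); split => //.
- by move=> t; rewrite /tr; case: ifP => // _; rewrite normr0.
- by apply: le_trans (hN N (leqnn N)); rewrite ler_norm.
Qed.

(* Truncation reduces the claim to bounded variables, hence to Chebyshev. *)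
Lemma weak_law (phi : T -> R) : measurable_fun setT phi ->
  rint P (fun w => phi (Y 0%N w)) -> forall e eta, 0 < e -> 0 < eta ->
  exists N, forall n, (N <= n)%N ->
    pr P [set w | e <= `|avg (fun i : 'I_n => phi (Y i w)) -
                         Ex P (fun w => phi (Y 0%N w))|] <= eta.
Proof.
move=> mphi iphi e eta e0 eta0.
(* The bound [e / 6] controls the bias of the truncated mean; [e * eta / 6] makes Markov's
   inequality at level [e / 3] give [eta / 2]. *)
have m0 : 0 < Num.min (e / 6) (e * eta / 6).
  by rewrite lt_min !divr_gt0// mulr_gt0.
have [C [C0 [phiC [mC bC tC]]]] := truncation_tail mphi iphi m0.
rewrite le_min; set tau := Ex P _ => /andP[tau1 tau2].
have iC i : rint P (fun w => phiC (Y i w)).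
  apply: (rint_bounded P (c := C)) => //; exact: (measurableT_comp mC).
set eC := Ex P (fun w => phiC (Y 0%N w)); set ee := Ex P (fun w => phi _).
have it : rint P (fun w => `|phi (Y 0%N w) - phiC (Y 0%N w)|).
  by apply: rint_norm; exact: rintB.
have eeC : `|eC - ee| <= e / 6.
  apply: le_trans tau1; rewrite distrC -ExB//.
  by apply: Ex_norm_le; exact: rintB.
have eCC : `|eC| <= C.
  apply: le_trans (Ex_norm_le (iC 0%N)) _; rewrite -[leRHS](Ex_cst P).
  by apply: Ex_le => //; [exact: rint_norm|exact: rint_cst].
pose psi t := phiC t - eC.
have mpsi : measurable_fun setT psi by exact: measurable_funB.
have psiC t : `|psi t| <= 2 * C.
  by apply: le_trans (ler_normB _ _) _; have := bC t; lra.
have psi0 i : Ex P (fun w => psi (Y i w)) = 0.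
  by rewrite ExB ?rint_cst// Ex_cst (Ex_id idY)// subrr.
(* Chebyshev at level [e / 3] gives [36 * C ^+ 2 / (n * e ^+ 2)], which is at most [eta / 2] for
   these [n]; the [+ 1] makes [n] positive. *)
have [N hN] := le_nat_above (72 * C ^+ 2 / (e ^+ 2 * eta) + 1).
exists N => n Nn; have {}hN := hN n Nn.
have n0 : 0 < n%:R :> R.
  apply: lt_le_trans hN; rewrite ltr_wpDl//.
  by rewrite divr_ge0// ?mulr_ge0 ?exprn_ge0// ltW.
have nn0 : (0 < n)%N by rewrite -(ltr_nat R).
have In0 : (0 < #|'I_n|)%N by rewrite card_ord.
have mt : measurable_fun setT (fun t => `|phi t - phiC t|).
  by apply: measurableT_comp => //; exact: measurable_funB.
pose f1 w := avg (fun i : 'I_n => `|phi (Y i w) - phiC (Y i w)|).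
have iti i : rint P (fun w => `|phi (Y i w) - phiC (Y i w)|).
  exact: (rint_id idY i mt it).
have if1 : rint P f1.
  exact: (rint_avg (F := fun (i : 'I_n) w => `|phi (Y i w) - phiC (Y i w)|)).
have Ef1 : Ex P f1 = tau.
  rewrite /f1 (Ex_avg (F := fun (i : 'I_n) w => `|phi (Y i w) - phiC (Y i w)|))//.
  rewrite -[RHS](avg_cst tau In0); congr avg; apply/funext => i.
  exact: (Ex_id idY i mt it).
have [iS ES] := second_moment_sum indY n mpsi psiC psi0.
pose f2 w := (avg (fun i : 'I_n => psi (Y i w))) ^+ 2.
have f2E : f2 = fun w => (n%:R^-1) ^+ 2 * (\sum_(i < n) psi (Y i w)) ^+ 2.
  by apply/funext => w; rewrite /f2 /avg card_ord mulrC exprMn.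
have if2 : rint P f2 by rewrite f2E; exact: rintZ.
have Ef2 : Ex P f2 <= 4 * C ^+ 2 / n%:R.
  rewrite f2E ExZ//; apply: (@le_trans _ _ ((n%:R^-1) ^+ 2 * (n%:R * (2 * C) ^+ 2))).
    by rewrite ler_wpM2l// exprn_ge0.
  rewrite le_eqVlt; apply/orP; left; apply/eqP; field.
  by rewrite gt_eqF.
have e30 : 0 < e / 3 by rewrite divr_gt0.
have e320 : 0 < (e / 3) ^+ 2 by rewrite exprn_gt0.
have p1 := markov_pr e30 if1 (fun w => avg_ge0 (fun i => normr_ge0 _)).
have p2 := markov_pr e320 if2 (fun w => sqr_ge0 _).
have mle (a : R) (f : O -> R) : rint P f -> measurable [set w | a <= f w].
  move=> hf; rewrite -[X in measurable X]setTI.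
  exact: (measurable_fun_le measurableT (measurable_cst a)
    (rint_measurable hf)).
apply: (@le_trans _ _ (pr P ([set w | e / 3 <= f1 w] `|`
                             [set w | (e / 3) ^+ 2 <= f2 w]))).
  apply: le_pr.
  - apply: mle; apply: rint_norm; apply: rintB; last exact: rint_cst.
    apply: (rint_avg (F := fun (i : 'I_n) w => phi (Y i w))) => i.
    exact: (rint_id idY i mphi iphi).
  - by apply: measurableU; exact: mle.
  - move=> w /= ew.
    have [|h1] := leP (e / 3) (f1 w); first by left.
    right; rewrite leNgt; apply/negP => h2.
    have h3 : `|avg (fun i : 'I_n => psi (Y i w))| < e / 3.
      by rewrite -(@ltr_pXn2r _ 2)// ?nnegrE ?ltW// real_normK ?num_real.
    have h4 : `|avg (fun i : 'I_n => phi (Y i w) - phiC (Y i w))| <= f1 w.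
      exact: ler_norm_avg.
    (* Centered truncated part, truncation error and bias: below [e / 3], below [e / 3], and at most
       [e / 6]. *)
    have h5 : avg (fun i : 'I_n => phi (Y i w)) - ee =
        avg (fun i : 'I_n => psi (Y i w)) +
        avg (fun i : 'I_n => phi (Y i w) - phiC (Y i w)) + (eC - ee).
      by rewrite /psi !avgB (avg_cst _ In0); ring.
    move: ew; rewrite h5 leNgt => /negP; apply.
    apply: le_lt_trans (ler_normD _ _) _.
    have := ler_normD (avg (fun i : 'I_n => psi (Y i w)))
        (avg (fun i : 'I_n => phi (Y i w) - phiC (Y i w))).
    by lra.
apply: le_trans (prU_le _ _ _) _; try exact: mle.
have q1 : Ex P f1 / (e / 3) <= eta / 2.
  by rewrite Ef1 ler_pdivrMr//; lra.
have q2 : Ex P f2 / (e / 3) ^+ 2 <= eta / 2.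
  rewrite ler_pdivrMr//; apply: le_trans Ef2 _.
  rewrite ler_pdivrMr//.
  have : 72 * C ^+ 2 / (e ^+ 2 * eta) <= n%:R by lra.
  rewrite ler_pdivrMr ?mulr_gt0 ?exprn_gt0// => h.
  have -> : eta / 2 * (e / 3) ^+ 2 * n%:R = n%:R * (e ^+ 2 * eta) / 18 by field.
  by lra.
by lra.
Qed.

End weak_law_of_large_numbers.
(** * Replacing a sample by its regression on one coordinate *)

Section centered_sample.
Context {R : realType} {d n : nat}.
Hypothesis n0 : (0 < n)%N.
Variable x : 'I_n -> 'rV[R]_d.

Definition centered (a : 'I_n) : 'rV[R]_d :=
  (Num.sqrt n%:R)^-1 *: (x a - n%:R^-1 *: \sum_b x b).

Local Notation p := centered.
Local Notation m j := (avg (fun a => x a 0 j)).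

Let nR0 : 0 < n%:R :> R. Proof. by rewrite ltr0n. Qed.
Let I0 : (0 < #|'I_n|)%N. Proof. by rewrite card_ord. Qed.
Let sn0 : 0 < Num.sqrt n%:R :> R. Proof. by rewrite sqrtr_gt0. Qed.
Let sn2 : (Num.sqrt n%:R : R) ^+ 2 = n%:R. Proof. by rewrite sqr_sqrtr. Qed.

Lemma mean_coord j : (n%:R^-1 *: \sum_b x b) 0 j = m j.
Proof. by rewrite mxE summxE /avg card_ord mulrC. Qed.

Lemma centeredE a j : p a 0 j = (Num.sqrt n%:R)^-1 * (x a 0 j - m j).
Proof.
rewrite -mean_coord mxE; congr (_ * _).
by rewrite mxE; congr (_ + _); rewrite mxE.
Qed.

Lemma centered_mean j : avg (fun a => p a 0 j) = 0.
Proof.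
under [X in avg X]eq_fun do rewrite centeredE.
by rewrite avgZ avgB (avg_cst _ I0) subrr mulr0.
Qed.

Lemma centered_cov j k : n%:R * avg (fun a => p a 0 j * p a 0 k) =
  avg (fun a => x a 0 j * x a 0 k) - m j * m k.
Proof.
have -> : (fun a => p a 0 j * p a 0 k) = (fun a => n%:R^-1 *
    ((x a 0 j * x a 0 k - m j * x a 0 k) - m k * (x a 0 j - m j))).
  by apply/funext => a; rewrite !centeredE -{3}sn2; field; rewrite gt_eqF.
rewrite avgZ mulrA divff ?mul1r ?gt_eqF//.
have e1 : avg (fun a => m j * x a 0 k) = m j * m k by rewrite avgZ.
have e2 : avg (fun a => m k * (x a 0 j - m j)) = 0.
  by rewrite avgZ avgB (avg_cst (m j) I0) subrr mulr0.
by rewrite !avgB e1 e2 subr0.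
Qed.

Variables (S : 'I_d -> 'I_d -> R) (g : R).
Hypothesis g01 : 0 < g <= 1.
Hypothesis xm : forall j, `|m j| <= g.
Hypothesis xc : forall j k, `|avg (fun a => x a 0 j * x a 0 k) - S j k| <= g.
Hypothesis xmu : avg (fun a => n%:R * mu (sqnorm (x a) / n%:R)) <= 2 * g.

Lemma centered_cov_close j k :
  `|n%:R * avg (fun a => p a 0 j * p a 0 k) - S j k| <= 2 * g.
Proof.
have /andP[gp g1] := g01.
have mm : `|m j * m k| <= g.
  by rewrite normrM -[leRHS]mulr1 ler_pM// (le_trans (xm k)).
rewrite centered_cov addrAC; apply: le_trans (ler_normB _ _) _.
by have := xc j k; lra.
Qed.

(** [muD_le] separates the sample mean from the data. The data contribute [8 * (2 * g)]; the mean
    contributes [8 * (d * g)], by [mu t <= t] and [g ^+ 2 <= g]. *)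
Lemma centered_mu : n%:R * avg (fun a => mu (sqnorm (p a))) <=
  (16 + 8 * d%:R) * g.
Proof.
pose mm : 'rV[R]_d := n%:R^-1 *: \sum_b x b.
have mmg : sqnorm mm <= d%:R * g.
  rewrite mulr_natl -[X in _ *+ X](card_ord d) -sumr_const.
  apply: ler_sum => j _; rewrite mean_coord.
  have /andP[gp g1] := g01.
  rewrite -real_normK ?num_real// expr2 -[leRHS]mulr1 ler_pM//.
  exact: le_trans (xm j) g1.
have key a : n%:R * mu (sqnorm (p a)) <=
    8 * (n%:R * mu (sqnorm (x a) / n%:R)) + 8 * sqnorm mm.
  have -> : sqnorm (p a) = sqnorm (x a - mm) / n%:R.
    by rewrite sqnormZ exprVn sn2 mulrC.
  have h1 : sqnorm (x a - mm) / n%:R <=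
      2 * (sqnorm (x a) / n%:R) + 2 * (sqnorm mm / n%:R).
    rewrite !mulrA -mulrDl ler_wpM2r ?invr_ge0//.
    by rewrite -[sqnorm mm](_ : sqnorm (- mm) = _) ?sqnormD_le// -scaleN1r
      sqnormZ sqrrN expr1n mul1r.
  have := mu_homo _ h1; rewrite divr_ge0 ?sqnorm_ge0// => /(_ isT) h2.
  have h3 := @muD_le R (sqnorm (x a) / n%:R) (sqnorm mm / n%:R).
  rewrite !divr_ge0 ?sqnorm_ge0// in h3; have {}h3 := h3 isT isT.
  have h4 := @mu_le R (sqnorm mm / n%:R).
  rewrite divr_ge0 ?sqnorm_ge0// in h4; have {}h4 := h4 isT.
  have h5 : n%:R * (sqnorm mm / n%:R) = sqnorm mm by field; rewrite gt_eqF.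
  rewrite -h5.
  have : mu (sqnorm (x a - mm) / n%:R) <=
     8 * mu (sqnorm (x a) / n%:R) + 8 * (sqnorm mm / n%:R) by lra.
  by move/(ler_wpM2l (ltW nR0)); lra.
rewrite -avgZ; apply: le_trans (avg_le key) _.
rewrite avgD [X in X + _]avgZ (avg_cst (8 * sqnorm mm) I0).
have -> : (16 + 8 * d%:R) * g = 8 * (2 * g) + 8 * (d%:R * g) by ring.
by rewrite lerD// ler_wpM2l.
Qed.

Variable j0 : 'I_d.
Hypothesis s0 : 0 < S j0 j0.
Hypothesis gs : 4 * g <= S j0 j0.

Local Notation c := (avg (fun a => p a 0 j0 ^+ 2)).

(* Regression of the sample on its coordinate [j0]: the part explained by that
   coordinate is replaced by a Rademacher multiple of [regr], which leaves the
   covariance unchanged. *)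
Definition regr : 'rV[R]_d :=
  \row_k ((Num.sqrt c)^-1 * avg (fun a => p a 0 j0 * p a 0 k)).
Definition resid (a : 'I_n) : 'rV[R]_d :=
  p a - ((Num.sqrt c)^-1 * p a 0 j0) *: regr.

Lemma c_lower : S j0 j0 / 2 <= n%:R * c.
Proof.
have : `|n%:R * c - S j0 j0| <= 2 * g := centered_cov_close j0 j0.
rewrite ler_norml => /andP[h _].
have h2 : 2 * g <= S j0 j0 / 2 by have := gs; lra.
move: h; move: (n%:R * c) => y h.
lra.
Qed.

Let c0 : 0 < c.
Proof.
by rewrite -(pmulr_rgt0 _ nR0); apply: lt_le_trans c_lower; rewrite divr_gt0.
Qed.
Let sc0 : 0 < Num.sqrt c. Proof. by rewrite sqrtr_gt0. Qed.
Let sc2 : Num.sqrt c ^+ 2 = c. Proof. by rewrite sqr_sqrtr// ltW. Qed.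

Lemma residE a k : resid a 0 k =
  p a 0 k - (Num.sqrt c)^-1 * p a 0 j0 * regr 0 k.
Proof.
by rewrite mxE; congr (_ + _); rewrite mxE; congr (- _); rewrite mxE.
Qed.

Definition replacement (ab : 'I_n * bool) : 'rV[R]_d :=
  resid ab.1 + signed_vec regr ab.2.

Lemma replacementE a b k : replacement (a, b) 0 k =
  resid a 0 k + (-1) ^+ b * regr 0 k.
Proof. by rewrite mxE; congr (_ + _); rewrite mxE. Qed.

Lemma avg_bool (f : bool -> R) : avg f = (f true + f false) / 2.
Proof. by rewrite /avg card_bool big_bool. Qed.

Lemma resid_mean k : avg (fun a => resid a 0 k) = 0.
Proof.
under [X in avg X]eq_fun do rewrite residE -mulrA mulrCA mulrC.
rewrite avgB centered_mean; set z := avg _.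
have -> : z = avg (fun a => (regr 0 k / Num.sqrt c) * p a 0 j0).
  by congr avg; apply/funext => a; ring.
by rewrite avgZ centered_mean mulr0 subrr.
Qed.

Lemma regrE k : regr 0 k = (Num.sqrt c)^-1 * avg (fun a => p a 0 j0 * p a 0 k).
Proof. by rewrite mxE. Qed.

Lemma resid_cov j k : avg (fun a => resid a 0 j * resid a 0 k) =
  avg (fun a => p a 0 j * p a 0 k) - regr 0 j * regr 0 k.
Proof.
have hk l : avg (fun a => p a 0 j0 * p a 0 l) = Num.sqrt c * regr 0 l.
  by rewrite regrE mulrA divff ?mul1r// gt_eqF.
have -> : (fun a => resid a 0 j * resid a 0 k) = (fun a =>
  p a 0 j * p a 0 k - (regr 0 k / Num.sqrt c) * (p a 0 j0 * p a 0 j) -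
  (regr 0 j / Num.sqrt c) * (p a 0 j0 * p a 0 k) +
  (regr 0 j * regr 0 k / Num.sqrt c ^+ 2) * (p a 0 j0 ^+ 2)).
  apply/funext => a; rewrite !residE.
  move: (Num.sqrt c) (gt_eqF sc0) => z /negbT z0.
  by field.
rewrite avgD avgB avgB.
rewrite (avgZ _ (fun a => p a 0 j0 * p a 0 j)).
rewrite (avgZ _ (fun a => p a 0 j0 * p a 0 k)).
rewrite (avgZ _ (fun a => p a 0 j0 ^+ 2)) (hk j) (hk k).
have -> : regr 0 j * regr 0 k / Num.sqrt c ^+ 2 * c = regr 0 j * regr 0 k.
  by rewrite sc2 divfK// gt_eqF.
move: (Num.sqrt c) (gt_eqF sc0) => z /negbT z0.
by field.
Qed.

Lemma replacement_mean k : avg (fun ab => replacement ab 0 k) = 0.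
Proof.
have -> : (fun ab => replacement ab 0 k) =
    (fun ab => replacement (ab.1, ab.2) 0 k) by apply/funext => -[].
rewrite (avg_pair (fun a b => replacement (a, b) 0 k)).
rewrite -[RHS](resid_mean k); congr avg; apply/funext => a.
by rewrite avg_bool !replacementE expr0 expr1; field.
Qed.

(** Residuals are uncorrelated with the coordinate [j0], and the explained part has second moments
    [regr 0 j * regr 0 k], exactly those of an independent random sign times [regr]. *)
Lemma replacement_cov j k :
  avg (fun ab => replacement ab 0 j * replacement ab 0 k) =
  avg (fun a => p a 0 j * p a 0 k).
Proof.
have -> : (fun ab => replacement ab 0 j * replacement ab 0 k) =
    (fun ab => replacement (ab.1, ab.2) 0 j * replacement (ab.1, ab.2) 0 k).
  by apply/funext => -[].
rewrite (avg_pair (fun a b => replacement (a, b) 0 j * replacement (a, b) 0 k)).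
have -> : (fun a => avg (fun b => replacement (a, b) 0 j * replacement (a, b) 0 k))
    = (fun a => resid a 0 j * resid a 0 k + regr 0 j * regr 0 k).
  by apply/funext => a; rewrite avg_bool !replacementE expr0 expr1; field.
by rewrite avgD resid_cov (avg_cst _ I0) subrK.
Qed.

(** The coordinate [j0] of [regr] is [c / sqrt c = sqrt c]. *)
Lemma regr_lower : S j0 j0 / 2 / n%:R <= sqnorm regr.
Proof.
apply: le_trans (le_coord_sqnorm regr j0).
rewrite regrE [X in _^-1 * X](_ : _ = c) // exprMn exprVn sc2.
have -> : c^-1 * c ^+ 2 = c by rewrite expr2 mulKf// gt_eqF.
by rewrite ler_pdivrMr// [leRHS]mulrC; exact: c_lower.
Qed.

(** The trace of [S], plus an error of at most 2 per diagonal entry since [g <= 1]. *)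
Let tau := \sum_j S j j + 2 * d%:R.

Lemma avg_sqnorm_le : n%:R * avg (fun a => sqnorm (p a)) <= tau.
Proof.
rewrite /sqnorm avg_sum big_distrr/= /tau.
have -> : 2 * d%:R = \sum_(j < d) 2 :> R.
  by rewrite sumr_const card_ord mulr_natr.
rewrite -big_split/=; apply: ler_sum => j _.
have := centered_cov_close j j; rewrite ler_norml => /andP[_ h].
have -> : avg (fun a => p a 0 j ^+ 2) = avg (fun a => p a 0 j * p a 0 j) by [].
by have /andP[_ g1] := g01; lra.
Qed.

(** Every entry of the sample covariance is bounded by its trace. *)
Lemma regr_upper :
  sqnorm regr <= d%:R * tau ^+ 2 / (n%:R ^+ 2 * c).
Proof.
have t0 : 0 <= n%:R * avg (fun a => sqnorm (p a)).
  by rewrite mulr_ge0// avg_ge0// => a; exact: sqnorm_ge0.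
rewrite -mulrA mulr_natl -[X in _ *+ X](card_ord d) -sumr_const.
apply: ler_sum => k _; rewrite regrE; set y := avg (fun a => p a 0 j0 * p a 0 k).
have ny : (n%:R * y) ^+ 2 <= tau ^+ 2.
  rewrite -[leLHS]real_normK ?num_real// ler_pXn2r ?nnegrE//; last first.
    exact: le_trans t0 avg_sqnorm_le.
  apply: le_trans avg_sqnorm_le; rewrite normrM ger0_norm ?ler_wpM2l//.
  apply: le_trans (ler_norm_avg _) _; apply: avg_le => a.
  exact: normM_coord_le.
rewrite exprMn exprVn sc2 [leLHS]mulrC [(n%:R ^+ 2 * _)^-1]invfM mulrA.
rewrite ler_wpM2r ?invr_ge0 ?(ltW c0)//.
by rewrite ler_pdivlMr ?exprn_gt0// mulrC -exprMn.
Qed.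

End centered_sample.

(** * Anti-concentration of the iterated average over a typical sample *)

Section sample_anticoncentration.
Context {R : realType} {d : nat}.
Variables (S : 'I_d -> 'I_d -> R) (j0 : 'I_d).

(* All the information about the sample used in the comparison: its first two
   moments are within [g] of [0] and [S], and it satisfies Lindeberg's
   condition up to [2 * g]. *)
Definition typical_sample (n : nat) (x : 'I_n -> 'rV[R]_d) (g : R) :=
  [/\ forall j, `|avg (fun a => x a 0 j)| <= g,
      forall j k, `|avg (fun a => x a 0 j * x a 0 k) - S j k| <= g &
      avg (fun a => n%:R * mu (sqnorm (x a) / n%:R)) <= 2 * g].

(** The first term is the cost of passing to the replacement, the other two are the Rademacher
    bound. [C1] depends on [S] only, so [g] and [n] can be adapted to [K] afterwards. *)
Lemma sample_anticoncentration : 0 < S j0 j0 -> exists C1 : R, 0 <= C1 /\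
  forall (n : nat) (x : 'I_n -> 'rV[R]_d) (g : R), (0 < n)%N ->
    0 < g <= 1 -> 4 * g <= S j0 j0 -> typical_sample x g ->
  forall (K lo w : R) f, 0 <= K -> 0 <= w -> expands K f ->
    (forall s, f s <= 1) ->
    (forall s, ~~ (lo <= sqnorm s <= lo + w) -> f s <= 0) ->
  iter n (shiftavg (centered x)) f 0 <=
    K * C1 * (g + (Num.sqrt n%:R)^-1) +
    2 * Num.sqrt (w / (2 * S j0 j0)) + 2 / Num.sqrt n%:R.
Proof.
move=> s0; set s := S j0 j0 in s0 *.
(* [L / n] bounds [sqnorm u], [H] bounds [sqnorm u / c], [cc] bounds the growth of the squared norm
   from [p] to its residual, and [A] comes from [centered_mu]. *)
pose tau := \sum_j S j j + 2 * d%:R.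
pose H := 4 * d%:R * tau ^+ 2 / s ^+ 2.
pose cc := 2 * (1 + H).
pose L := 2 * d%:R * tau ^+ 2 / s.
pose A : R := 16 + 8 * d%:R.
have H0 : 0 <= H by rewrite !(sqr_ge0, ler0n, divr_ge0, mulr_ge0).
have cc1 : 1 <= cc by rewrite /cc; lra.
have L0 : 0 <= L by rewrite !(sqr_ge0, ler0n, divr_ge0, mulr_ge0, ltW s0).
have A0 : 0 <= A by rewrite addr_ge0// mulr_ge0.
pose C1 := A * (1 + 8 * cc ^+ 3) + 8 * (L * Num.sqrt L).
have cc0 : 0 <= cc by apply: le_trans cc1.
exists C1; split.
  apply: addr_ge0; apply: mulr_ge0 => //.
    by apply: addr_ge0 => //; apply: mulr_ge0 => //; exact: exprn_ge0.
  by apply: mulr_ge0.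
move=> n x g n0 g01 gs [xm xc xmu] K lo w f K0 w0 fK f1 fout.
have I0 : (0 < #|'I_n|)%N by rewrite card_ord.
have J0 : (0 < #|{: 'I_n * bool}|)%N.
  by rewrite card_prod card_ord card_bool muln_gt0 n0.
have nR0 : 0 < n%:R :> R by rewrite ltr0n.
have sn0 : 0 < Num.sqrt n%:R :> R by rewrite sqrtr_gt0.
set p := centered x; set u := regr x j0; set q := replacement x j0.
have cl := c_lower n0 g01 xm xc gs.
set c := avg (fun a => centered x a 0 j0 ^+ 2) in cl.
have c0 : 0 < c.
  by rewrite -(pmulr_rgt0 _ nR0); apply: lt_le_trans cl; rewrite divr_gt0.
have ulo : s / 2 / n%:R <= sqnorm u := regr_lower n0 g01 xm xc s0 gs.
have uhi : sqnorm u <= d%:R * tau ^+ 2 / (n%:R ^+ 2 * c) :=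
  regr_upper n0 g01 xm xc s0 gs.
have uL : sqnorm u <= L / n%:R.
  apply: le_trans uhi _; rewrite /L.
  have -> : 2 * d%:R * tau ^+ 2 / s / n%:R = d%:R * tau ^+ 2 / (n%:R * (s / 2)).
    by field; rewrite !gt_eqF.
  apply: ler_wpM2l; first exact: (mulr_ge0 (ler0n _ _) (sqr_ge0 _)).
  have s20 : 0 < s / 2 by rewrite divr_gt0.
  rewrite lef_pV2 ?posrE ?(mulr_gt0 nR0 s20) ?(mulr_gt0 (exprn_gt0 2 nR0) c0)//.
  by rewrite expr2 -mulrA; apply: ler_wpM2l => //; exact: ltW.
have uH : sqnorm u / c <= H.
  rewrite ler_pdivrMr//; apply: le_trans uL _.
  have -> : L / n%:R = H * (s / 2 / n%:R) by rewrite /L /H; field; rewrite !gt_eqF.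
  by rewrite ler_wpM2l// ler_pdivrMr// [leRHS]mulrC.
have rp a : sqnorm (resid x j0 a) <= cc * sqnorm (p a).
  have -> : resid x j0 a = p a + (- ((Num.sqrt c)^-1 * p a 0 j0)) *: u.
    by rewrite scaleNr.
  apply: le_trans (sqnormD_le _ _) _; rewrite (sqnormZ _ u) sqrrN exprMn exprVn.
  rewrite sqr_sqrtr ?(ltW c0)//.
  have e : c^-1 * p a 0 j0 ^+ 2 * sqnorm u = p a 0 j0 ^+ 2 * (sqnorm u / c).
    by ring.
  have h : p a 0 j0 ^+ 2 * (sqnorm u / c) <= sqnorm (p a) * H.
    apply: ler_pM => //; first exact: sqr_ge0.
      by apply: divr_ge0; [exact: sqnorm_ge0|exact: ltW].
    exact: le_coord_sqnorm.
  by rewrite e /cc; lra.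
have snu b : sqnorm (signed_vec u b) = sqnorm u.
  by rewrite sqnormZ; case: b; rewrite ?expr0 ?expr1 ?sqrrN expr1n mul1r.
have muq a b : mu (sqnorm (q (a, b))) <=
    8 * (cc ^+ 3 * mu (sqnorm (p a))) + 8 * mu (L / n%:R).
  have h1 : sqnorm (q (a, b)) <= 2 * sqnorm (resid x j0 a) + 2 * sqnorm u.
    by apply: le_trans (sqnormD_le _ _) _; rewrite snu.
  apply: le_trans (mu_homo (sqnorm_ge0 _) h1) _.
  apply: le_trans (muD_le (sqnorm_ge0 _) (sqnorm_ge0 _)) _.
  apply: lerD; rewrite ler_wpM2l//; last first.
    by apply: mu_homo => //; exact: sqnorm_ge0.
  apply: le_trans (mu_sqM cc1 (sqnorm_ge0 _)).
  apply: mu_homo; first exact: sqnorm_ge0.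
  apply: le_trans (rp a) _; rewrite ler_wpM2r ?sqnorm_ge0//.
  by rewrite expr2 ler_peMl.
(* The vector [u] has length of order [n ^ (-1/2)], so on the cubic branch of [mu] its [n] copies
   cost only [O (n ^ (-1/2))]. *)
have nmuL : n%:R * mu (L / n%:R) <= L * Num.sqrt L / Num.sqrt n%:R.
  have h0 : 0 <= L / n%:R by rewrite divr_ge0.
  have -> : L * Num.sqrt L / Num.sqrt n%:R =
      n%:R * (L / n%:R * Num.sqrt (L / n%:R)).
    rewrite (sqrtrM _ L0) sqrtrV ?(ltW nR0)//.
    by field; rewrite !gt_eqF.
  by apply: ler_wpM2l; [exact: ltW|exact: mu_le_sqrt].
have nmup : n%:R * avg (fun a => mu (sqnorm (p a))) <= A * g :=
  centered_mu n0 g01 xm xmu.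
have nmuq : n%:R * avg (fun ab => mu (sqnorm (q ab))) <=
    8 * cc ^+ 3 * (A * g) + 8 * (L * Num.sqrt L / Num.sqrt n%:R).
  have h : avg (fun ab => mu (sqnorm (q ab))) <=
      avg (fun ab : 'I_n * bool =>
        8 * (cc ^+ 3 * mu (sqnorm (p ab.1))) + 8 * mu (L / n%:R)).
    by apply: avg_le => -[a b]; exact: muq.
  rewrite (avg_pair (J := bool) (fun a _ => 8 * (cc ^+ 3 * mu (sqnorm (p a))) +
    8 * mu (L / n%:R))) in h.
  have e : (fun a => avg (fun _ : bool => 8 * (cc ^+ 3 * mu (sqnorm (p a))) +
    8 * mu (L / n%:R))) = (fun a => 8 * cc ^+ 3 * mu (sqnorm (p a)) +
    8 * mu (L / n%:R)).
    by apply/funext => a; rewrite avg_cst ?card_bool// mulrA.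
  rewrite e avgD avgZ (avg_cst (8 * mu (L / n%:R)) I0) in h.
  have := ler_wpM2l (ltW nR0) h; move/le_trans; apply.
  rewrite mulrDr mulrCA lerD//.
    by rewrite ler_wpM2l// mulr_ge0// exprn_ge0.
  by rewrite mulrCA ler_wpM2l.
have lind := shiftavg_lindeberg I0 J0 fK (centered_mean n0 x)
  (replacement_mean n0 x j0)
  (fun j k => esym (replacement_cov n0 g01 xm xc s0 gs j k)).
have dist := iter_shiftavg_dist n I0 J0 lind 0.
(* Since [sqnorm u >= s / (2 n)], the band condition follows from [D ^+ 2 > w n / (2 s)]. *)
set D := (Num.truncn (Num.sqrt (w * n%:R / (2 * s)))).+1.
have s20 : 0 < 2 * s by rewrite mulr_gt0.
have wns : 0 <= w * n%:R / (2 * s) by rewrite divr_ge0 ?mulr_ge0// ltW.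
have Dgt : Num.sqrt (w * n%:R / (2 * s)) < D%:R by exact: truncnS_gt.
have Dle : D%:R <= Num.sqrt (w * n%:R / (2 * s)) + 1.
  by rewrite /D -natr1 lerD2r truncn_le ?sqrtr_ge0.
have wD : w < 4 * sqnorm u * D%:R ^+ 2.
  have h : w * n%:R / (2 * s) < D%:R ^+ 2.
    by rewrite -[ltLHS]sqr_sqrtr// ltr_pXn2r ?nnegrE ?sqrtr_ge0.
  apply: (@lt_le_trans _ _ (4 * (s / 2 / n%:R) * D%:R ^+ 2)); last first.
    by rewrite ler_wpM2r ?exprn_ge0// ler_wpM2l.
  move: h; rewrite ltr_pdivrMr// => h.
  have -> : 4 * (s / 2 / n%:R) * D%:R ^+ 2 = D%:R ^+ 2 * (2 * s) / n%:R.
    by field; rewrite gt_eqF.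
  by rewrite ltr_pdivlMr.
(* The bound holds from every starting point [y], hence survives the average over the residuals. *)
have ac y := rademacher_anticoncentration y n0 wD f1 fout.
have qle : iter n (shiftavg q) f 0 <= 2 * D%:R / Num.sqrt n%:R.
  rewrite (iter_shiftavg_pair (resid x j0) (signed_vec u)).
  exact: iter_shiftavg_le.
have Dn : 2 * D%:R / Num.sqrt n%:R <= 2 * Num.sqrt (w / (2 * s)) + 2 / Num.sqrt n%:R.
  have -> : 2 * Num.sqrt (w / (2 * s)) + 2 / Num.sqrt n%:R =
      2 * (Num.sqrt (w / (2 * s)) * Num.sqrt n%:R + 1) / Num.sqrt n%:R.
    by field; rewrite gt_eqF.
  rewrite ler_wpM2r ?invr_ge0 ?(ltW sn0)// ler_wpM2l//.
  apply: le_trans Dle _; rewrite lerD2r -sqrtrM ?divr_ge0 ?(ltW s20)//.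
  by rewrite mulrAC.
have dd : n%:R * (K * (avg (fun a => mu (sqnorm (p a))) +
    avg (fun ab => mu (sqnorm (q ab))))) <= K * C1 * (g + (Num.sqrt n%:R)^-1).
  rewrite mulrCA -mulrA ler_wpM2l// mulrDr.
  apply: le_trans (lerD nmup nmuq) _.
  have /andP[g0 _] := g01.
  have B0 : 0 <= A * (1 + 8 * cc ^+ 3).
    by rewrite mulr_ge0// addr_ge0// mulr_ge0// exprn_ge0.
  have L20 : 0 <= 8 * (L * Num.sqrt L).
    by apply: mulr_ge0 => //; apply: mulr_ge0.
  have i0 : 0 <= (Num.sqrt n%:R)^-1 :> R by rewrite invr_ge0 ltW.
  rewrite /C1; set i := (Num.sqrt n%:R)^-1 in i0 *.
  have h1 := mulr_ge0 B0 i0; have h2 := mulr_ge0 L20 (ltW g0).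
  by lra.
move: dist; rewrite ler_norml => /andP[_ dist].
rewrite lerBlDr in dist; apply: le_trans dist _.
rewrite -addrA; apply: lerD => //.
exact: le_trans qle Dn.
Qed.

End sample_anticoncentration.
(** * Comparison with the sample, with high probability *)

Section typical_samples.
Context {R : realType} {dO : measure_display} {O : measurableType dO}
  (P : probability O R).

Lemma weak_law_family {dT : measure_display} {T : measurableType dT}
    (Y : nat -> {RV P >-> T}) (J : finType) (phi : J -> T -> R) :
  mutually_independent setT Y -> identically_distributed Y ->
  (forall j, measurable_fun setT (phi j)) ->
  (forall j, rint P (fun w => phi j (Y 0%N w))) ->
  forall e eta, 0 < e -> 0 < eta ->
  exists N, forall n, (N <= n)%N -> exists B : set O,
    [/\ measurable B, pr P B <= eta & forall w, ~ B w -> forall j,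
        `|avg (fun i : 'I_n => phi j (Y i w)) -
          Ex P (fun w => phi j (Y 0%N w))| <= e].
Proof.
move=> indY idY mphi iphi e eta e0 eta0.
suff H (r : seq J) eta' : 0 < eta' ->
  exists N, forall n, (N <= n)%N -> exists B : set O,
    [/\ measurable B, pr P B <= eta' & forall w, ~ B w -> forall j, j \in r ->
        `|avg (fun i : 'I_n => phi j (Y i w)) -
          Ex P (fun w => phi j (Y 0%N w))| <= e].
  have [N hN] := H (enum J) eta eta0.
  exists N => n /hN[B [mB pB hB]]; exists B; split => // w Bw j.
  by apply: hB => //; rewrite mem_enum.
elim: r eta' => [|j r IHr] eta' eta'0.
  exists 0%N => n _; exists set0; split => //.
  by rewrite /pr measure0 ltW.
have eta20 : 0 < eta' / 2 by rewrite divr_gt0.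
have [N1 hN1] := IHr _ eta20.
have [N2 hN2] := weak_law indY idY (mphi j) (iphi j) e0 eta20.
exists (maxn N1 N2) => n; rewrite geq_max => /andP[/hN1[B [mB pB hB]] /hN2].
set B' := [set w | _] => pB'.
have mB' : measurable B'.
  rewrite -[X in measurable X]setTI.
  apply: (measurable_fun_le measurableT (measurable_cst e)).
  apply: measurableT_comp => //; apply: measurable_funB => //.
  apply: measurable_funM => //; apply: measurable_sum => i.
  exact: (measurableT_comp (mphi j)).
exists (B `|` B'); split; first exact: measurableU.
  by apply: le_trans (prU_le _ mB mB') _; lra.
move=> w BB' k; rewrite inE => /predU1P[->|kr].
  by rewrite leNgt; apply/negP => ew; apply: BB'; right; rewrite /B'/= ltW.
by apply: hB => // Bw; apply: BB'; left.
Qed.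

Context {d : nat} (X : nat -> {RV P >-> d.-tuple R}).
Hypothesis indX : mutually_independent setT X.
Hypothesis idX : identically_distributed X.
Hypothesis X_mean : forall j, Ex P (fun w => vec (X 0%N w) 0 j) = 0.
Hypothesis X_int : rint P (fun w => sqnorm (vec (X 0%N w))).

Definition cov (j k : 'I_d) : R :=
  Ex P (fun w => vec (X 0%N w) 0 j * vec (X 0%N w) 0 k).

Lemma vmeasurable_X i : vmeasurable (fun w => vec (X i w)).
Proof. by apply: vmeasurable_comp => //; exact: vmeasurable_vec. Qed.

Lemma rint_coord j : rint P (fun w => vec (X 0%N w) 0 j).
Proof.
apply: (rint_le (g := fun w => 1 + sqnorm (vec (X 0%N w)))).
- exact: vmeasurable_X.
- move=> w; have := le_coord_sqnorm (vec (X 0%N w)) j.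
  move: (vec (X 0%N w) 0 j) => a ha.
  by rewrite ler_norml; apply/andP; split; nra.
- by apply: rintD => //; exact: rint_cst.
Qed.

Lemma rint_coordM j k :
  rint P (fun w => vec (X 0%N w) 0 j * vec (X 0%N w) 0 k).
Proof.
apply: (rint_le _ _ X_int).
  by apply: measurable_funM; exact: vmeasurable_X.
by move=> w; exact: normM_coord_le.
Qed.

(** For [n > 0] this is [|t|^2 min (1, |t| / sqrt n)]: dominated by [|t|^2], decreasing in [n] and
    tending to 0. *)
Definition lindeberg_fun (n : nat) (t : d.-tuple R) : R :=
  n%:R * mu (sqnorm (vec t) / n%:R).

Lemma measurable_lindeberg_fun n : measurable_fun setT (lindeberg_fun n).
Proof.
apply: measurable_funM => //.
apply: (measurableT_comp measurable_mu).
apply: measurable_funM => //.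
exact: (vborel_comp vborel_sqnorm (vmeasurable_vec)).
Qed.

Lemma lindeberg_funE n t : (0 < n)%N -> lindeberg_fun n t =
  sqnorm (vec t) * Num.min 1 (Num.sqrt (sqnorm (vec t) / n%:R)).
Proof.
move=> n0; rewrite /lindeberg_fun /mu mulrA; congr (_ * _).
by rewrite mulrCA mulfV ?mulr1// pnatr_eq0 -lt0n.
Qed.

Lemma lindeberg_fun_ge0 n t : 0 <= lindeberg_fun n t.
Proof. by rewrite mulr_ge0// mu_ge0// divr_ge0// sqnorm_ge0. Qed.

Lemma lindeberg_fun_le n t : lindeberg_fun n t <= sqnorm (vec t).
Proof.
case: n => [|n]; first by rewrite /lindeberg_fun mul0r sqnorm_ge0.
by rewrite lindeberg_funE// ler_piMr ?sqnorm_ge0// ge_min lexx.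
Qed.

Lemma lindeberg_fun_homo m n t : (0 < m)%N -> (m <= n)%N ->
  lindeberg_fun n t <= lindeberg_fun m t.
Proof.
move=> m0 mn; have n0 : (0 < n)%N by apply: leq_trans mn.
rewrite !lindeberg_funE// ler_wpM2l ?sqnorm_ge0//.
rewrite le_min !ge_min lexx/= ler_wsqrtr ?orbT//.
by rewrite ler_wpM2l ?sqnorm_ge0// lef_pV2 ?posrE ?ltr0n// ler_nat.
Qed.

Lemma rint_lindeberg n : rint P (fun w => lindeberg_fun n (X 0%N w)).
Proof.
apply: (rint_le _ _ X_int).
  by apply: (measurableT_comp (measurable_lindeberg_fun n)).
by move=> w; rewrite ger0_norm ?lindeberg_fun_ge0// lindeberg_fun_le.
Qed.

Lemma Ex_lindeberg_fun_small e : 0 < e -> exists m, (0 < m)%N /\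
  Ex P (fun w => lindeberg_fun m (X 0%N w)) <= e.
Proof.
move=> e0.
have [] := @Ex_dominated R dO O P (fun n w => lindeberg_fun n (X 0%N w))
    (fun w => sqnorm (vec (X 0%N w))) _ X_int _ _ e e0.
- by move=> n; apply: (measurableT_comp (measurable_lindeberg_fun n)).
- by move=> n w; rewrite ger0_norm ?lindeberg_fun_ge0// lindeberg_fun_le.
- move=> w e' e'0; set z := sqnorm (vec (X 0%N w)).
  have z0 : 0 <= z by exact: sqnorm_ge0.
  have [N hN] := le_nat_above ((z + 1) ^+ 3 / e' ^+ 2 + 1).
  exists N => n /hN h.
  have q0 : 0 <= (z + 1) ^+ 3 / e' ^+ 2 by rewrite divr_ge0// exprn_ge0//; lra.
  have nR0 : 0 < n%:R :> R by lra.
  have n0 : (0 < n)%N by rewrite -(ltr_nat R).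
  rewrite ger0_norm ?lindeberg_fun_ge0// lindeberg_funE//.
  apply: (@le_trans _ _ (z * Num.sqrt (z / n%:R))).
    by rewrite ler_wpM2l// ge_min lexx orbT.
  have w0 : 0 <= z * Num.sqrt (z / n%:R) by rewrite mulr_ge0.
  rewrite -(@ler_pXn2r _ 2) ?nnegrE ?(ltW e'0)// exprMn sqr_sqrtr ?divr_ge0//.
  have {h}h : (z + 1) ^+ 3 / e' ^+ 2 <= n%:R by lra.
  rewrite mulrA ler_pdivrMr//; rewrite ler_pdivrMr ?exprn_gt0// in h.
  have : z ^+ 2 * z <= (z + 1) ^+ 3.
    by rewrite -exprSr lerXn2r// ?nnegrE; lra.
  by lra.
move=> N hN; exists N.+1; split => //.
by apply: le_trans (hN N.+1 (leqnSn N)); rewrite ler_norm.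
Qed.

Lemma typical_samples g eta : 0 < g -> 0 < eta ->
  exists N, forall n, (N <= n)%N ->
    Ex P (fun w => lindeberg_fun n (X 0%N w)) <= g /\
    exists B : set O, [/\ measurable B, pr P B <= eta &
      forall w, ~ B w ->
        typical_sample cov (fun a : 'I_n => vec (X a w)) g].
Proof.
(* The weak law needs a function independent of [n], so [m] is frozen and monotonicity covers all
   [n >= m]. The [2 * g] is [g] for the expectation plus [g] for the deviation. *)
move=> g0 eta0; have [m [m0 hm]] := Ex_lindeberg_fun_small g0.
pose phi (j : 'I_d + 'I_d * 'I_d + unit) (t : d.-tuple R) : R :=
  match j with
  | inl (inl j) => vec t 0 j
  | inl (inr (j, k)) => vec t 0 j * vec t 0 k
  | inr _ => lindeberg_fun m t
  end.
have mphi j : measurable_fun setT (phi j).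
  case: j => [[j|[j k]]|[]]; rewrite /phi.
  - exact: vmeasurable_vec.
  - by apply: measurable_funM; exact: vmeasurable_vec.
  - exact: measurable_lindeberg_fun.
have iphi j : rint P (fun w => phi j (X 0%N w)).
  case: j => [[j|[j k]]|[]]; rewrite /phi.
  - exact: rint_coord.
  - exact: rint_coordM.
  - exact: rint_lindeberg.
have [N hN] := weak_law_family indX idX mphi iphi g0 eta0.
exists (maxn N m) => n; rewrite geq_max => /andP[/hN[B [mB pB hB]] mn].
split.
  apply: le_trans hm; apply: Ex_le; try exact: rint_lindeberg.
  by move=> w; exact: lindeberg_fun_homo.
exists B; split => // w Bw; have {}hB := hB w Bw; split.
- by move=> j; have := hB (inl (inl j)); rewrite /phi X_mean subr0.
- by move=> j k; exact: hB (inl (inr (j, k))).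
- apply: (@le_trans _ _ (avg (fun i : 'I_n => lindeberg_fun m (X i w)))).
    by apply: avg_le => i; exact: lindeberg_fun_homo.
  have := hB (inr tt); rewrite ler_norml => /andP[_].
  move: hm; rewrite /phi /=; set u := Ex P _; set v := avg _.
  by move=> h1 h2; lra.
Qed.

End typical_samples.

(** * Normalized sums against iterated averages of a typical sample *)

Section normalized_sums.
Context {R : realType} {d : nat} {dO : measure_display} {O : measurableType dO}
  (P : probability O R) (X : nat -> {RV P >-> d.-tuple R}).
Hypothesis indX : mutually_independent setT X.
Hypothesis idX : identically_distributed X.
Hypothesis X_mean : forall j, Ex P (fun w => vec (X 0%N w) 0 j) = 0.
Hypothesis X_int : rint P (fun w => sqnorm (vec (X 0%N w))).

Definition normalized_sum (n : nat) (w : O) : 'rV[R]_d :=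
  \sum_(i < n) (Num.sqrt n%:R)^-1 *: vec (X i w).

Definition sample (n : nat) (w : O) (a : 'I_n) : 'rV[R]_d := vec (X a w).

Lemma vmeasurable_normalized_sum n : vmeasurable (normalized_sum n).
Proof.
apply: vmeasurable_sum => i; apply: vmeasurableZ; exact: vmeasurable_X.
Qed.

(** The constant collects 1 from the true Lindeberg term, [16 + 8 d] from the centered sample, and
    [2] for each of the [d * d] covariance entries. *)
Lemma normalized_sum_shiftavg n w (g K : R) f : (0 < n)%N -> 0 < g <= 1 ->
  0 <= K -> typical_sample (cov X) (sample w (n := n)) g ->
  Ex P (fun w => lindeberg_fun n (X 0%N w)) <= g ->
  vborel f -> (forall x, 0 <= f x <= 1) -> expands K f ->
  `|Ex P (fun w' => f (normalized_sum n w')) -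
    iter n (shiftavg (centered (sample w (n := n)))) f 0| <=
  K * ((17 + 8 * d%:R + 2 * d%:R * d%:R) * g).
Proof.
move=> n0 g01 K0 [xm xc xmu] lg mf f01 fK.
have I0 : (0 < #|'I_n|)%N by rewrite card_ord.
have nR0 : 0 < n%:R :> R by rewrite ltr0n.
set p := centered (sample w (n := n)).
pose phi (t : d.-tuple R) : 'rV[R]_d := (Num.sqrt n%:R)^-1 *: vec t.
have mphi : vmeasurable phi by apply: vmeasurableZ; exact: vmeasurable_vec.
have isn2 : (Num.sqrt n%:R : R)^-1 ^+ 2 = n%:R^-1.
  by rewrite exprVn sqr_sqrtr.
have sqphi t : sqnorm (phi t) = sqnorm (vec t) / n%:R.
  by rewrite sqnormZ isn2 mulrC.
have iphi : rint P (fun w => sqnorm (phi (X 0%N w))).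
  have -> : (fun w => sqnorm (phi (X 0%N w))) =
      (fun w => n%:R^-1 * sqnorm (vec (X 0%N w))).
    by apply/funext => w'; rewrite sqphi mulrC.
  exact: rintZ.
have mphiX : vmeasurable (fun w => phi (X 0%N w)) by exact: vmeasurable_comp.
have phi0 j : Ex P (fun w => phi (X 0%N w) 0 j) = 0.
  have -> : (fun w => phi (X 0%N w) 0 j) =
      (fun w => (Num.sqrt n%:R)^-1 * vec (X 0%N w) 0 j).
    by apply/funext => w'; rewrite [in LHS]mxE.
  by rewrite ExZ ?X_mean ?mulr0//; exact: rint_coord.
have phicov j k : Ex P (fun w => phi (X 0%N w) 0 j * phi (X 0%N w) 0 k) =
    n%:R^-1 * cov X j k.
  have -> : (fun w => phi (X 0%N w) 0 j * phi (X 0%N w) 0 k) =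
      (fun w => n%:R^-1 * (vec (X 0%N w) 0 j * vec (X 0%N w) 0 k)).
    apply/funext => w'; rewrite -isn2.
    have e l : phi (X 0%N w') 0 l = (Num.sqrt n%:R)^-1 * vec (X 0%N w') 0 l.
      by rewrite [LHS]mxE.
    by rewrite !e; ring.
  by rewrite ExZ//; exact: rint_coordM.
have phimu : n%:R * Ex P (fun w => mu (sqnorm (phi (X 0%N w)))) <= g.
  apply: le_trans lg; rewrite -ExZ.
    rewrite le_eqVlt; apply/orP; left; apply/eqP; congr (Ex P _).
    by apply/funext => w'; rewrite sqphi.
  apply: (rint_le _ _ iphi).
    apply: (measurableT_comp measurable_mu).
    by have := rint_measurable iphi.
  by move=> w'; rewrite ger0_norm ?mu_ge0 ?mu_le ?sqnorm_ge0.
have p0 := centered_mean n0 (sample w (n := n)).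
have one := Ex_lindeberg I0 K0 mphiX iphi phi0 mf f01 fK p0.
set c := K * _ in one.
have := Ex_sum_shiftavg indX (m := n) (fun i _ => Logic.I) mphi I0 mf f01
  (c := c).
move=> h; apply: (@le_trans _ _ (n%:R * c)).
  apply: h => i x _; apply: le_trans (one x).
  rewrite (Ex_id idX (g := fun t => f (x + phi t)))//.
    apply: (vborel_comp mf); exact: vmeasurableD.
  apply: rint01 => //; apply: (vborel_comp mf); exact: vmeasurableD.
rewrite /c mulrCA ler_wpM2l// !mulrDr.
have pmu := centered_mu n0 g01 xm xmu.
have pcov : n%:R * (\sum_j \sum_k `|Ex P (fun w => phi (X 0%N w) 0 j *
    phi (X 0%N w) 0 k) - avg (fun i => p i 0 j * p i 0 k)|) <=
    2 * d%:R * d%:R * g.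
  have -> : 2 * d%:R * d%:R * g = \sum_(j < d) \sum_(k < d) (2 * g).
    under eq_bigr do rewrite sumr_const card_ord -mulr_natr.
    by rewrite sumr_const card_ord -[in RHS]mulr_natr; ring.
  rewrite big_distrr/=; apply: ler_sum => j _; rewrite big_distrr/=.
  apply: ler_sum => k _; rewrite phicov.
  rewrite -[X in X * `|_|]ger0_norm ?(ltW nR0)// -normrM mulrBr mulrA.
  rewrite mulfV ?gt_eqF// mul1r distrC.
  exact: centered_cov_close.
by move: pcov pmu phimu; rewrite -/p; lra.
Qed.

Lemma le_sqrt_above (a : R) : 0 <= a ->
  exists N, forall n, (N <= n)%N -> (0 < n)%N /\ a <= Num.sqrt n%:R.
Proof.
move=> a0; have [N hN] := le_nat_above (a ^+ 2 + 1).
exists N => n /hN h; have a20 := sqr_ge0 a; split.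
  by rewrite -(ltr_nat R); lra.
by rewrite -[leLHS]ger0_norm// -sqrtr_sqr ler_wsqrtr//; lra.
Qed.

Variable j0 : 'I_d.
Hypothesis cov0 : 0 < cov X j0 j0.

Lemma sample_comparison (K e : R) : 0 <= K -> 0 < e ->
  exists N, forall n, (N <= n)%N -> (0 < n)%N /\
  exists B : set O, [/\ measurable B, pr P B <= e & forall w, ~ B w ->
    let T := shiftavg (centered (sample w (n := n))) in
    [/\ forall f, vborel f -> (forall x, 0 <= f x <= 1) -> expands K f ->
          `|Ex P (fun w' => f (normalized_sum n w')) - iter n T f 0| <= e,
        forall f lo wd, 0 <= wd -> expands K f -> (forall s, f s <= 1) ->
          (forall s, ~~ (lo <= sqnorm s <= lo + wd) -> f s <= 0) ->
          iter n T f 0 <= e + 2 * Num.sqrt (wd / (2 * cov X j0 j0)) &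
        n%:R * avg (fun a => sqnorm (centered (sample w (n := n)) a)) <=
          \sum_j cov X j j + 2 * d%:R]].
Proof.
move=> K0 e0.
have [C1 [C10 hC1]] := sample_anticoncentration cov0.
have s0 := cov0; set s := cov X j0 j0 in s0 hC1 *.
pose D : R := 17 + 8 * d%:R + 2 * d%:R * d%:R.
have D0 : 0 <= D by rewrite /D !addr_ge0// ?mulr_ge0.
(* With [g <= e / A] the comparison error is at most [e] and [K * C1 * g] at most [e / 3]; a large
   [n] makes [(K * C1 + 2) / sqrt n] at most [e / 3]. *)
pose A := K * D + 3 * (K * C1) + 1.
have KD0 : 0 <= K * D by exact: mulr_ge0.
have KC0 : 0 <= K * C1 by exact: mulr_ge0.
have A0 : 0 < A by rewrite /A; lra.
pose g := Num.min (Num.min 1 (s / 4)) (e / A).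
have g0 : 0 < g by rewrite !lt_min ltr01 !divr_gt0.
have g1 : g <= 1 by rewrite !ge_min lexx.
have gs : 4 * g <= s.
  have : g <= s / 4 by rewrite !ge_min lexx orbT.
  by lra.
have gA : A * g <= e.
  have : g <= e / A by rewrite ge_min lexx orbT.
  by rewrite ler_pdivlMr// mulrC.
have g01 : 0 < g <= 1 by rewrite g0.
have [N1 hN1] := typical_samples indX idX X_mean X_int g0 e0.
have a0 : 0 <= 3 * (K * C1 + 2) / e.
  by rewrite divr_ge0 ?(ltW e0)// mulr_ge0// addr_ge0.
have [N2 hN2] := le_sqrt_above a0.
exists (maxn N1 N2) => n; rewrite geq_max => /andP[/hN1[lg [B [mB pB hB]]]].
move=> /hN2[n0 sn]; split => //; exists B; split => // w Bw T.
have ts := hB w Bw.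
have h3 : K * D * g + 3 * (K * C1 * g) + g <= e.
  by apply: le_trans gA; rewrite /A; lra.
have k1 : 0 <= K * D * g by rewrite mulr_ge0 ?(ltW g0).
have k2 : 0 <= K * C1 * g by rewrite mulr_ge0 ?(ltW g0).
have sn0 : 0 < Num.sqrt n%:R :> R by rewrite sqrtr_gt0 ltr0n.
split.
- move=> f mf f01 fK.
  apply: le_trans (normalized_sum_shiftavg n0 g01 K0 ts lg mf f01 fK) _.
  by rewrite mulrA -/D; lra.
- move=> f lo wd wd0 fK f1 fout.
  apply: le_trans (hC1 n _ g n0 g01 gs ts K lo wd f K0 wd0 fK f1 fout) _.
  rewrite ler_pdivrMr// in sn.
  have h4 : (K * C1 + 2) / Num.sqrt n%:R <= e / 3.
    by rewrite ler_pdivrMr//; lra.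
  rewrite mulrDl in h4; rewrite mulrDr.
  by lra.
- case: ts => xm xc xmu.
  exact: (avg_sqnorm_le n0 g01 xm xc).
Qed.

End normalized_sums.

(** * Second moments under iterated averages *)

Section iterated_averages_of_sqnorm.
Context {R : realType} {d : nat} {I : finType}.
Variable p : I -> 'rV[R]_d.
Hypothesis I0 : (0 < #|I|)%N.
Hypothesis p0 : forall j, avg (fun i => p i 0 j) = 0.

Lemma iter_shiftavg_mono (f g : 'rV[R]_d -> R) n :
  (forall x, f x <= g x) ->
  forall x, iter n (shiftavg p) f x <= iter n (shiftavg p) g x.
Proof. by move=> fg; elim: n => //= n IHn x; apply: avg_le => i. Qed.

Lemma iter_shiftavg_cst (c : R) n x :
  iter n (shiftavg p) (fun=> c) x = c.
Proof.
elim: n x => //= n IHn x; rewrite /shiftavg.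
by under eq_fun do rewrite IHn; rewrite avg_cst.
Qed.

Lemma iter_shiftavg_sqnorm (c : R) n x :
  iter n (shiftavg p) (fun y => c * sqnorm y) x =
  c * (sqnorm x + n%:R * avg (fun i => sqnorm (p i))).
Proof.
elim: n x => [|n IHn] x; first by rewrite mul0r addr0.
rewrite iterS /shiftavg.
under eq_fun do rewrite IHn sqnormD.
rewrite avgZ; congr (c * _); rewrite !avgD avgZ !(avg_cst _ I0).
have -> : avg (fun i => dotp x (p i)) = 0.
  by rewrite /dotp avg_sum big1// => j _; rewrite avgZ p0 mulr0.
by rewrite -natr1; ring.
Qed.

End iterated_averages_of_sqnorm.

(** * Distribution functions of V_n and of its bootstrap version *)

Section bootstrap_distribution.
Context {R : realType} {d : nat} {dO : measure_display} {O : measurableType dO}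
  (P : probability O R) (X : nat -> {RV P >-> d.-tuple R}).
Context {dS : measure_display} {S : measurableType dS} (Q : probability S R)
  (idx : nat -> nat -> {RV Q >-> nat}).

Lemma enorm_sqr (x : 'rV[R]_d) : enorm x ^+ 2 = sqnorm x.
Proof. by rewrite sqr_sqrtr// sqnorm_ge0. Qed.

Lemma VnE n w : (0 < n)%N -> Vn X n w = sqnorm (normalized_sum X n w).
Proof.
move=> n0; have nR0 : 0 < n%:R :> R by rewrite ltr0n.
rewrite /Vn enorm_sqr /sample_mean /normalized_sum -scaler_sumr !sqnormZ.
rewrite mulrA !exprVn sqr_sqrtr ?(ltW nR0)// expr2 invfM mulrA.
by rewrite divff ?mul1r ?gt_eqF.
Qed.

Definition boot_sum n w s : 'rV[R]_d :=
  \sum_(i < n) (Num.sqrt n%:R)^-1 *: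
    (vec (X (idx n i s) w) - sample_mean X n w).

Lemma VstarE n w s : (0 < n)%N -> Vstar X idx n w s = sqnorm (boot_sum n w s).
Proof.
move=> n0; have nR0 : 0 < n%:R :> R by rewrite ltr0n.
rewrite /Vstar enorm_sqr /xi_mean /boot_sum -scaler_sumr !sqnormZ.
rewrite mulrA !exprVn sqr_sqrtr ?(ltW nR0)// expr2 invfM mulrA.
by rewrite divff ?mul1r ?gt_eqF.
Qed.

Hypothesis hidx : resampling_indices idx.

(* Conditionally on the data, the bootstrap expectation is an [n]-fold iterated
   average over the centered sample. *)
Lemma Ex_boot_sum n w f : (0 < n)%N -> vborel f -> (forall x, 0 <= f x <= 1) ->
  Ex Q (fun s => f (boot_sum n w s)) =
  iter n (shiftavg (centered (sample X w (n := n)))) f 0.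
Proof.
move=> n0 mf f01; have [indn unifn] := hidx n.
pose phi (a : nat) : 'rV[R]_d :=
  (Num.sqrt n%:R)^-1 *: (vec (X a w) - sample_mean X n w).
have mphi : vmeasurable phi by move=> j.
have I0 : (0 < #|'I_n|)%N by rewrite card_ord.
(* For uniform resampling indices the one-step error is exactly 0, so the replacement bound becomes
   an identity. *)
have := Ex_sum_shiftavg indn (m := n) (fun i im => im) mphi I0 mf f01 (c := 0)
  (p := centered (sample X w (n := n))).
rewrite mulr0 => h; apply/eqP; rewrite -subr_eq0 -normr_le0.
apply: h => i x im; rewrite normr_le0 subr_eq0; apply/eqP.
rewrite (Ex_uniform (g := fun a => f (x + phi a)) n0)//.
by move=> j jn; exact: unifn.
Qed.

Definition boot_cdf n w (x : R) : R := pr Q [set s | Vstar X idx n w s <= x].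
Definition Vn_cdf n (x : R) : R :=
  pr P [set w | sqnorm (normalized_sum X n w) <= x].

Lemma measurable_le_set {dT : measure_display} {T : measurableType dT}
    (g : T -> R) (x : R) : measurable_fun setT g ->
  measurable [set t | g t <= x].
Proof.
move=> mg; rewrite -[X in measurable X]setTI.
exact: (measurable_fun_le measurableT mg (measurable_cst x)).
Qed.

Lemma measurable_sqnorm_sum n :
  measurable_fun setT (fun w => sqnorm (normalized_sum X n w)).
Proof. exact: (vborel_comp vborel_sqnorm (vmeasurable_normalized_sum X n)). Qed.

Lemma Vn_cdf_homo n x y : x <= y -> Vn_cdf n x <= Vn_cdf n y.
Proof.
move=> xy; apply: le_pr.
- exact/measurable_le_set/measurable_sqnorm_sum.
- exact/measurable_le_set/measurable_sqnorm_sum.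
- by move=> w /= /le_trans; apply.
Qed.

Lemma boot_cdf_homo n w x y : x <= y -> boot_cdf n w x <= boot_cdf n w y.
Proof.
move=> xy; apply: le_pr.
- exact/measurable_le_set/measurable_Vstar.
- exact/measurable_le_set/measurable_Vstar.
- by move=> s /= /le_trans; apply.
Qed.

Hypothesis indX : mutually_independent setT X.
Hypothesis idX : identically_distributed X.
Hypothesis X_mean : forall j, Ex P (fun w => vec (X 0%N w) 0 j) = 0.
Hypothesis X_int : rint P (fun w => sqnorm (vec (X 0%N w))).
Variable j0 : 'I_d.
Hypothesis cov0 : 0 < cov X j0 j0.

Lemma expands_ge0 (K : R) (f : 'rV[R]_d -> R) : expands K f -> 0 <= K.
Proof.
by move=> /(_ 0)[l [b [bK _]]]; apply: le_trans (bK j0 j0).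
Qed.

Lemma exists_outside (B : set O) : measurable B -> pr P B < 1 ->
  exists w, ~ B w.
Proof.
move=> mB pB; apply: contrapT => /forallNP h.
have BT : B = setT by apply/seteqP; split=> // w _; exact: contrapT (h w).
by move: pB; rewrite BT /pr probability_setT ltxx.
Qed.

Lemma vborel_radial (h : R -> R) : measurable_fun setT h ->
  vborel (fun s : 'rV[R]_d => h (sqnorm s)).
Proof. by move=> mh; apply: (measurableT_comp mh); exact: vborel_sqnorm. Qed.

Lemma Ex_radial_ge n (h : R -> R) x : measurable_fun setT h ->
  (forall t, 0 <= h t <= 1) -> (forall t, t <= x -> h t = 1) ->
  Vn_cdf n x <= Ex P (fun w => h (sqnorm (normalized_sum X n w))).
Proof.
move=> mh h01 h1; apply: pr_le_Ex.
- exact/measurable_le_set/measurable_sqnorm_sum.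
- apply: rint01 => //; apply: (measurableT_comp mh).
  exact: measurable_sqnorm_sum.
- by move=> w; case/andP: (h01 (sqnorm (normalized_sum X n w))).
- by move=> w /= /h1 ->.
Qed.

Lemma Ex_radial_le n (h : R -> R) x : measurable_fun setT h ->
  (forall t, 0 <= h t <= 1) -> (forall t, x <= t -> h t = 0) ->
  Ex P (fun w => h (sqnorm (normalized_sum X n w))) <= Vn_cdf n x.
Proof.
move=> mh h01 h0; apply: Ex_le_pr.
- exact/measurable_le_set/measurable_sqnorm_sum.
- apply: rint01 => //; apply: (measurableT_comp mh).
  exact: measurable_sqnorm_sum.
- by move=> w; case/andP: (h01 (sqnorm (normalized_sum X n w))).
- by move=> w /= /negP; rewrite -ltNge => /ltW/h0 ->.
Qed.

Lemma Vn_tight e : 0 < e ->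
  exists M N, forall n, (N <= n)%N -> 1 - e <= Vn_cdf n M.
Proof.
move=> e0; pose tau := \sum_j cov X j j + 2 * d%:R.
(* Markov's inequality under the iterated average: [1 - h] is at most the squared norm over [M0],
   whose average is at most [tau / M0 <= e / 2]. *)
pose M0 := 2 * (`|tau| + 1) / e.
have M00 : 0 < M0 by rewrite divr_gt0// mulr_gt0// ltr_wpDl.
have [K hK] := @smooth_cutoff R d 1 M0 ltr01.
have [h [mh h01 h1 h0 hE]] := hK M0 (lexx _).
have K0 := expands_ge0 hE.
(* The [1 / 2] keeps the exceptional event from being everything, so that a good sample exists. *)
have e'0 : 0 < Num.min (e / 2) (1 / 2) by rewrite lt_min !divr_gt0.
have [N hN] := sample_comparison indX idX X_mean X_int cov0 K0 e'0.
exists (M0 + 1), N => n /hN[n0 [B [mB pB hB]]].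
have [w Bw] : exists w, ~ B w.
  apply: exists_outside => //; apply: le_lt_trans pB _.
  by rewrite gt_min; apply/orP; right; lra.
have [cmp _ tr] := hB w Bw.
have {cmp} := cmp _ (vborel_radial mh) (fun x => h01 _) hE.
set T := shiftavg _; set it := iter n T _ 0.
have I0 : (0 < #|'I_n|)%N by rewrite card_ord.
have it1 : 1 - it <= e / 2.
  have -> : 1 - it = iter n T (fun x => 1 - h (sqnorm x)) 0.
    by rewrite iter_shiftavgB iter_shiftavg_cst.
  apply: (@le_trans _ _ (iter n T (fun y => M0^-1 * sqnorm y) 0)).
    apply: iter_shiftavg_mono => y.
    have [yM|yM] := leP (sqnorm y) M0.
      by rewrite h1// subrr mulr_ge0 ?sqnorm_ge0// invr_ge0 ltW.
    apply: (@le_trans _ _ 1).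
      by have /andP[? _] := h01 (sqnorm y); lra.
    by rewrite mulrC ler_pdivlMr// mul1r ltW.
  rewrite iter_shiftavg_sqnorm//; last exact: centered_mean.
  rewrite sqnorm0 add0r mulrC ler_pdivrMr//.
  apply: le_trans tr _; rewrite -/tau /M0.
  have -> : e / 2 * (2 * (`|tau| + 1) / e) = `|tau| + 1.
    by field; rewrite gt_eqF.
  by have := ler_norm tau; lra.
have := Ex_radial_le n mh h01 h0; set E := Ex P _ => hE' cmp.
have {}cmp : `|E - it| <= e / 2 by apply: le_trans cmp _; rewrite ge_min lexx.
by move: cmp; rewrite ler_norml => /andP[? ?]; lra.
Qed.

(** [delta] must not depend on [M]: in the final argument the range of thresholds is a multiple of
    [delta]. Only [N] feels [M], through [K]. *)
Lemma Vn_anticoncentration e : 0 < e -> exists delta, 0 < delta /\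
  forall M, exists N, forall n, (N <= n)%N -> forall x, x <= M ->
    Vn_cdf n (x + delta) <= Vn_cdf n x + e.
Proof.
move=> e0; have s0 := cov0; set s := cov X j0 j0 in s0.
(* Chosen so that a band of width [3 * delta] contributes
   [2 * sqrt (3 * delta / (2 * s)) = e / 3]. *)
pose delta := 2 * s / 3 * (e / 6) ^+ 2.
have delta0 : 0 < delta by rewrite mulr_gt0 ?exprn_gt0 ?divr_gt0 ?mulr_gt0.
exists delta; split => // M.
have [K hK] := @smooth_cutoff R d delta (M + delta) delta0.
have [h [mh h01 h1 h0 hE]] := hK (M + delta) (lexx _).
have K0 : 0 <= K + K by rewrite addr_ge0 ?(expands_ge0 hE).
have e'0 : 0 < Num.min (e / 3) (1 / 2) by rewrite lt_min !divr_gt0.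
have [N hN] := sample_comparison indX idX X_mean X_int cov0 K0 e'0.
exists N => n /hN[n0 [B [mB pB hB]]] x xM.
have [w Bw] : exists w, ~ B w.
  apply: exists_outside => //; apply: le_lt_trans pB _.
  by rewrite gt_min; apply/orP; right; lra.
have xu : x + delta <= M + delta by rewrite lerD2r.
have xl : x - delta <= M + delta by lra.
have [hu [mu0 u01 u1 u0 uE]] := hK _ xu.
have [hl [ml l01 l1 l0 lE]] := hK _ xl.
(* [f] is 1 for squared norms in [[x, x + delta]] and 0 outside [[x - delta, x + 2 * delta]]. *)
pose f (y : 'rV[R]_d) := hu (sqnorm y) - hl (sqnorm y).
have f01 y : 0 <= f y <= 1.
  rewrite /f; have := u01 (sqnorm y); have := l01 (sqnorm y).
  have [yx|yx] := leP (sqnorm y) (x + delta); first by rewrite (u1 _ yx); lra.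
  by rewrite (l0 (sqnorm y)) ?subrK; lra.
have mf : vborel f by apply: measurable_funB; exact: vborel_radial.
have fE : expands (K + K) f by exact: expandsB.
have [cmp ac _] := hB w Bw; have {cmp} := cmp f mf f01 fE.
have {ac} := ac f (x - delta) (3 * delta) _ fE _ _.
set T := shiftavg _; set it := iter n T _ 0 => ac cmp.
have {}ac : it <= e / 3 + e / 3.
  have -> : e / 3 + e / 3 = e / 3 + 2 * Num.sqrt (3 * delta / (2 * s)).
    have -> : 3 * delta / (2 * s) = (e / 6) ^+ 2.
      by rewrite /delta; field; rewrite gt_eqF.
    by rewrite sqrtr_sqr ger0_norm; lra.
  apply: le_trans (ac _ _ _) _.
  - by rewrite mulr_ge0// ltW.
  - by move=> y; case/andP: (f01 y).
  - move=> y; rewrite negb_and -!ltNge => /orP[yl|yh].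
      by rewrite /f u1 ?l1 ?subrr//; lra.
    by rewrite /f u0 ?l0 ?subrr//; lra.
  - by rewrite lerD2r ge_min lexx.
have cmp' : `|Ex P (fun w' => f (normalized_sum X n w')) - it| <= e / 3.
  by apply: le_trans cmp _; rewrite ge_min lexx.
have EB : Ex P (fun w' => f (normalized_sum X n w')) =
    Ex P (fun w' => hu (sqnorm (normalized_sum X n w'))) -
    Ex P (fun w' => hl (sqnorm (normalized_sum X n w'))).
  by rewrite /f ExB//; apply: rint01 => //;
    apply: (measurableT_comp (f := _)) => //; exact: measurable_sqnorm_sum.
have hi := Ex_radial_ge n mu0 u01 u1.
have lo : Ex P (fun w' => hl (sqnorm (normalized_sum X n w'))) <= Vn_cdf n x.
  by apply: Ex_radial_le => // t xt; apply: l0; rewrite subrK.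
move: cmp'; rewrite EB ler_norml => /andP[_].
by lra.
Qed.

(** Cutoffs starting at [x - delta] and at [x] sandwich both distribution functions: [e / 2] is lost
    in the comparison and [e / 2] in an increment of [Vn_cdf]. The event [B] precedes [x], so the
    closeness is uniform. *)
Lemma boot_cdf_close e M : 0 < e ->
  exists N, forall n, (N <= n)%N -> (0 < n)%N /\ exists B : set O,
    [/\ measurable B, pr P B <= e & forall w, ~ B w -> forall x, x <= M ->
      `|boot_cdf n w x - Vn_cdf n x| <= e].
Proof.
move=> e0; have e20 : 0 < e / 2 by rewrite divr_gt0.
have [delta [delta0 hac]] := Vn_anticoncentration e20.
have [N1 hN1] := hac M.
have [K hK] := @smooth_cutoff R d delta M delta0.
have [h [mh h01 h1 h0 hE]] := hK M (lexx _).
have [N2 hN2] := sample_comparison indX idX X_mean X_int cov0 (expands_ge0 hE) e20.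
exists (maxn N1 N2) => n; rewrite geq_max => /andP[/hN1 ac /hN2[n0 [B [mB pB hB]]]].
split => //; exists B; split => // [|w Bw x xM].
  by apply: le_trans pB _; lra.
have [cmp _ _] := hB w Bw.
have mV : measurable [set s | Vstar X idx n w s <= x].
  exact/measurable_le_set/measurable_Vstar.
have mbs (g : R -> R) : measurable_fun setT g ->
    measurable_fun setT (fun s => g (sqnorm (boot_sum n w s))).
  move=> mg; have -> : (fun s => g (sqnorm (boot_sum n w s))) =
      g \o Vstar X idx n w by apply/funext => s /=; rewrite VstarE.
  by apply: measurableT_comp => //; exact: measurable_Vstar.
have xl : x - delta <= M by lra.
have [hu [mu0 u01 u1 u0 uE]] := hK _ xM.
have [hl [ml l01 l1 l0 lE]] := hK _ xl.
have cu := cmp _ (vborel_radial mu0) (fun x => u01 _) uE.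
have cl := cmp _ (vborel_radial ml) (fun x => l01 _) lE.
rewrite -(Ex_boot_sum w n0 (vborel_radial mu0) (fun x => u01 _)) in cu.
rewrite -(Ex_boot_sum w n0 (vborel_radial ml) (fun x => l01 _)) in cl.
have bu : boot_cdf n w x <= Ex Q (fun s => hu (sqnorm (boot_sum n w s))).
  apply: pr_le_Ex => //.
  - by apply: rint01 => //; exact: mbs.
  - by move=> s; case/andP: (u01 (sqnorm (boot_sum n w s))).
  - by move=> s /=; rewrite VstarE// => /u1 ->.
have bl : Ex Q (fun s => hl (sqnorm (boot_sum n w s))) <= boot_cdf n w x.
  apply: Ex_le_pr => //.
  - by apply: rint01 => //; exact: mbs.
  - by move=> s; case/andP: (l01 (sqnorm (boot_sum n w s))).
  - move=> s /= /negP; rewrite -ltNge VstarE// => /ltW xs.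
    by rewrite l0// subrK.
have pu : Ex P (fun w => hu (sqnorm (normalized_sum X n w))) <=
    Vn_cdf n (x + delta) by exact: Ex_radial_le.
have pl : Vn_cdf n (x - delta) <=
    Ex P (fun w => hl (sqnorm (normalized_sum X n w))) by exact: Ex_radial_ge.
have a1 := ac x xM.
have := ac (x - delta); rewrite subrK => a2.
have {}a2 : Vn_cdf n x <= Vn_cdf n (x - delta) + e / 2 by apply: a2; lra.
move: cu cl; rewrite !ler_norml => /andP[? ?] /andP[? ?].
by apply/andP; split; lra.
Qed.

End bootstrap_distribution.
Lemma measurable_lt_set {R : realType} {dT : measure_display}
    {T : measurableType dT} (g : T -> R) (x : R) : measurable_fun setT g ->
  measurable [set t | x < g t].
Proof.
move=> mg; have -> : [set t | x < g t] = ~` [set t | g t <= x].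
  by apply/seteqP; split=> t /=; rewrite ltNge => /negP.
exact/measurableC/measurable_le_set.
Qed.

(** * The bootstrap critical value *)

Section critical_value.
Context {R : realType} {d : nat} {dO : measure_display} {O : measurableType dO}
  (P : probability O R) (X : nat -> {RV P >-> d.-tuple R}).
Context {dS : measure_display} {S : measurableType dS} (Q : probability S R)
  (idx : nat -> nat -> {RV Q >-> nat}).
Hypothesis hidx : resampling_indices idx.

Lemma FstarE n w x : Fstar X idx n w x = (boot_cdf X idx n w x)%:E.
Proof.
rewrite /boot_cdf EFin_pr; last exact/measurable_le_set/measurable_Vstar.
by rewrite /Fstar /cdf /distribution /pushforward; congr (Q _).
Qed.

Lemma measurable_iter_shiftavg (I : finType) (p : O -> I -> 'rV[R]_d) f k Z :
  vborel f -> (forall i, vmeasurable (fun w => p w i)) -> vmeasurable Z ->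
  measurable_fun setT (fun w => iter k (shiftavg (p w)) f (Z w)).
Proof.
move=> mf mp; elim: k Z => [|k IHk] Z mZ; first exact: vborel_comp.
apply: measurable_funM; last exact: measurable_cst.
by apply: measurable_sum => i; apply: IHk; apply: vmeasurableD.
Qed.

(** As an iterated average of an indicator, the bootstrap distribution function is a finite
    expression in the data. *)
Lemma measurable_boot_cdf n x : (0 < n)%N ->
  measurable_fun setT (fun w => boot_cdf X idx n w x).
Proof.
move=> n0; pose f (y : 'rV[R]_d) : R := \1_[set t | t <= x] (sqnorm y).
have m1 : measurable [set t : R | t <= x].
  exact: (measurable_le_set x (@measurable_id _ _ setT)).
have mf : vborel f by apply: vborel_radial; exact: measurable_indic.
have f01 y : 0 <= f y <= 1.
  by rewrite /f indicE; case: (_ \in _); rewrite ?ler01 ?lexx.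
have -> : (fun w => boot_cdf X idx n w x) =
    (fun w => iter n (shiftavg (centered (sample X w (n := n)))) f 0).
  apply/funext => w; rewrite -(Ex_boot_sum X hidx w n0 mf f01).
  have mV : measurable [set s | Vstar X idx n w s <= x].
    exact/measurable_le_set/measurable_Vstar.
  rewrite /boot_cdf; have [_ <-] := pr_indic Q mV; congr (Ex Q _).
  apply/funext => s; rewrite /f -(VstarE X idx w s n0) !indicE.
  by congr (nat_of_bool _)%:R; apply/idP/idP => /set_mem h; exact/mem_set.
apply: (@measurable_iter_shiftavg 'I_n _ f n (fun=> 0)) => //.
move=> i; apply: vmeasurableZ.
have -> : (fun w => sample X w i - n%:R^-1 *: \sum_(b < n) sample X w b) =
    (fun w => sample X w i + (- n%:R^-1) *: \sum_(b < n) sample X w b).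
  by apply/funext => w; rewrite scaleNr.
apply: vmeasurableD; first exact: vmeasurable_X.
apply: vmeasurableZ; apply: vmeasurable_sum => b; exact: vmeasurable_X.
Qed.

Section quantile_of_bootstrap.
Variables (n : nat) (beta : R).
Hypothesis beta01 : 0 < beta < 1.

Let E w := [set x | beta <= boot_cdf X idx n w x].

Let quantileE w : quantile (Fstar X idx n w) beta = inf (E w).
Proof.
rewrite /quantile; congr inf; apply/seteqP.
by split=> x /=; rewrite FstarE lee_fin.
Qed.

(** With [E_nonempty], this ensures that [inf (E w)] is a genuine infimum and not a default value;
    it uses [0 < beta], the other [beta < 1]. *)
Let E_lb w : lbound (E w) 0.
Proof.
move=> x; rewrite /E/= => bx; rewrite leNgt; apply/negP => x0.
move: bx; rewrite leNgt => /negP; apply.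
rewrite /boot_cdf (_ : [set s | _] = set0).
  by rewrite /pr measure0; case/andP: beta01.
apply/seteqP; split=> // s /= /le_lt_trans /(_ x0).
by rewrite /Vstar ltNge mulr_ge0// sqr_ge0.
Qed.

Let E_nonempty w : E w !=set0.
Proof.
have /fine_cvgP[_ /cvgrPdist_le h] := cvg_cdfy1 (Vstar X idx n w : {RV Q >-> R}).
have /andP[b0 b1] := beta01.
have [|M [_ hM]] := h (1 - beta); first by lra.
exists (M + 1); rewrite /E/= -lee_fin -FstarE.
have {hM} := hM (M + 1); rewrite ltrDl ltr01 => /(_ isT) /=.
rewrite -/(Fstar X idx n w (M + 1)) FstarE/= lee_fin ler_norml => /andP[_].
by lra.
Qed.

(** Rational thresholds make the rejection event a countable union of measurable sets. *)
Lemma quantile_lt_iff w v : quantile (Fstar X idx n w) beta < v <->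
  exists r : rat, beta <= boot_cdf X idx n w (ratr r) /\ ratr r < v.
Proof.
rewrite quantileE; split=> [/(inf_lt (E_nonempty w))[y Ey yv]|[r [Er rv]]].
  have [r] := rat_in_itvoo yv; rewrite in_itv/= => /andP[yr rv].
  exists r; split => //; apply: le_trans Ey _.
  by apply: boot_cdf_homo; exact: ltW.
by apply: le_lt_trans rv; apply: ge_inf => //; exists 0; exact: E_lb.
Qed.

Lemma quantile_le w x : beta <= boot_cdf X idx n w x ->
  quantile (Fstar X idx n w) beta <= x.
Proof.
move=> bx; rewrite quantileE; apply: ge_inf => //.
by exists 0; exact: E_lb.
Qed.

Lemma quantile_ge w x : boot_cdf X idx n w x < beta ->
  x <= quantile (Fstar X idx n w) beta.
Proof.
move=> bx; rewrite quantileE; apply: lb_le_inf => // y; rewrite /E/= => yb.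
rewrite leNgt; apply/negP => /ltW/(boot_cdf_homo X idx n w).
by lra.
Qed.

Lemma measurable_rejection (V : O -> R) : (0 < n)%N -> measurable_fun setT V ->
  measurable [set w | quantile (Fstar X idx n w) beta < V w].
Proof.
move=> n0 mV.
have -> : [set w | quantile (Fstar X idx n w) beta < V w] =
    \bigcup_(r : rat) ([set w | beta <= boot_cdf X idx n w (ratr r)] `&`
                       [set w | ratr r < V w]).
  apply/seteqP; split=> w /=.
    by move=> /quantile_lt_iff[r [? ?]]; exists r.
  by move=> [r _ [? ?]]; apply/quantile_lt_iff; exists r.
apply: countable_bigcupT_measurable => [|r].
  exact: countableP.
apply: measurableI; last exact: measurable_lt_set.
rewrite -[X in measurable X]setTI; apply: measurable_fun_le => //.
exact: measurable_boot_cdf.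
Qed.

End quantile_of_bootstrap.

End critical_value.

(** * Moments of X_1 and nondegeneracy *)

Section moments.
Context {R : realType} {d : nat} {dO : measure_display} {O : measurableType dO}
  (P : probability O R) (X : nat -> {RV P >-> d.-tuple R}).

Lemma rint_sqnorm_of_expectation :
  ('E_P[fun w => (enorm (vec (X 0%N w)) ^+ 2)%R] < +oo)%E ->
  rint P (fun w => sqnorm (vec (X 0%N w))).
Proof.
rewrite unlock => h; apply/integrableP; split.
  apply/measurable_EFinP.
  exact: (vborel_comp vborel_sqnorm (vmeasurable_X X 0%N)).
apply: le_lt_trans h; rewrite le_eqVlt; apply/orP; left; apply/eqP.
apply: eq_integral => w _ /=.
by rewrite enorm_sqr ger0_norm// sqnorm_ge0.
Qed.

(** If all variances vanish, so does the mean squared norm; Markov's inequality at the levels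
    [1 / (k + 1)] then forces X_1 = 0 almost surely. *)
Lemma exists_cov_gt0 : rint P (fun w => sqnorm (vec (X 0%N w))) ->
  (P [set w | vec (X 0%N w) = 0%R] < 1)%E -> exists j, 0 < cov X j j.
Proof.
move=> iX; apply: contraPP => /forallNP h; apply/negP; rewrite -leNgt.
have cov_eq0 j : cov X j j = 0.
  apply: le_anti; rewrite leNgt; apply/andP; split; first exact/negP/h.
  by apply: Ex_ge0 => w; rewrite -expr2 sqr_ge0.
have Es : Ex P (fun w => sqnorm (vec (X 0%N w))) = 0.
  rewrite /sqnorm Ex_sum; last by move=> j; exact: (rint_coordM iX j j).
  by rewrite big1// => j _; exact: cov_eq0.
pose A k := [set w | k.+1%:R^-1 <= sqnorm (vec (X 0%N w))].
have msq : measurable_fun setT (fun w => sqnorm (vec (X 0%N w))).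
  exact: (vborel_comp vborel_sqnorm (vmeasurable_X X 0%N)).
have mA k : measurable (A k).
  rewrite -[X in measurable X]setTI.
  exact: (measurable_fun_le measurableT (measurable_cst _) msq).
have A0 k : P (A k) = 0%E.
  have k0 : 0 < k.+1%:R^-1 :> R by rewrite invr_gt0.
  have := markov_pr k0 iX (fun w => sqnorm_ge0 _); rewrite Es mul0r => p0.
  by rewrite -EFin_pr//; congr EFin; apply: le_anti; rewrite p0 pr_ge0.
have cupA0 : P (\bigcup_k A k) = 0%E.
  apply: measure_negligible; first exact: bigcup_measurable.
  apply: negligible_bigcup => k; apply/negligibleP; first exact: mA.
  exact: A0.
have -> : [set w | vec (X 0%N w) = 0] = ~` \bigcup_k A k.
  apply/seteqP; split=> w /=.
    move=> w0 [k _]; rewrite /A/= w0 sqnorm0 leNgt => /negP; apply.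
    by rewrite invr_gt0.
  move=> hA; apply/rowP => j; rewrite [RHS]mxE.
  have [w0|w0] := eqVneq (sqnorm (vec (X 0%N w))) 0.
    have := le_coord_sqnorm (vec (X 0%N w)) j; rewrite w0 => h0.
    by apply/eqP; rewrite -sqrf_eq0 eq_le h0 sqr_ge0.
  exfalso; apply: hA.
  have wp : 0 < sqnorm (vec (X 0%N w)) by rewrite lt_def w0 sqnorm_ge0.
  have [N hN] := le_nat_above (sqnorm (vec (X 0%N w)))^-1.
  exists N => //; rewrite /A/= -[leRHS]invrK lef_pV2 ?posrE ?invr_gt0//.
  exact: hN.
rewrite probability_setC; last exact: bigcup_measurable.
by rewrite cupA0 sube0.
Qed.

End moments.

(** An approximate inverse for an [F] that may jump: at the least grid point where [F] reaches [v],
    the preceding point is still below [v] and the increment is at most [e]. *)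
Lemma grid_quantile {R : realType} (F : R -> R) (delta v e : R) (k0 : nat) :
  0 < delta -> 0 <= v -> F (- delta) = 0 ->
  (forall x, x <= delta * k0%:R -> F (x + delta) <= F x + e) ->
  v <= F (delta * k0%:R) ->
  exists c, c <= delta * k0%:R /\ v <= F c <= v + e.
Proof.
move=> d0 v0 F0 Fe vk.
have ex : exists k, v <= F (delta * k%:R) by exists k0.
case: (ex_minnP ex) => k vFk kmin; have kk0 := kmin _ vk.
have kd : delta * k%:R <= delta * k0%:R by rewrite ler_pM2l// ler_nat.
exists (delta * k%:R); split => //; rewrite vFk/=.
have := Fe (delta * k%:R - delta); rewrite subrK => Fk.
have {Fk}Fk := Fk (le_trans _ kd).
apply: le_trans (Fk _) _; first by rewrite gerBl ltW.
(* For [k = 0] the preceding point is [- delta], where [F] vanishes. *)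
rewrite lerD2r; case: k vFk kmin {kk0 kd Fk} => [|k] vFk kmin.
  by rewrite mulr0 sub0r F0.
rewrite -natr1 mulrDr mulr1 addrK leNgt; apply/negP => /ltW/kmin.
by rewrite ltnn.
Qed.
(* [hnd] excludes the degenerate case X_1 = 0 a.s., in which V_n and the
   critical value both vanish a.s. and the rejection probability is 0. *)
Theorem proposition2 (R : realType) (d : nat) (hd : (0 < d)%N)
    (dO : measure_display) (O : measurableType dO) (P : probability O R)
    (X : nat -> {RV P >-> d.-tuple R})
    (hindep : mutually_independent [set: nat] X)
    (hid : identically_distributed X)
    (hmean : forall j : 'I_d, ('E_P[fun w => (vec (X 0%N w) 0 j)%R] = 0)%E)
    (hmom : ('E_P[fun w => (enorm (vec (X 0%N w)) ^+ 2)%R] < +oo)%E)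
    (hnd : (P [set w | vec (X 0%N w) = 0%R] < 1)%E)
    (dS : measure_display) (S : measurableType dS) (Q : probability S R)
    (idx : nat -> nat -> {RV Q >-> nat})
    (hidx : resampling_indices idx)
    (alpha : R) (halpha : 0 < alpha < 1) :
  P [set w | cstar X idx n alpha w < Vn X n w] @[n --> \oo] --> alpha%:E.
Proof.
have X_int := rint_sqnorm_of_expectation hmom.
have X_mean j : Ex P (fun w => vec (X 0%N w) 0 j) = 0.
  by have := hmean j; rewrite unlock /Ex /Rintegral => ->.
have [j0 cov0] := exists_cov_gt0 X_int hnd.
have /andP[a0 a1] := halpha; pose beta := 1 - alpha.
have b01 : 0 < beta < 1 by rewrite /beta; lra.
pose A n := [set w | cstar X idx n alpha w < Vn X n w].
have mA n : (0 < n)%N -> measurable (A n).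
  move=> n0; apply: measurable_rejection => //.
  have -> : Vn X n = (fun w => sqnorm (normalized_sum X n w)).
    by apply/funext => w; rewrite VnE.
  exact: measurable_sqnorm_sum.
apply/fine_cvgP; split.
  by exists 1%N => // n /= n0; rewrite fin_num_measure//; exact: mA.
apply/cvgrPdist_le => e e0.
(* The final error is [4 * eps]. The other two bounds keep the levels [beta - 3 * eps] and
   [beta + 2 * eps] between 0 and [1 - eps], where [grid_quantile] can reach them. *)
pose eps := Num.min (e / 4) (Num.min (beta / 3) (alpha / 4)).
have eps0 : 0 < eps by rewrite !lt_min !divr_gt0//; case/andP: b01.
have eps1 : eps <= e / 4 by rewrite ge_min lexx.
have eps2 : eps <= beta / 3 by rewrite !ge_min lexx orbT.
have eps3 : eps <= alpha / 4 by rewrite !ge_min lexx !orbT.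
have [delta [delta0 hac]] :=
  Vn_anticoncentration hindep hid X_mean X_int cov0 eps0.
have [M1 [N1 tight]] := Vn_tight hindep hid X_mean X_int cov0 eps0.
pose k0 := (Num.truncn (M1 / delta)).+1.
have Mk0 : M1 <= delta * k0%:R.
  by rewrite mulrC -ler_pdivrMr//; exact/ltW/truncnS_gt.
have [N2 ac] := hac (delta * k0%:R).
have [N3 close] := boot_cdf_close hidx hindep hid X_mean X_int cov0
  (delta * k0%:R) eps0.
exists (maxn N1 (maxn N2 N3)) => // n /=; rewrite !geq_max.
move=> /andP[/tight tn /andP[/ac an /close[n0 [B [mB pB hB]]]]].
set F := Vn_cdf X n in tn an hB.
have F0 : F (- delta) = 0.
  rewrite /F /Vn_cdf (_ : [set w | _] = set0) ?/pr ?measure0//.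
  apply/seteqP; split=> // w /= h.
  by have := sqnorm_ge0 (normalized_sum X n w); lra.
have Fk0 : 1 - eps <= F (delta * k0%:R).
  by apply: le_trans tn _; exact: Vn_cdf_homo.
(* Off [B] the bootstrap distribution function is within [eps] of [F], hence above [beta] at [cp]
   and below [beta] at [cm]; so the critical value lies between [cm] and [cp]. *)
have [cp [cpM /andP[cp1 cp2]]] : exists c, c <= delta * k0%:R /\
    beta + 2 * eps <= F c <= beta + 2 * eps + eps.
  by apply: (grid_quantile delta0 _ F0 an); rewrite /beta in b01 eps2 *; lra.
have [cm [cmM /andP[cm1 cm2]]] : exists c, c <= delta * k0%:R /\
    beta - 3 * eps <= F c <= beta - 3 * eps + eps.
  by apply: (grid_quantile delta0 _ F0 an); rewrite /beta in b01 eps2 *; lra.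
have gtE c : pr P [set w | c < Vn X n w] = 1 - F c.
  have mc : measurable [set w | sqnorm (normalized_sum X n w) <= c].
    exact/measurable_le_set/measurable_sqnorm_sum.
  rewrite /F /Vn_cdf -pr_setC//; congr (pr P _).
  by apply/seteqP; split=> w /=; rewrite VnE// ltNge => /negP.
have mgt c : measurable [set w | c < Vn X n w].
  have -> : Vn X n = (fun w => sqnorm (normalized_sum X n w)).
    by apply/funext => w; rewrite VnE.
  exact/measurable_lt_set/measurable_sqnorm_sum.
have upper : pr P (A n) <= eps + (1 - F cm).
  rewrite -gtE; apply: (@le_trans _ _ (pr P (B `|` [set w | cm < Vn X n w]))).
    apply: le_pr; [exact: mA|exact: measurableU|move=> w Aw].
    have [Bw|Bw] := pselect (B w); [by left|right => /=].
    apply: le_lt_trans Aw; apply: quantile_ge => //.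
    by have := hB w Bw cm cmM; rewrite -/beta ler_norml => /andP[? ?]; lra.
  by apply: le_trans (prU_le _ mB (mgt cm)) _; rewrite lerD2r.
have lower : 1 - F cp <= eps + pr P (A n).
  rewrite -gtE; apply: (@le_trans _ _ (pr P (B `|` A n))).
    apply: le_pr; [exact: mgt|apply: measurableU => //; exact: mA|move=> w cw].
    have [Bw|Bw] := pselect (B w); [by left|right].
    rewrite /A/=; apply: le_lt_trans cw; apply: quantile_le => //.
    by have := hB w Bw cp cpM; rewrite -/beta ler_norml => /andP[? ?]; lra.
  by apply: le_trans (prU_le _ mB (mA n n0)) _; rewrite lerD2r.
rewrite -[fine _]/(pr P (A n)) /beta in cm1 cm2 cp1 cp2 *.
by rewrite ler_norml; apply/andP; split; lra.
Qed.
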